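(* Let $\mathcal{B}=\{B_t\}_{t\in G}$ be a Fell bundle over a discrete group $G$ with unit $e$, and suppose that the primitive ideal space $\mathrm{Prim}(B_e)$ (with the Jacobson topology) of the unit fiber $B_e$ is Hausdorff. If the partial action $(\{\mathrm{Prim}(D_t)\}_{t\in G},\{h_t\}_{t\in G})$ on $\mathrm{Prim}(B_e)$ dual to $\mathcal{B}$ is topologically free, then $\mathcal{B}$ is aperiodic.
   Context: Products of subspaces of a $C^*$-algebra denote closed linear spans of products. A Fell bundle $\mathcal{B}=\{B_t\}_{t\in G}$ over a discrete group $G$ with unit $e$ is a collection of closed subspaces of a $C^*$-algebra such that $B_t^*=B_{t^{-1}}$ and $B_tB_s\subseteq B_{ts}$ for all $s,t\in G$; in particular $B_e$ is a $C^*$-algebra. Dual partial action: $D_t:=B_tB_{t^{-1}}$ is an ideal in $B_e$, and $\mathrm{Prim}(D_t)$ is identified with the open set $\{P\in\mathrm{Prim}(B_e):P\nsupseteq D_t\}$ via $P\mapsto P\cap D_t$. The map $h_t:\mathrm{Prim}(D_{t^{-1}})\to\mathrm{Prim}(D_t)$ is the homeomorphism given on primitive ideals $I$ of $D_{t^{-1}}$ by $h_t(I)=B_tIB_{t^{-1}}$. These form a partial action of $G$ on $\mathrm{Prim}(B_e)$. A partial action $(\{\Omega_t\}_{t\in G},\{\theta_t\}_{t\in G})$ of $G$ on a topological space $\Omega$ consists of open sets $\Omega_t\subseteq\Omega$ and homeomorphisms $\theta_t:\Omega_{t^{-1}}\to\Omega_t$ with $\theta_e=\mathrm{id}_\Omega$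 and $\theta_{st}$ extending $\theta_s\circ\theta_t$. It is topologically free if for every finite set $F\subseteq G\setminus\{e\}$ the set $\bigcup_{t\in F}\{x\in\Omega_{t^{-1}}:\theta_t(x)=x\}$ has empty interior in $\Omega$. $\mathcal{B}$ is aperiodic if for each $t\in G\setminus\{e\}$, each $b_t\in B_t$ and every non-zero hereditary $C^*$-subalgebra $D$ of $B_e$, $\inf\{\|ab_ta\|: a\in D^+,\ \|a\|=1\}=0$. *)

(* Defs.v *)
From HB Require Import structures.
From mathcomp Require Import all_boot all_order all_algebra.
From mathcomp Require Import complex.
From mathcomp Require Import all_classical all_reals all_analysis.

Set Implicit Arguments.
Unset Strict Implicit.
Unset Printing Implicit Defensive.

Import Order.TTheory GRing.Theory Num.Theory.
Import numFieldNormedType.Exports.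

Local Open Scope classical_set_scope.
Local Open Scope ring_scope.

#[local] Identity Coercion fun_of_set : set >-> Funclass.

(* Norms on modules over R[i] take their values in R[i]; they are real and
   nonnegative there. *)
Definition rnorm (R : realType) (V : normedModType R[i]) (x : V) : R :=
  complex.Re `|x|.

Definition closed_subspace (R : realType) (V : normedModType R[i])
    (S : set V) : Prop :=
  [/\ closed S, S 0 &
      forall (k : R[i]) (x y : V), S x -> S y -> S (k *: x + y)].

Definition closed_span (R : realType) (V : normedModType R[i])
    (S : set V) : set V :=
  smallest (@closed_subspace R V) S.

(* C*-algebras need not be unital, so the ring structures of MathComp, which
   all have a unit, do not apply. *)
HB.mixin Record isCstarAlgebra (R : realType) A
    of CompleteNormedModule R[i] A := {
  cmul : A -> A -> A ;
  cstar : A -> A ;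
  cmulA : associative cmul ;
  cmulDl : left_distributive cmul +%R ;
  cmulDr : right_distributive cmul +%R ;
  cmulZl : forall (k : R[i]) (a b : A), cmul (k *: a) b = k *: cmul a b ;
  cmulZr : forall (k : R[i]) (a b : A), cmul a (k *: b) = k *: cmul a b ;
  cstarK : involutive cstar ;
  cstarD : {morph cstar : a b / a + b} ;
  cstarZ : forall (k : R[i]) (a : A), cstar (k *: a) = k^* *: cstar a ;
  cstarM : forall a b : A, cstar (cmul a b) = cmul (cstar b) (cstar a) ;
  cnormM : forall a b : A, `|cmul a b| <= `|a| * `|b| ;
  cnorm_star : forall a : A, `|cmul (cstar a) a| = `|a| ^+ 2
}.

#[short(type="cstarAlgType")]
HB.structure Definition CstarAlgebra (R : realType) :=
  {A of isCstarAlgebra R A & CompleteNormedModule R[i] A}.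

Declare Scope cstar_scope.
Infix "**" := cmul (at level 40, left associativity) : cstar_scope.
Notation "a ^#" := (cstar a) (at level 2, format "a ^#") : cstar_scope.
Local Open Scope cstar_scope.

Definition mulspan (R : realType) (A : cstarAlgType R) (S T : set A) : set A :=
  closed_span [set a ** b | a in S & b in T].

Record cstar_subalgebra (R : realType) (A : cstarAlgType R) := CstarSubalgebra {
  subalg_set :> set A ;
  subalg_closed_subspace : closed_subspace subalg_set ;
  subalg_mul : forall a b, subalg_set a -> subalg_set b -> subalg_set (a ** b) ;
  subalg_star : forall a, subalg_set a -> subalg_set a^#
}.

Definition positive_in (R : realType) (A : cstarAlgType R) (S : set A) : set A :=
  [set x^# ** x | x in S].

Definition hereditary (R : realType) (A : cstarAlgType R)
    (S D : cstar_subalgebra A) : Prop :=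
  D `<=` S /\
  forall a b : A, D a -> positive_in S b -> positive_in S (a - b) -> D b.

Record hilbertSpace (R : realType) := HilbertSpace {
  hilbert_carrier :> completeNormedModType R[i] ;
  hdot : {dot hilbert_carrier for (@Num.conj R[i])} ;
  hdotE : forall x : hilbert_carrier, `|x| ^+ 2 = hdot x x
}.

(* A representation of a subalgebra S is a map on the ambient algebra of which
   only the values on S matter. *)
Record representation (R : realType) (A : cstarAlgType R)
    (S : cstar_subalgebra A) (H : hilbertSpace R) (rho : A -> H -> H) : Prop :=
  Representation {
  rep_linear : forall a, S a -> linear (rho a) ;
  rep_continuous : forall a, S a -> continuous (rho a) ;
  repP : forall (k : R[i]) a b x, S a -> S b ->
    rho (k *: a + b) x = k *: rho a x + rho b x ;
  repM : forall a b x, S a -> S b -> rho (a ** b) x = rho a (rho b x) ;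
  rep_star : forall a x y, S a -> hdot H (rho a x) y = hdot H x (rho a^# y)
}.

Definition irreducible_rep (R : realType) (A : cstarAlgType R)
    (S : cstar_subalgebra A) (H : hilbertSpace R) (rho : A -> H -> H) : Prop :=
  [/\ representation S rho,
      exists a x, S a /\ rho a x <> 0 &
      forall M : set H, closed_subspace M ->
        (forall a x, S a -> M x -> M (rho a x)) -> M = [set 0] \/ M = setT].

Definition primitive (R : realType) (A : cstarAlgType R)
    (S : cstar_subalgebra A) (P : set A) : Prop :=
  exists (H : hilbertSpace R) (rho : A -> H -> H),
    irreducible_rep S rho /\ P = [set a | S a /\ forall x, rho a x = 0].

Record Prim (R : realType) (A : cstarAlgType R) (S : cstar_subalgebra A) :=
  PrimIdeal {
  prim_set :> set A ;
  prim_primitive : primitive S prim_set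
}.

Section Jacobson_topology.
Context (R : realType) (A : cstarAlgType R) (S : cstar_subalgebra A).
Implicit Types (P Q : Prim S) (X : set (Prim S)).

Definition hull (I : set A) : set (Prim S) := [set P | I `<=` P].

Definition kernel X : set A := [set a | S a /\ forall P, X P -> P a].

(* open sets are the complements of the sets closed for the hull-kernel
   closure *)
Definition jacobson_open X : Prop := hull (kernel (~` X)) `<=` ~` X.

Lemma prim_prime P (a b : A) : S a -> S b -> P (a ** b) ->
  (forall c, S c -> P (a ** c ** b)) -> P a \/ P b.
Proof.
case: P => P /= [H [rho [[rep _ irr] ->]]] Sa Sb [_ ab0] acb0.
have [b0|/existsNP[x bx]] := pselect (forall x, rho b x = 0); first by right.
left; split => // y; have [_ S0 _] := subalg_closed_subspace S.
pose M := [set y | rho a y = 0 /\ forall c, S c -> rho a (rho c y) = 0].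
have lin d (Sd : S d) k u v : rho d (k *: u + v) = k *: rho d u + rho d v.
  exact: (rep_linear rep Sd).
have rho0 d (Sd : S d) : rho d 0 = 0.
  by have := lin d Sd (-1) 0 0; rewrite !scaleN1r !addNr.
have cl0 (f : H -> H) : continuous f -> closed [set y | f y = 0].
  move=> cf; rewrite -[X in closed X]/(f @^-1` [set 0]).
  apply: closed_comp => [z _|]; first exact: cf.
  exact/accessible_closed_set1/hausdorff_accessible/norm_hausdorff.
have clM : closed_subspace M.
  split.
  - have -> : M = [set y | rho a y = 0] `&`
        \bigcap_(c in S) [set y | rho a (rho c y) = 0].
      by apply/seteqP; split.
    apply: closedI; first exact/cl0/(rep_continuous rep).
    apply: closed_bigI => c Sc; apply: (cl0 (rho a \o rho c)) => z.
    by apply: continuous_comp; apply: (rep_continuous rep).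
  - by split=> [|c Sc]; rewrite !rho0.
  - move=> k u v [u0 cu0] [v0 cv0]; split=> [|c Sc].
      by rewrite lin // u0 v0 scaler0 addr0.
    by rewrite !lin // cu0 // cv0 // scaler0 addr0.
have Minv d u : S d -> M u -> M (rho d u).
  move=> Sd [u0 cu0]; split=> [|c Sc]; first exact: cu0.
  by rewrite -(repM rep u Sc Sd); apply: cu0; apply: subalg_mul.
have Mbx : M (rho b x).
  split=> [|c Sc]; first by rewrite -(repM rep).
  have [_ /(_ x)] := acb0 c Sc.
  by rewrite !(repM rep) //; apply: subalg_mul.
case: (irr M clM Minv) => ME.
  by move: Mbx; rewrite ME => /= /bx.
by have [] : M y by rewrite ME.
Qed.

Lemma prim_mul P (a b : A) : S a -> S b -> P a \/ P b -> P (a ** b).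
Proof.
case: P => P /= [H [rho [[rep _ _] ->]]] Sa Sb ab.
split; first exact: subalg_mul.
move=> x; rewrite (repM rep) //; case: ab => -[_ z]; rewrite z //.
have := rep_linear rep Sa (-1) 0 0.
by rewrite !scaleN1r !addNr.
Qed.

Lemma jacobson_openT : jacobson_open setT.
Proof.
move=> P kP _; have [H [rho [[_ [a [x [Sa ax]]] _] PE]]] := prim_primitive P.
have : P a by apply: kP; split=> // Q; rewrite setCT.
by rewrite PE => -[_ /(_ x)].
Qed.

Lemma jacobson_openI : setI_closed jacobson_open.
Proof.
move=> X Y oX oY P kP [XP YP].
have /existsNP[a /not_implyP[[Sa ka] Pa]] : ~ hull (kernel (~` X)) P.
  by move/oX.
have /existsNP[b /not_implyP[[Sb kb] Pb]] : ~ hull (kernel (~` Y)) P.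
  by move/oY.
suff [] : P a \/ P b by [].
have ker c : S c -> (forall Q, (~` (X `&` Y)) Q -> Q c) -> P c.
  by move=> Sc h; apply: kP; split=> // Q; apply: h.
apply: prim_prime => // [|c Sc]; apply: ker.
- exact: subalg_mul.
- move=> Q; rewrite setCI => -[/ka|/kb] h; apply: prim_mul => //; tauto.
- by apply: subalg_mul => //; apply: subalg_mul.
- move=> Q; rewrite setCI => -[/ka|/kb] h; apply: prim_mul => //.
  + exact: subalg_mul.
  + by left; apply: prim_mul => //; left.
  + exact: subalg_mul.
  + by right.
Qed.

Lemma jacobson_open_bigU (I : Type) (f : I -> set (Prim S)) :
  (forall i, jacobson_open (f i)) -> jacobson_open (\bigcup_i f i).
Proof.
move=> of_ P kP [i _ fiP]; apply: (of_ i P _ fiP) => a [Sa ka].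
apply: kP; split=> // Q nfQ; apply: ka => fiQ; apply: nfQ; by exists i.
Qed.

HB.instance Definition _ := gen_eqMixin (Prim S).
HB.instance Definition _ := gen_choiceMixin (Prim S).
HB.instance Definition _ := isOpenTopological.Build (Prim S)
  jacobson_openT jacobson_openI jacobson_open_bigU.

End Jacobson_topology.

Record fellBundle (R : realType) (G : groupType) (A : cstarAlgType R) :=
  FellBundle {
  fiber :> G -> set A ;
  fiber_closed_subspace : forall t, closed_subspace (fiber t) ;
  fiber_star : forall t, [set b^# | b in fiber t] = fiber (t^-1)%g ;
  fiber_mul : forall t s, mulspan (fiber t) (fiber s) `<=` fiber (t * s)%g
}.

Section Fell_bundle.
Context (R : realType) (G : groupType) (A : cstarAlgType R).
Variable B : fellBundle G A.
Implicit Types (s t : G).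

Lemma unit_fiber_mul a b : B 1%g a -> B 1%g b -> B 1%g (a ** b).
Proof.
move=> Ba Bb; rewrite -[X in B X](mulg1 1%g); apply: fiber_mul.
by apply: sub_gen_smallest; exists a => //; exists b.
Qed.

Lemma unit_fiber_star a : B 1%g a -> B 1%g a^#.
Proof. by move=> Ba; rewrite -[X in B X]invg1 -fiber_star; exists a. Qed.

Definition unit_fiber : cstar_subalgebra A :=
  CstarSubalgebra (fiber_closed_subspace B 1%g) unit_fiber_mul unit_fiber_star.

Definition dual_ideal t : set A := mulspan (B t) (B (t^-1)%g).

(* Prim(D_t), as a subset of Prim(B_e) *)
Definition dual_dom t : set (Prim unit_fiber) :=
  [set P | ~ (dual_ideal t `<=` P)].

Definition induced_ideal t (I : set A) : set A :=
  mulspan (mulspan (B t) I) (B (t^-1)%g).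

(* The graph of h_t, for the identification of P in Prim(B_e) with the
   primitive ideal P `&` D_t of D_t: "h_t(P) = Q". *)
Definition dual_map t (P Q : Prim unit_fiber) : Prop :=
  [/\ dual_dom (t^-1)%g P, dual_dom t Q &
      induced_ideal t (P `&` dual_ideal (t^-1)%g) = Q `&` dual_ideal t].

Definition aperiodic : Prop :=
  forall (t : G) (b : A) (D : cstar_subalgebra A), t <> 1%g -> B t b ->
    hereditary unit_fiber D -> (exists2 d, D d & d <> 0) ->
    ereal_inf [set (rnorm (a ** b ** a))%:E
              | a in [set a | positive_in D a /\ rnorm a = 1]] = 0%E.

End Fell_bundle.

Arguments dual_dom {R G A} B t.
Arguments dual_map {R G A} B t P Q.

(* Topological freeness of the partial action with domains [Om t] and partial
   homeomorphisms theta_t : Om t^-1 -> Om t given by their graphs: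
   [theta t x y] reads "theta_t(x) = y". *)
Definition topologically_free (G : groupType) (X : topologicalType)
    (Om : G -> set X) (theta : G -> X -> X -> Prop) : Prop :=
  forall F : set G, finite_set F -> ~ F 1%g ->
    interior (\bigcup_(t in F) [set x | Om (t^-1)%g x /\ theta t x x]) = set0.

(* Main.v *)
Require Import Defs.
From HB Require Import structures.
From mathcomp Require Import all_boot all_order all_algebra.
From mathcomp Require Import complex ring lra.
From mathcomp Require Import all_classical all_reals all_analysis.

Set Implicit Arguments.
Unset Strict Implicit.
Unset Printing Implicit Defensive.

Import Order.TTheory GRing.Theory Num.Theory.
Import numFieldNormedType.Exports.

Local Open Scope classical_set_scope.
Local Open Scope ring_scope.
Local Open Scope cstar_scope.

#[local] Identity Coercion fun_of_set : set >-> Funclass.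

(** Let [b] be in [B_t] with [t] not the unit, and [D] a nonzero hereditary
subalgebra of [B_e]. The infimum of aperiodicity is in fact attained: there is a
positive [a] of norm one in [D] with [a b a = 0].

If no primitive ideal in the domain of [h_t] is in the open set of the ideals
that do not contain a given positive [d] in [D], then [b^* b d] is in every
primitive ideal, so it is zero, and [b d = 0]. Otherwise topological freeness gives
in this open set a primitive ideal [P] that is not fixed by [h_t]. Put
[Q = h_t(P)], and let [U] and [V] be disjoint neighbourhoods of [P] and [Q]. There
are [u] not in [P] that belongs to all primitive ideals outside [U], and [v] not in
[Q] that belongs to all those outside [V]. Then [u B_e v^*] is in every primitive
ideal, hence zero. As [Q] is the set of the [x] with [B_t^* x B_t] in [P], there
are [c] and [c'] in [B_t] with [c^* v c'] not in [P], and as [P] is prime, there are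
[r] and [s] in [B_e] such that [y = u r c^* v c' s d] is not in [P]. Then [e = y^* y]
is a nonzero positive element, in [D] because [D] is hereditary, and [e b e = 0],
since the middle of this product is [u] times an element of [B_e] times [v^*]
([exists_compression]).

Two facts about primitive ideals carry this argument. First, they separate the
elements of a C*-algebra ([prim_separates]). This needs the positivity of [y^* y]
([pos_star_mul]), which is proved in the unitization with square roots given by a
convergent iteration ([exists_sqrt_defect]); an extreme positive functional, which
Zorn's lemma provides ([extreme_dominated]); and the Hilbert space of this
functional, on which the representation is irreducible ([pure_irreducible]).

Second, [h_t(P)] is a primitive ideal for every [P] in the domain of [h_t]
([exists_dual_map]). If [P] is the kernel of an irreducible representation with a
vector [xi], the form [x, y |-> <y^* x xi, xi>] on [B_t] has a Hilbert space
completion on which [B_e] acts; this representation is irreducible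
([induced_irreducible]), with kernel the set of the [a] such that [B_t^* a B_t] is
in [P] ([induced_kernel]). That this kernel agrees with [B_t I B_t^*] inside [D_t]
([induced_idealE]) holds because every element is a sum of a series of cubes
[a a^* a] of elements of the ideal it generates ([cubes_span]). *)

(** * Real-valued norms and sequences *)

Section RealNorm.
Context (R : realType).

Lemma ge0_ReE (z : R[i]) : 0 <= z -> z = (complex.Re z)%:C%C.
Proof. by move=> /ger0_Im z0; rewrite [LHS]complexE z0 mulr0 addr0. Qed.

Lemma cgt0P (z : R[i]) : 0 < z -> 0 < complex.Re z /\ z = (complex.Re z)%:C%C.
Proof. by move=> z0; have zE := ge0_ReE (ltW z0); split=> //; rewrite -ltcR -zE. Qed.

Definition cabs (z : R[i]) : R := complex.Re `|z|.

Lemma cabsE (z : R[i]) : `|z| = (cabs z)%:C%C.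
Proof. exact/ge0_ReE/normr_ge0. Qed.

Lemma cabs_ge0 (z : R[i]) : 0 <= cabs z.
Proof. by rewrite -lecR -cabsE; exact: normr_ge0. Qed.

Lemma cabsR (r : R) : cabs r%:C%C = `|r|.
Proof. by apply: complexI; rewrite -cabsE normc_def /= expr0n /= addr0 sqrtr_sqr. Qed.

Lemma cabsM (x y : R[i]) : cabs (x * y) = cabs x * cabs y.
Proof. by apply: complexI; rewrite rmorphM /= -!cabsE normrM. Qed.

Lemma cabsD (x y : R[i]) : cabs (x + y) <= cabs x + cabs y.
Proof. by rewrite -lecR rmorphD /= -!cabsE ler_normD. Qed.

Lemma cabsN (x : R[i]) : cabs (- x) = cabs x.
Proof. by rewrite /cabs normrN. Qed.

Lemma cabsJ (x : R[i]) : cabs x^* = cabs x.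
Proof. by rewrite /cabs norm_conjC. Qed.

Lemma cabs0 : cabs 0 = 0.
Proof. by rewrite /cabs normr0. Qed.

Lemma cabs1 : cabs 1 = 1.
Proof. by rewrite -[1](_ : 1%:C%C = 1)// cabsR normr1. Qed.

Lemma cabs_eq0 (x : R[i]) : cabs x = 0 -> x = 0.
Proof. by move=> x0; apply/eqP; rewrite -normr_eq0 cabsE x0. Qed.

Lemma cabs_distC (x y : R[i]) : cabs (x - y) = cabs (y - x).
Proof. by rewrite -cabsN opprB. Qed.

Lemma ReD (x y : R[i]) : complex.Re (x + y) = complex.Re x + complex.Re y.
Proof. by case: x => ? ?; case: y. Qed.

Lemma ReN (x : R[i]) : complex.Re (- x) = - complex.Re x.
Proof. by case: x. Qed.

Lemma ReZ (r : R) (x : R[i]) : complex.Re (r%:C%C * x) = r * complex.Re x.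
Proof. by case: x => a b /=; rewrite mul0r subr0. Qed.

Lemma Re_conj (x : R[i]) : complex.Re x^* = complex.Re x.
Proof. by case: x. Qed.

Lemma Re_cabs (x : R[i]) : `|complex.Re x| <= cabs x.
Proof. by rewrite -lecR -cabsE normc_ge_Re. Qed.

Lemma Im_cabs (x : R[i]) : `|complex.Im x| <= cabs x.
Proof.
have := Re_cabs ('i%C * x); rewrite mulrC ReiNIm normrN mulrC cabsM.
suff -> : cabs 'i%C = 1 :> R by rewrite mul1r.
by apply: complexI; rewrite -cabsE normc_def /= expr0n expr1n add0r sqrtr1.
Qed.

Lemma cabs_i : cabs 'i%C = 1 :> R.
Proof. by apply: complexI; rewrite -cabsE normc_def /= expr0n expr1n add0r sqrtr1. Qed.

Lemma cabs_ReIm (x : R[i]) : cabs x <= `|complex.Re x| + `|complex.Im x|.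
Proof.
rewrite {1}[x]complexE (le_trans (cabsD _ _))// cabsR cabsM cabs_i cabsR.
by rewrite mul1r.
Qed.

Lemma cabs_sqr (x : R[i]) : (cabs x ^+ 2)%:C%C = x * x^*.
Proof. by rewrite rmorphXn /= -cabsE normCK. Qed.

Context (V : normedModType R[i]).
Implicit Types (x y : V) (u : nat -> V).

Lemma rnormE x : `|x| = (rnorm x)%:C%C.
Proof. exact/ge0_ReE/normr_ge0. Qed.

Lemma rnorm_ge0 x : 0 <= rnorm x.
Proof. by rewrite -lecR -rnormE; exact: normr_ge0. Qed.

Lemma rnormD x y : rnorm (x + y) <= rnorm x + rnorm y.
Proof. by rewrite -lecR rmorphD /= -!rnormE ler_normD. Qed.

Lemma rnormN x : rnorm (- x) = rnorm x.
Proof. by rewrite /rnorm normrN. Qed.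

Lemma rnormB x y : rnorm (x - y) <= rnorm x + rnorm y.
Proof. by rewrite -[rnorm y]rnormN rnormD. Qed.

Lemma rnorm_distC x y : rnorm (x - y) = rnorm (y - x).
Proof. by rewrite -rnormN opprB. Qed.

Lemma rnormZ (k : R[i]) x : rnorm (k *: x) = cabs k * rnorm x.
Proof. by apply: complexI; rewrite rmorphM /= -cabsE -!rnormE normrZ. Qed.

Lemma rnormZr (k : R) x : rnorm (k%:C%C *: x) = `|k| * rnorm x.
Proof. by rewrite rnormZ cabsR. Qed.

Lemma rnorm0 : rnorm (0 : V) = 0.
Proof. by rewrite /rnorm normr0. Qed.

Lemma rnorm_eq0 x : rnorm x = 0 -> x = 0.
Proof. by move=> x0; apply: normr0_eq0; rewrite rnormE x0. Qed.

Lemma rnorm_gt0 x : x <> 0 -> 0 < rnorm x.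
Proof.
move=> x0; rewrite lt_neqAle rnorm_ge0 andbT eq_sym.
by apply/eqP => /rnorm_eq0.
Qed.

Lemma rnorm_dist (x y z : V) : rnorm (x - z) <= rnorm (x - y) + rnorm (y - z).
Proof. by rewrite (le_trans _ (rnormD _ _))// addrA subrK. Qed.

Lemma rnorm_small0 x : (forall e, 0 < e -> rnorm x <= e) -> x = 0.
Proof.
move=> xe; apply: rnorm_eq0; apply/eqP; rewrite eq_le rnorm_ge0 andbT.
by apply/ler_addgt0Pl => e e0; rewrite addr0 xe.
Qed.

Definition tends u (l : V) :=
  forall e, 0 < e -> exists N, forall n, (N <= n)%N -> rnorm (u n - l) < e.

Definition cauchy_sequence u :=
  forall e, 0 < e ->
    exists N, forall m n, (N <= m)%N -> (N <= n)%N -> rnorm (u m - u n) < e.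

Lemma ball_rnorm x (r : R) y : ball x r%:C%C y <-> rnorm (x - y) < r.
Proof. by rewrite -ball_normE /ball_ /= rnormE ltcR. Qed.

Lemma closed_rnormP (S : set V) :
  closed S <-> forall x, (forall e, 0 < e -> exists2 y, S y & rnorm (x - y) < e) -> S x.
Proof.
split=> [cS x xS|cS].
  apply: cS => B /nbhs_ballP[r /= /cgt0P[r0 rE] rB].
  have [y Sy xy] := xS _ r0; exists y; split=> //.
  by apply: rB; rewrite rE; apply/ball_rnorm.
move=> x clx; apply: cS => e e0.
have [|y [Sy xy]] := clx (ball x e%:C%C).
  by apply: nbhsx_ballx; rewrite ltcR.
by exists y => //; apply/ball_rnorm.
Qed.

Lemma closed_tends (S : set V) u l : closed S -> (forall n, S (u n)) -> tends u l -> S l.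
Proof.
move=> /closed_rnormP cS Su ul; apply: cS => e /ul[N Nu].
by exists (u N) => //; rewrite rnorm_distC Nu.
Qed.

End RealNorm.

Section Completeness.
Context (R : realType).

Lemma cauchy_sequence_tends (V : completeNormedModType R[i]) (u : nat -> V) :
  cauchy_sequence u -> exists l, tends u l.
Proof.
move=> cu; have : cvg (u @ \oo).
  apply/cauchy_cvgP; apply/cauchy_exP => e /cgt0P[e0 eE].
  have [N Nu] := cu _ e0; exists (u N); exists N => // n /= Nn.
  by rewrite eE; apply/ball_rnorm/Nu.
move=> /cvg_ex[l ul]; exists l => e e0.
have [] := ul (ball l e%:C%C); first by apply: nbhsx_ballx; rewrite ltcR.
move=> N _ Nu; exists N => n Nn; rewrite rnorm_distC; apply/ball_rnorm.
exact: Nu.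
Qed.

(** Unitizations and Hilbert completions are vector spaces first, and get their
norms later, as a supremum over the space; [banach] is an alias that carries such
a norm. *)
Record completeNorm (V : lmodType R[i]) := CompleteNorm {
  cnorm :> V -> R ;
  cnormD : forall x y, cnorm (x + y) <= cnorm x + cnorm y ;
  cnormZ : forall k x, cnorm (k *: x) = cabs k * cnorm x ;
  cnorm_eq0 : forall x, cnorm x = 0 -> x = 0 ;
  cnorm_complete : forall u : nat -> V,
    (forall e, 0 < e -> exists N, forall m n, (N <= m)%N -> (N <= n)%N ->
       cnorm (u m - u n) < e) ->
    exists l, forall e, 0 < e -> exists N, forall n, (N <= n)%N -> cnorm (u n - l) < e
}.

Definition banach (V : lmodType R[i]) (N : completeNorm V) : Type := V.

Section Banach.
Context (V : lmodType R[i]) (N : completeNorm V).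

HB.instance Definition _ := GRing.Lmodule.on (banach N).

Let norm (x : banach N) : R[i] := (N x)%:C%C.

Let normD (x y : banach N) : norm (x + y) <= norm x + norm y.
Proof. by rewrite -rmorphD lecR cnormD. Qed.

Let normZ (k : R[i]) (x : banach N) : norm (k *: x) = `|k| * norm x.
Proof. by rewrite cabsE -rmorphM /= -cnormZ. Qed.

Let norm_eq0 (x : banach N) : norm x = 0 -> x = 0.
Proof. by move=> /complexI /cnorm_eq0. Qed.

HB.instance Definition _ :=
  Lmodule_isNormed.Build R[i] (banach N) normD normZ norm_eq0.

Lemma banach_rnorm (x : banach N) : rnorm x = N x.
Proof. by []. Qed.

Let complete (F : set_system (banach N)) : ProperFilter F -> cauchy F -> cvg F.
Proof.
move=> FF /cauchyP cF.
have inv0 n : 0 < n.+1%:R^-1 :> R by rewrite invr_gt0.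
have /choice[u uF] : forall n, exists x, F (ball x (n.+1%:R^-1)%:C%C).
  by move=> n; apply: cF; rewrite ltcR.
have small (e : R) : 0 < e -> exists n, n.+1%:R^-1 < e.
  move=> e0; have [k] := ltr_add_invr (e0 : 0 < e).
  by rewrite add0r => ke; exists k.
have [] := @cnorm_complete _ N u => [e e0|l ul].
  have [n ne] := small _ (divr_gt0 e0 (ltr0n _ 2)).
  exists n => p q np nq.
  have [x [/ball_rnorm xp /ball_rnorm xq]] := filter_ex (filterI (uF p) (uF q)).
  have h k : (n <= k)%N -> (k.+1%:R^-1 : R) < e / 2.
    by move=> nk; rewrite (le_lt_trans _ ne)// lef_pV2 ?posrE// ler_nat.
  have hp := lt_trans xp (h _ np); have hq := lt_trans xq (h _ nq).
  have := rnorm_dist (u p) x (u q); rewrite (rnorm_distC x).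
  rewrite -[N (u p - u q)]/(rnorm (u p - u q : banach N)).
  lra.
apply/cvg_ex; exists l => B /nbhs_ballP[e /= /cgt0P[e0 eE] eB].
have [N0 Nu] := ul _ (divr_gt0 e0 (ltr0n _ 2)).
have [n ne] := small _ (divr_gt0 e0 (ltr0n _ 2)).
apply: (filterS _ (uF (maxn n N0))) => x /ball_rnorm ux; apply: eB; rewrite eE.
apply/ball_rnorm.
have := Nu _ (leq_maxr n N0).
rewrite -[N (u _ - l)]/(rnorm (u _ - l : banach N)).
have /(lt_trans ux) : ((maxn n N0).+1%:R^-1 : R) < complex.Re e / 2.
  by rewrite (le_lt_trans _ ne)// lef_pV2 ?posrE// ler_nat ltnS leq_maxl.
have := rnorm_dist (l : banach N) (u (maxn n N0)) x.
by rewrite (rnorm_distC (l : banach N) (u _)); lra.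
Qed.

HB.instance Definition _ := Uniform_isComplete.Build (banach N) complete.

End Banach.

(** Real and imaginary parts are contractive, and the reals are complete. *)
Lemma complex_cauchy (u : nat -> R[i]) :
  (forall e, 0 < e -> exists N, forall m n, (N <= m)%N -> (N <= n)%N ->
     cabs (u m - u n) < e) ->
  exists l, forall e, 0 < e -> exists N, forall n, (N <= n)%N -> cabs (u n - l) < e.
Proof.
move=> cu.
have part (f : R[i] -> R) : {morph f : x y / x - y} -> (forall x, `|f x| <= cabs x) ->
    exists l, forall e, 0 < e -> exists N, forall n, (N <= n)%N -> `|f (u n) - l| < e.
  move=> fB fle; have : cvg (f \o u @ \oo).
    apply/cauchy_cvgP; apply/cauchy_exP => e e0.
    have [N Nu] := cu _ e0; exists (f (u N)); exists N => // n /= Nn.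
    by rewrite -ball_normE /= -fB (le_lt_trans (fle _))// Nu.
  move=> /cvg_ex[l /cvgrPdist_lt ul]; exists l => e /ul[N _ Nu].
  by exists N => n Nn; rewrite distrC; apply: Nu.
have [|a aP] := part (@complex.Re R) _ (@Re_cabs _).
  by move=> x y; rewrite ReD ReN.
have [|b bP] := part (@complex.Im R) _ (@Im_cabs _).
  by case=> ? ?; case.
exists (a +i* b)%C => e e0.
have [N1 h1] := aP _ (divr_gt0 e0 (ltr0n _ 2)).
have [N2 h2] := bP _ (divr_gt0 e0 (ltr0n _ 2)).
exists (maxn N1 N2) => n; rewrite geq_max => /andP[/h1 ha /h2 hb].
apply: le_lt_trans (cabs_ReIm _) _.
by case: (u n) ha hb => p q /=; lra.
Qed.

End Completeness.

(** * Best constants *)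

Section BestBound.
Context (R : realType) (I : Type) (u v : I -> R).

Definition bound (C : R) := 0 <= C /\ forall i, u i <= C * v i.

(** For [v i] the norm of [i] and [u i] that of its image this is an operator norm;
[v] may also be a seminorm, which vanishes on some [i]. *)
Definition best_bound : R := inf bound.

Hypothesis v_ge0 : forall i, 0 <= v i.
Hypothesis bounded : exists C, bound C.

Lemma best_bound_ge0 : 0 <= best_bound.
Proof. by apply: lb_le_inf => // C []. Qed.

Lemma best_bound_le (C : R) : 0 <= C -> (forall i, u i <= C * v i) -> best_bound <= C.
Proof. by move=> C0 uC; apply: ge_inf; [exists 0 => ? []|split]. Qed.

Lemma best_boundP i : u i <= best_bound * v i.
Proof.
have [v0|v0] := eqVneq (v i) 0.
  by case: bounded => C [_ /(_ i)]; rewrite v0 !mulr0.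
have vp : 0 < v i by rewrite lt_neqAle eq_sym v0 v_ge0.
rewrite -ler_pdivrMr//; apply: lb_le_inf => // C [_ uC].
by rewrite ler_pdivrMr.
Qed.

End BestBound.

(** * Elementary algebra of C*-algebras *)

Section CstarBasics.
Context (R : realType) (A : cstarAlgType R).
Implicit Types (a b c x y : A) (S T : cstar_subalgebra A).

Lemma cmul0r a : a ** 0 = 0 :> A.
Proof. by have := cmulZr 0 a 0; rewrite !scale0r. Qed.

Lemma cmul0l a : 0 ** a = 0 :> A.
Proof. by have := cmulZl 0 0 a; rewrite !scale0r. Qed.

Lemma cmulNr a b : a ** (- b) = - (a ** b).
Proof. by rewrite -scaleN1r cmulZr scaleN1r. Qed.

Lemma cmulNl a b : (- a) ** b = - (a ** b).
Proof. by rewrite -scaleN1r cmulZl scaleN1r. Qed.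

Lemma cmulBr a b c : a ** (b - c) = a ** b - a ** c.
Proof. by rewrite cmulDr cmulNr. Qed.

Lemma cmulBl a b c : (a - b) ** c = a ** c - b ** c.
Proof. by rewrite cmulDl cmulNl. Qed.

Lemma cstar0 : 0^# = 0 :> A.
Proof. by have := cstarZ 0 (0 : A); rewrite conjC0 !scale0r. Qed.

Lemma cstarN a : (- a)^# = - a^#.
Proof. by rewrite -scaleN1r cstarZ rmorphN1 scaleN1r. Qed.

Lemma cstarB a b : (a - b)^# = a^# - b^#.
Proof. by rewrite cstarD cstarN. Qed.

Lemma conj_real (r : R) : (r%:C%C)^* = r%:C%C :> R[i].
Proof. by rewrite conj_Creal// complex_real. Qed.

Lemma cstarZr (r : R) a : (r%:C%C *: a)^# = r%:C%C *: a^#.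
Proof. by rewrite cstarZ conj_real. Qed.

Lemma conj_i : ('i%C)^* = - 'i%C :> R[i].
Proof. by rewrite complexiE conjCi. Qed.

Lemma cstarZi a : ('i%C *: a)^# = - ('i%C *: a^#).
Proof. by rewrite cstarZ conj_i scaleNr. Qed.

Lemma scale_ii a : 'i%C *: ('i%C *: a) = - a.
Proof. by rewrite scalerA -expr2 sqr_i scaleN1r. Qed.

Lemma rnormM a b : rnorm (a ** b) <= rnorm a * rnorm b.
Proof. by rewrite -lecR rmorphM /= -!rnormE cnormM. Qed.

Lemma rnorm_CN a : rnorm (a^# ** a) = rnorm a ^+ 2.
Proof. by apply: complexI; rewrite rmorphXn /= -!rnormE cnorm_star. Qed.

Lemma rnorm_star a : rnorm a^# = rnorm a.
Proof.
have le b : rnorm b <= rnorm b^#.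
  have [->|b0] := eqVneq (rnorm b) 0; first exact: rnorm_ge0.
  have bp : 0 < rnorm b by rewrite lt_neqAle eq_sym b0 rnorm_ge0.
  by rewrite -(ler_pM2r bp) -expr2 -rnorm_CN rnormM.
by apply/eqP; rewrite eq_le le -{2}[a]cstarK le.
Qed.

Lemma rnorm_CN' a : rnorm (a ** a^#) = rnorm a ^+ 2.
Proof. by rewrite -{1}[a]cstarK rnorm_CN rnorm_star. Qed.

Lemma cstar_mul_eq0 a : a^# ** a = 0 -> a = 0.
Proof.
move=> aa; apply: rnorm_eq0; apply/eqP.
by rewrite -sqrf_eq0 -rnorm_CN aa rnorm0.
Qed.

Lemma sa_sqr_eq0 a : a^# = a -> a ** a = 0 -> a = 0.
Proof. by move=> aa; rewrite -{1}aa; exact: cstar_mul_eq0. Qed.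

Lemma csub0 S : S 0.
Proof. by have [] := subalg_closed_subspace S. Qed.

Lemma csubP S (k : R[i]) a b : S a -> S b -> S (k *: a + b).
Proof. by have [_ _] := subalg_closed_subspace S; apply. Qed.

Lemma csubZ S (k : R[i]) a : S a -> S (k *: a).
Proof. by move=> Sa; rewrite -[_ *: _]addr0; apply: csubP => //; apply: csub0. Qed.

Lemma csubD S a b : S a -> S b -> S (a + b).
Proof. by move=> Sa Sb; rewrite -[a]scale1r; apply: csubP. Qed.

Lemma csubN S a : S a -> S (- a).
Proof. by move=> Sa; rewrite -scaleN1r; apply: csubZ. Qed.

Lemma csubB S a b : S a -> S b -> S (a - b).
Proof. by move=> Sa Sb; apply/csubD/csubN. Qed.

Lemma csub_closed S : closed S.
Proof. by have [] := subalg_closed_subspace S. Qed.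

Lemma scale_half (x : A) : (2^-1)%:C%C *: x + (2^-1)%:C%C *: x = x.
Proof.
rewrite -scalerDl -rmorphD /= (_ : 2^-1 + 2^-1 = 1) ?scale1r//.
by lra.
Qed.

(** The formal power series of [1 - sqrt (1 - z)] is summed by iterating
[w |-> (z + w^2) / 2]: on scalars the iteration started from [0] increases for
[z = 1], and this scalar sequence dominates the one in [A]. *)
Section SquareRoot.
Variables (S : cstar_subalgebra A) (z : A).
Hypotheses (Sz : S z) (z_sa : z^# = z) (z_le1 : rnorm z <= 1).

Fixpoint sqrt_iter n : A :=
  if n is m.+1 then (2^-1)%:C%C *: (z + sqrt_iter m ** sqrt_iter m) else 0.

Fixpoint sqrt_maj n : R :=
  if n is m.+1 then 2^-1 * (1 + sqrt_maj m ^+ 2) else 0.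

Lemma sqrt_maj_ge0 n : 0 <= sqrt_maj n.
Proof. by case: n => //= n; rewrite mulr_ge0// ?invr_ge0// addr_ge0// sqr_ge0. Qed.

Lemma sqrt_maj_le1 n : sqrt_maj n <= 1.
Proof.
elim: n => //= n IH; have : sqrt_maj n ^+ 2 <= 1 by rewrite expr_le1 // sqrt_maj_ge0.
lra.
Qed.

Lemma sqrt_iter_le n : rnorm (sqrt_iter n) <= sqrt_maj n.
Proof.
elim: n => [|n IH] /=; first by rewrite rnorm0.
rewrite rnormZr ger0_norm ?invr_ge0// ler_pM2l ?invr_gt0//.
rewrite (le_trans (rnormD _ _))// lerD// (le_trans (rnormM _ _))//.
by rewrite expr2 ler_pM ?rnorm_ge0.
Qed.

Lemma sqrt_iter_step n :
  rnorm (sqrt_iter n.+1 - sqrt_iter n) <= sqrt_maj n.+1 - sqrt_maj n.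
Proof.
elim: n => [|n IH].
  by rewrite /= cmul0l expr0n /= !addr0 !subr0 rnormZr ger0_norm ?invr_ge0// ler_pM2l ?invr_gt0.
set w := sqrt_iter n in IH *; set w' := sqrt_iter n.+1 in IH *.
set t := sqrt_maj n in IH *; set t' := sqrt_maj n.+1 in IH *.
have -> : sqrt_iter n.+2 = (2^-1)%:C%C *: (z + w' ** w') by [].
have -> : sqrt_maj n.+2 = 2^-1 * (1 + t' ^+ 2) by [].
rewrite [in X in _ <= X](_ : t' = 2^-1 * (1 + t ^+ 2))//.
rewrite [in X in _ - X](_ : w' = (2^-1)%:C%C *: (z + w ** w))//.
rewrite -scalerBr opprD addrACA subrr add0r.
rewrite -[2^-1 * (1 + t ^+ 2)]/t'.
have -> : 2^-1 * (1 + t' ^+ 2) - t' = 2^-1 * (t' ^+ 2 - t ^+ 2).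
  rewrite [in X in _ - X](_ : t' = 2^-1 * (1 + t ^+ 2))//; lra.
rewrite rnormZr ger0_norm ?invr_ge0// ler_pM2l ?invr_gt0//.
have -> : w' ** w' - w ** w = w' ** (w' - w) + (w' - w) ** w.
  by rewrite cmulBr cmulBl addrA subrK.
rewrite (le_trans (rnormD _ _))// (le_trans (lerD (rnormM _ _) (rnormM _ _)))//.
have wt : rnorm w <= t by exact: sqrt_iter_le.
have wt' : rnorm w' <= t' by exact: sqrt_iter_le.
have -> : t' ^+ 2 - t ^+ 2 = t' * (t' - t) + (t' - t) * t by ring.
by rewrite lerD// ler_pM// rnorm_ge0.
Qed.

Lemma sqrt_iter_dist n k :
  rnorm (sqrt_iter (k + n) - sqrt_iter n) <= sqrt_maj (k + n) - sqrt_maj n.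
Proof.
elim: k => [|k IH]; first by rewrite !subrr rnorm0.
have := rnorm_dist (sqrt_iter (k.+1 + n)) (sqrt_iter (k + n)) (sqrt_iter n).
have := sqrt_iter_step (k + n); rewrite -addSn; lra.
Qed.

Lemma sqrt_iter_cauchy : cauchy_sequence sqrt_iter.
Proof.
pose E := range sqrt_maj.
have supE : has_sup E.
  by split; [exists (sqrt_maj 0), 0%N|exists 1 => _ [n _ <-]; exact: sqrt_maj_le1].
have maj_mono n k : sqrt_maj n <= sqrt_maj (k + n).
  by rewrite -subr_ge0 (le_trans (rnorm_ge0 _) (sqrt_iter_dist n k)).
move=> e e0; have [|_ [N _ <-] EN] := sup_adherent (eps := e / 2) _ supE.
  by rewrite divr_gt0.
exists N; suff h m : (N <= m)%N -> rnorm (sqrt_iter m - sqrt_iter N) < e / 2.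
  move=> m n /h hm /h hn.
  have := rnorm_dist (sqrt_iter m) (sqrt_iter N) (sqrt_iter n).
  by rewrite (rnorm_distC (sqrt_iter N)); lra.
move=> Nm; rewrite -(subnK Nm); apply: le_lt_trans (sqrt_iter_dist _ _) _.
have : sqrt_maj (m - N + N) <= sup E by apply: sup_ubound; [case: supE|exists (m - N + N)%N].
lra.
Qed.

Lemma exists_sqrt_defect : exists w, [/\ S w, w^# = w, rnorm w <= 1,
  w + w = z + w ** w & forall c, c ** z = z ** c -> c ** w = w ** c].
Proof.
have [w ww] := cauchy_sequence_tends sqrt_iter_cauchy.
have iS n : S (sqrt_iter n).
  elim: n => [|n IH] /=; first exact: csub0.
  by apply/csubZ/csubD => //; apply: subalg_mul.
have isa n : (sqrt_iter n)^# = sqrt_iter n.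
  elim: n => [|n IH] /=; first exact: cstar0.
  by rewrite cstarZr cstarD z_sa cstarM IH.
have icomm c n : c ** z = z ** c -> c ** sqrt_iter n = sqrt_iter n ** c.
  move=> cz; elim: n => [|n IH] /=; first by rewrite cmul0l cmul0r.
  by rewrite cmulZr cmulZl cmulDr cmulDl cz cmulA IH -cmulA IH cmulA.
have w1 : rnorm w <= 1.
  apply/ler_addgt0Pr => e /ww[N /(_ N (leqnn _))].
  have := rnormD (w - sqrt_iter N) (sqrt_iter N); rewrite subrK rnorm_distC.
  by have := sqrt_iter_le N; have := sqrt_maj_le1 N; lra.
exists w; split=> //.
- exact: closed_tends (@csub_closed S) iS ww.
- apply/subr0_eq/rnorm_small0 => e e0; have [N /(_ N (leqnn _)) wN] := ww _ (divr_gt0 e0 (ltr0n _ 2)).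
  have -> : w^# - w = (w - sqrt_iter N)^# - (w - sqrt_iter N).
    by rewrite cstarB isa opprB addrA subrK.
  have := rnormB (w - sqrt_iter N)^# (w - sqrt_iter N).
  by rewrite rnorm_star (rnorm_distC w); lra.
- apply/subr0_eq/rnorm_small0 => e e0.
  have [N wN] := ww _ (divr_gt0 e0 (ltr0n _ 4)).
  have -> : w + w - (z + w ** w) = (w - sqrt_iter N.+1) + (w - sqrt_iter N.+1)
      - (w ** (w - sqrt_iter N) + (w - sqrt_iter N) ** sqrt_iter N).
    have -> : w ** (w - sqrt_iter N) + (w - sqrt_iter N) ** sqrt_iter N =
        w ** w - sqrt_iter N ** sqrt_iter N.
      by rewrite cmulBr cmulBl addrA subrK.
    rewrite [in RHS]addrACA -opprD.
    have -> : sqrt_iter N.+1 + sqrt_iter N.+1 = z + sqrt_iter N ** sqrt_iter N.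
      by rewrite /= scale_half.
    by rewrite opprB -[RHS]addrA; congr (_ + _); rewrite !opprD addrA addrNK.
  have h1 := wN N.+1 (leqnSn _); have h0 := wN N (leqnn _).
  have := rnormB ((w - sqrt_iter N.+1) + (w - sqrt_iter N.+1))
    (w ** (w - sqrt_iter N) + (w - sqrt_iter N) ** sqrt_iter N).
  have := rnormD (w - sqrt_iter N.+1) (w - sqrt_iter N.+1).
  have := rnormD (w ** (w - sqrt_iter N)) ((w - sqrt_iter N) ** sqrt_iter N).
  have : rnorm (w ** (w - sqrt_iter N)) <= rnorm (w - sqrt_iter N).
    by rewrite (le_trans (rnormM _ _))// ler_piMl ?rnorm_ge0.
  have : rnorm ((w - sqrt_iter N) ** sqrt_iter N) <= rnorm (w - sqrt_iter N).
    rewrite (le_trans (rnormM _ _))// ler_piMr ?rnorm_ge0//.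
    exact: le_trans (sqrt_iter_le _) (sqrt_maj_le1 _).
  by rewrite !(rnorm_distC w); lra.
- move=> c cz; apply/subr0_eq/rnorm_small0 => e e0.
  have d0 : 0 < e / (2 * (1 + rnorm c)) by rewrite divr_gt0// mulr_gt0// ltr_pwDl// rnorm_ge0.
  have [N /(_ N (leqnn _)) wN] := ww _ d0.
  have -> : c ** w - w ** c = c ** (w - sqrt_iter N) - (w - sqrt_iter N) ** c.
    by rewrite cmulBr cmulBl icomm// opprB addrA subrK.
  rewrite (le_trans (rnormB _ _))// (le_trans (lerD (rnormM _ _) (rnormM _ _)))//.
  rewrite (rnorm_distC w); move: wN; rewrite ltr_pdivlMr; last first.
    by rewrite mulr_gt0// ltr_pwDl// rnorm_ge0.
  have := rnorm_ge0 c; have := rnorm_ge0 (sqrt_iter N - w); nra.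
Qed.

End SquareRoot.

End CstarBasics.

(** ** Noncommutative polynomial identities *)

(** An identity between polynomials in noncommuting elements holds as soon as
both sides expand to the same multiset of signed monomials; [ncring] checks
this by computation. There is no unit, so that a monomial is given by its first
letter and the rest of the word. *)
Section NCRing.
Context (R : realType) (A : cstarAlgType R).

Inductive ncexpr := NCvar of nat | NCzero | NCadd of ncexpr & ncexpr
  | NCopp of ncexpr | NCmul of ncexpr & ncexpr.

Definition monomial := (nat * seq nat)%type.

Definition mulmon (m n : monomial) : monomial := (m.1, m.2 ++ n.1 :: n.2).

Definition mulmons (s t : seq monomial) := [seq mulmon m n | m <- s, n <- t].

Fixpoint ncexpand (x : ncexpr) : seq monomial * seq monomial :=
  match x with
  | NCvar i => ([:: (i, [::])], [::])
  | NCzero => ([::], [::])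
  | NCadd y z => let p := ncexpand y in let q := ncexpand z in
      (p.1 ++ q.1, p.2 ++ q.2)
  | NCopp y => let p := ncexpand y in (p.2, p.1)
  | NCmul y z => let p := ncexpand y in let q := ncexpand z in
      (mulmons p.1 q.1 ++ mulmons p.2 q.2, mulmons p.1 q.2 ++ mulmons p.2 q.1)
  end.

Variable env : seq A.

Fixpoint nceval (x : ncexpr) : A :=
  match x with
  | NCvar i => nth 0 env i
  | NCzero => 0
  | NCadd y z => nceval y + nceval z
  | NCopp y => - nceval y
  | NCmul y z => nceval y ** nceval z
  end.

Definition evalmon (m : monomial) : A :=
  foldl (fun x i => x ** nth 0 env i) (nth 0 env m.1) m.2.

Definition evalmons (s : seq monomial) : A := \sum_(m <- s) evalmon m.

Lemma evalmon_mul m n : evalmon (mulmon m n) = evalmon m ** evalmon n.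
Proof.
case: m n => [i s] [j t]; rewrite /evalmon /= foldl_cat /=.
move: (foldl _ _ s) (nth 0 env j) => x y.
by elim: t y => //= k t IH y; rewrite -IH cmulA.
Qed.

Lemma evalmons_mul s t : evalmons (mulmons s t) = evalmons s ** evalmons t.
Proof.
rewrite /evalmons /mulmons; elim: s => [|m s IH] /=; first by rewrite !big_nil cmul0l.
rewrite big_cat IH big_cons cmulDl; congr (_ + _).
rewrite big_map; elim: t {IH} => [|n t IH]; first by rewrite !big_nil cmul0r.
by rewrite !big_cons evalmon_mul IH cmulDr.
Qed.

Lemma ncexpandP x :
  nceval x = evalmons (ncexpand x).1 - evalmons (ncexpand x).2.
Proof.
have catE s t : evalmons (s ++ t) = evalmons s + evalmons t by exact: big_cat.
elim: x => [i||x IHx y IHy|x IHx|x IHx y IHy] /=; rewrite ?IHx ?IHy.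
- by rewrite /evalmons big_seq1 big_nil subr0.
- by rewrite /evalmons big_nil subr0.
- by rewrite !catE opprD addrACA.
- by rewrite opprB.
- rewrite !catE !evalmons_mul cmulBr !cmulBl opprB [in RHS]opprD.
  by rewrite addrACA [- _ + _]addrC.
Qed.

Lemma ncring_correct x y :
  perm_eq ((ncexpand x).1 ++ (ncexpand y).2) ((ncexpand y).1 ++ (ncexpand x).2) ->
  nceval x = nceval y.
Proof.
move=> xy; rewrite !ncexpandP; apply/eqP; rewrite subr_eq addrAC eq_sym subr_eq.
have catE s t : evalmons (s ++ t) = evalmons s + evalmons t by exact: big_cat.
by rewrite -!catE; apply/eqP; rewrite /evalmons; exact/esym/perm_big.
Qed.

End NCRing.

(* Atoms are compared up to conversion, as the same scalar multiple may be
elaborated through different structure instances. *)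
Ltac nc_index x env :=
  match env with
  | ?y :: _ => let _ := match goal with _ => unify x y end in constr:(0%N)
  | _ :: ?env' => let n := nc_index x env' in constr:(S n)
  end.

Ltac nc_insert x env :=
  match goal with
  | _ => let _ := nc_index x env in env
  | _ => constr:(x :: env)
  end.

Ltac nc_atoms x env :=
  lazymatch x with
  | (?y + ?z)%R => let env' := nc_atoms y env in nc_atoms z env'
  | (- ?y)%R => nc_atoms y env
  | cmul ?y ?z => let env' := nc_atoms y env in nc_atoms z env'
  | 0%R => env
  | _ => nc_insert x env
  end.

Ltac nc_reify x env :=
  lazymatch x with
  | (?y + ?z)%R =>
      let y' := nc_reify y env in let z' := nc_reify z env in constr:(NCadd y' z')
  | (- ?y)%R => let y' := nc_reify y env in constr:(NCopp y')
  | cmul ?y ?z =>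
      let y' := nc_reify y env in let z' := nc_reify z env in constr:(NCmul y' z')
  | 0%R => constr:(NCzero)
  | _ => let i := nc_index x env in constr:(NCvar i)
  end.

Ltac ncring :=
  lazymatch goal with
  | |- @eq ?A ?x ?y =>
      let env := nc_atoms x (@nil A) in
      let env := nc_atoms y env in
      let x' := nc_reify x env in
      let y' := nc_reify y env in
      exact: (@ncring_correct _ _ env x' y' isT)
  end.

(** * Positive elements of a unital C*-algebra *)

Section FullSubalgebra.
Context (R : realType) (A : cstarAlgType R).

Lemma closed_subspaceT : closed_subspace [set: A].
Proof. by split=> //; exact: closedT. Qed.

Definition full_subalgebra : cstar_subalgebra A :=
  @CstarSubalgebra R A setT closed_subspaceT (fun _ _ _ _ => I) (fun _ _ => I).

End FullSubalgebra.

Section Unital.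
Context (R : realType) (A : cstarAlgType R) (e : A).
Hypotheses (mul1c : forall x, e ** x = x) (mulc1 : forall x, x ** e = x).
Implicit Types (a b c h k l x y : A) (T : cstar_subalgebra A).

Local Notation "r :* x" := (r%:C%C *: x) (at level 40).

Lemma star_unit : e^# = e.
Proof. by rewrite -[e^#]mulc1 -{2}[e]cstarK -cstarM mulc1 cstarK. Qed.

Lemma rnorm_unit_le1 : rnorm e <= 1.
Proof.
have := rnorm_CN e; rewrite star_unit mul1c => ne.
have [->//|e0] := eqVneq (rnorm e) 0.
have e1 : rnorm e * rnorm e = rnorm e * 1 by rewrite -expr2 -ne mulr1.
by rewrite (mulfI e0 e1).
Qed.

Lemma scaleR_unit_sa (r : R) : (r :* e)^# = r :* e.
Proof. by rewrite cstarZr star_unit. Qed.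

(** Positivity is measured by the distance to a large multiple of the unit.
With this definition sums of positive elements are positive by the triangle
inequality, while it takes work to see that [y^# ** y] is positive. *)
Definition pos h := h^# = h /\ exists2 r : R, 0 <= r & rnorm (r :* e - h) <= r.

Lemma pos0 : pos 0.
Proof. by split; [exact: cstar0|exists 0 => //; rewrite scale0r subr0 rnorm0]. Qed.

Lemma posD h k : pos h -> pos k -> pos (h + k).
Proof.
move=> [hsa [r r0 hr]] [ksa [s s0 ks]]; split; first by rewrite cstarD hsa ksa.
exists (r + s); first exact: addr_ge0.
rewrite rmorphD scalerDl opprD addrACA.
by rewrite (le_trans (rnormD _ _))// lerD.
Qed.

Lemma posZ (s : R) h : 0 <= s -> pos h -> pos (s :* h).
Proof.
move=> s0 [hsa [r r0 hr]]; split; first by rewrite cstarZr hsa.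
exists (s * r); first exact: mulr_ge0.
by rewrite rmorphM -scalerA -scalerBr rnormZr ger0_norm// ler_wpM2l.
Qed.

Lemma pos_shift h (r : R) : h^# = h -> rnorm h <= r -> pos (r :* e - h).
Proof.
move=> hsa hr; split; first by rewrite cstarB scaleR_unit_sa hsa.
by exists r; rewrite ?(le_trans (rnorm_ge0 _) hr)// opprB addrC subrK.
Qed.

Lemma pos_sqrt T h : T e -> T h -> pos h ->
  exists k, [/\ T k, pos k, k ** k = h & forall c, c ** h = h ** c -> c ** k = k ** c].
Proof.
move=> Te Th [hsa [r r0 hr]]; have [rz|rn0] := eqVneq r 0.
  have h0 : h = 0.
    apply/rnorm_eq0/eqP; rewrite eq_le rnorm_ge0 andbT.
    by move: hr; rewrite rz scale0r sub0r rnormN.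
  exists 0; split=> [||//|c _]; [exact: csub0|exact: pos0|by rewrite cmul0l|].
  by rewrite cmul0l cmul0r.
have rp : 0 < r by rewrite lt_neqAle eq_sym rn0.
pose z := e - r^-1 :* h.
have zsa : z^# = z by rewrite cstarB star_unit cstarZr hsa.
have rzh : r :* z = r :* e - h by rewrite scalerBr scalerA -rmorphM mulfV// scale1r.
have z1 : rnorm z <= 1.
  by rewrite -(ler_pM2l rp) mulr1 -{1}(gtr0_norm rp) -rnormZr rzh.
have [|w [Tw wsa w1 ww wc]] := exists_sqrt_defect (S := T) _ zsa z1.
  by apply: csubB => //; apply: csubZ.
exists (Num.sqrt r :* (e - w)); split.
- by apply/csubZ/csubB.
- apply: posZ; first exact: sqrtr_ge0.
  by have := @pos_shift w 1 wsa w1; rewrite scale1r.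
- rewrite cmulZl cmulZr scalerA -rmorphM -expr2 sqr_sqrtr//.
  have -> : (e - w) ** (e - w) = e - z.
    by rewrite !(cmulBr, cmulBl, mulc1, mul1c) -[z](addrK (w ** w)) -ww; ncring.
  by rewrite scalerBr rzh subKr.
- move=> c ch; rewrite cmulZl cmulZr !(cmulBr, cmulBl, mulc1, mul1c) wc//.
  by rewrite /z !(cmulBr, cmulBl, mulc1, mul1c) cmulZr cmulZl ch.
Qed.

(** [l + i k] is a multiple of a unitary, and [l] is its real part. *)
Lemma rnorm_sq_le l k (s : R) : l^# = l -> k^# = k -> l ** k = k ** l -> 0 <= s ->
  l ** l + k ** k = s :* e -> rnorm l ^+ 2 <= s.
Proof.
move=> lsa ksa lk s0 sE; pose u := l + 'i%C *: k.
have us : u^# = l - 'i%C *: k by rewrite cstarD cstarZi lsa ksa.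
have uu : u^# ** u = s :* e.
  rewrite us /u cmulBl !cmulDr cmulZr !cmulZl cmulZr scale_ii lk -sE.
  by ncring.
have u2 : rnorm u ^+ 2 <= s.
  by rewrite -rnorm_CN uu rnormZr ger0_norm// ler_piMr// rnorm_unit_le1.
have lu : rnorm (l + l) <= rnorm u + rnorm u.
  rewrite (_ : l + l = u + u^#); first by rewrite (le_trans (rnormD _ _))// rnorm_star.
  by rewrite us /u addrACA subrr addr0.
have : rnorm l <= rnorm u.
  move: lu; have -> : l + l = 2 :* l.
    by rewrite -[in RHS](scale1r l) scalerA mulr1 -[2]/(1 + 1) rmorphD scalerDl !scale1r.
  by rewrite rnormZr ger0_norm//; lra.
move=> le; apply: le_trans u2; by rewrite lerXn2r ?nnegrE ?rnorm_ge0.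
Qed.

(** With [c = sqrt (1 - g^2)] the element [u = g + i c] is unitary, and
[u^2 + (u^#)^2 = 4 (g^2 - 1/2)]. *)
Lemma pos_sqr_contraction g : g^# = g -> rnorm g <= 1 -> pos (g ** g).
Proof.
move=> gsa g1.
have ggsa : (g ** g)^# = g ** g by rewrite cstarM gsa.
have gg1 : rnorm (g ** g) <= 1.
  by rewrite (le_trans (rnormM _ _))// mulr_ile1 ?rnorm_ge0.
have [c [csa cg cc]] : exists c, [/\ c^# = c, g ** c = c ** g & c ** c = e - g ** g].
  have [//|w [_ wsa w1 ww wc]] := exists_sqrt_defect (S := full_subalgebra A) _ ggsa gg1.
  exists (e - w); split.
  - by rewrite cstarB star_unit wsa.
  - by rewrite !(cmulBr, cmulBl, mulc1, mul1c) wc// cmulA.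
  - by rewrite !(cmulBr, cmulBl, mulc1, mul1c) -[g ** g](addrK (w ** w)) -ww; ncring.
have u1 (v : A) : v^# ** v = e -> rnorm v <= 1.
  move=> vv; rewrite -(@ler_pXn2r _ 2) ?nnegrE ?rnorm_ge0// expr1n.
  by rewrite -rnorm_CN vv rnorm_unit_le1.
pose u := g + 'i%C *: c.
have us : u^# = g - 'i%C *: c by rewrite cstarD cstarZi gsa csa.
have un : rnorm u <= 1.
  apply: u1; rewrite us /u cmulBl !cmulDr cmulZr !cmulZl cmulZr scale_ii cg.
  have -> : g ** g = e - c ** c by rewrite cc subKr.
  ncring.
have uu : u ** u + u^# ** u^# = 4 :* (g ** g - 2^-1 :* e).
  rewrite us /u !cmulBl !cmulBr !(cmulDl, cmulDr) !(cmulZr, cmulZl) !scale_ii cg.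
  rewrite !scalerBr !scalerA -!rmorphM /= (_ : 4 * 2^-1 = 1 + 1); last by lra.
  rewrite (_ : 4 = 1 + 1 + 1 + 1); last by lra.
  rewrite !rmorphD !scalerDl !scale1r; have -> : e = g ** g + c ** c by rewrite cc addrC subrK.
  ncring.
split; first exact: ggsa.
exists 2^-1; first by rewrite invr_ge0.
rewrite rnorm_distC; have : rnorm (u ** u + u^# ** u^#) <= 1 + 1.
  rewrite (le_trans (rnormD _ _))// lerD//.
    by rewrite (le_trans (rnormM _ _))// mulr_ile1 ?rnorm_ge0.
  by rewrite (le_trans (rnormM _ _))// rnorm_star mulr_ile1 ?rnorm_ge0.
by rewrite uu rnormZr ger0_norm//; lra.
Qed.

Lemma pos_sqr h : h^# = h -> pos (h ** h).
Proof.
move=> hsa; have [h0|hn0] := eqVneq (rnorm h) 0.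
  by rewrite (rnorm_eq0 h0) cmul0l; exact: pos0.
have hp : 0 < rnorm h by rewrite lt_neqAle eq_sym hn0 rnorm_ge0.
pose g := (rnorm h)^-1 :* h.
have -> : h ** h = (rnorm h ^+ 2) :* (g ** g).
  rewrite cmulZl cmulZr !scalerA -!rmorphM -[LHS]scale1r.
  by congr (_%:C%C *: _); field.
apply/posZ/pos_sqr_contraction; first exact: sqr_ge0.
  by rewrite cstarZr hsa.
by rewrite rnormZr ger0_norm ?invr_ge0 ?rnorm_ge0// mulVf.
Qed.

(** The square roots [l] of [h] and [k] of [s - h] commute and satisfy
[l^2 + k^2 = s]. *)
Lemma pos_le h (s : R) : 0 <= s -> pos h -> pos (s :* e - h) -> rnorm h <= s.
Proof.
move=> s0 hp shp.
have [//|//|l [_ [lsa _] ll lc]] := pos_sqrt (T := full_subalgebra A) _ _ hp.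
have [//|//|k [_ [ksa _] kk kc]] := pos_sqrt (T := full_subalgebra A) _ _ shp.
rewrite -ll -{1}lsa rnorm_CN; apply: (@rnorm_sq_le l k) => //; last first.
  by rewrite ll kk addrC subrK.
apply: kc; rewrite !(cmulBr, cmulBl) cmulZr cmulZl mulc1 mul1c.
by rewrite -lc.
Qed.

Lemma pos_antisym h : pos h -> pos (- h) -> h = 0.
Proof.
move=> hp hn; apply/rnorm_eq0/eqP; rewrite eq_le rnorm_ge0 andbT.
by apply: pos_le => //; rewrite scale0r sub0r.
Qed.

(** Let [x = q ** y^#]. Both [x^# ** x] and [x ** x^#] are the opposites of
squares, while their sum, half the sum of the squares of [x + x^#] and
[i (x^# - x)], is positive. *)
Lemma negative_square_eq0 y q : q^# = q -> y^# ** y = - (q ** q) -> y = 0.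
Proof.
move=> qsa yy; pose x := q ** y^#.
have xs : x^# = y ** q by rewrite cstarM cstarK qsa.
have xx : - (x^# ** x) = (y ** y^#) ** (y ** y^#).
  have -> : (y ** y^#) ** (y ** y^#) = y ** (y^# ** y) ** y^# by ncring.
  by rewrite yy xs /x; ncring.
have xx' : - (x ** x^#) = (q ** q) ** (q ** q).
  have -> : x ** x^# = q ** (y^# ** y) ** q by rewrite xs /x; ncring.
  by rewrite yy; ncring.
have nx : pos (- (x^# ** x)).
  by rewrite xx; apply: pos_sqr; rewrite cstarM cstarK.
have nx' : pos (- (x ** x^#)).
  by rewrite xx'; apply: pos_sqr; rewrite cstarM qsa.
have s0 : x^# ** x + x ** x^# = 0.
  set m := (X in X = 0); rewrite -[m]scale_half -scalerDr.
  suff -> : m + m = 0 by rewrite scaler0.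
  apply: pos_antisym; last by rewrite /m !opprD; do !apply: posD.
  have -> : m + m = (x + x^#) ** (x + x^#) + ('i%C *: (x^# - x)) ** ('i%C *: (x^# - x)).
    by rewrite cmulZl cmulZr scale_ii /m; ncring.
  apply: posD; apply: pos_sqr; first by rewrite cstarD cstarK addrC.
  by rewrite cstarZi cstarB cstarK -scalerN opprB.
have x0 : x = 0.
  apply/cstar_mul_eq0/pos_antisym => //.
  by rewrite (_ : x^# ** x = - (x ** x^#))//; apply/eqP; rewrite -addr_eq0 s0.
have qq0 : q ** q = 0.
  apply: sa_sqr_eq0; first by rewrite cstarM qsa.
  by rewrite -xx' x0 cmul0l oppr0.
by apply: cstar_mul_eq0; rewrite yy qq0 oppr0.
Qed.

(** Let [h = y^# ** y], [s = |h|] and [d = s - h], twice the negative part of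
[h]. Then [(y ** d)^# ** (y ** d) = d ** h ** d = - s ** d ** d] is the opposite
of a square, whence [y ** d = 0] and [d = 0]. *)
Lemma pos_star_mul y : pos (y^# ** y).
Proof.
set h := y^# ** y; have hsa : h^# = h by rewrite cstarM cstarK.
have [//|//|s [_ spos ss sc]] := pos_sqrt (T := full_subalgebra A) _ _ (pos_sqr hsa).
have sh : h ** s = s ** h by apply: sc; ncring.
have [//|//|r [_ [rsa _] rr rc]] := pos_sqrt (T := full_subalgebra A) _ _ spos.
have rh : h ** r = r ** h by exact: rc.
have rs : s ** r = r ** s by exact: rc.
have [ssa _] := spos.
have hs_d : (h + s) ** (s - h) = 0.
  by rewrite cmulBr !cmulDl ss sh; ncring.
have d_sa : (s - h)^# = s - h by rewrite cstarB ssa hsa.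
have rd : r ** (s - h) = (s - h) ** r by rewrite cmulBr cmulBl rs rh.
have yd : y ** (s - h) = 0.
  apply: (@negative_square_eq0 _ (r ** (s - h))).
    by rewrite cstarM rsa d_sa rd.
  apply/eqP; rewrite -addr_eq0; apply/eqP.
  rewrite cstarM d_sa.
  have -> : (s - h) ** y^# ** (y ** (s - h)) = (s - h) ** h ** (s - h) by rewrite /h; ncring.
  have -> : r ** (s - h) ** (r ** (s - h)) = s ** (s - h) ** (s - h).
    rewrite {1}rd (_ : _ ** _ = (s - h) ** (r ** r) ** (s - h)); last by ncring.
    by rewrite rr; congr (_ ** _); rewrite cmulBl cmulBr sh.
  have -> : (s - h) ** h = h ** (s - h) by rewrite cmulBr cmulBl sh.
  by rewrite -!cmulDl hs_d cmul0l.
have hd : h ** (s - h) = 0 by rewrite /h -cmulA yd cmul0r.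
have sd : s ** (s - h) = 0 by move: hs_d; rewrite cmulDl hd add0r.
have d0 : s - h = 0.
  by apply: sa_sqr_eq0 => //; rewrite {1}/GRing.add /= cmulBl sd hd subrr.
by rewrite -(subr0_eq d0).
Qed.

Lemma pos_mul_star y : pos (y ** y^#).
Proof. by rewrite -{1}[y]cstarK; exact: pos_star_mul. Qed.

(** On scalars, [x (1 - x)^2 <= 1/4] when [0 <= x <= 1]; with [x] replaced by
[a ** a^#] the left hand side is the square of the norm in question. *)
Lemma rnorm_sub_cube a : rnorm a <= 1 -> rnorm (a - a ** a^# ** a) <= 2^-1.
Proof.
move=> a1; set h := a ** a^#.
have hsa : h^# = h by rewrite cstarM cstarK.
have h1 : rnorm h <= 1 by rewrite rnorm_CN' expr_le1 ?rnorm_ge0.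
set z := a - h ** a.
have zz : z ** z^# = h - (h ** h + h ** h) + h ** h ** h.
  by rewrite cstarB cstarM hsa /z /h; ncring.
have := pos_shift hsa h1; rewrite scale1r => ph.
have [//|//|k [_ [ksa _] kk _]] := pos_sqrt (T := full_subalgebra A) _ _ ph.
have := @pos_le (z ** z^#) 4^-1 _ (pos_mul_star z); rewrite rnorm_CN' => le4.
have : rnorm z ^+ 2 <= 4^-1.
  apply: le4; first by rewrite invr_ge0.
  rewrite (_ : _ - _ = (2^-1 :* e - h) ** (2^-1 :* e - h) + (k ** h)^# ** (k ** h)).
    apply: posD; last exact: pos_star_mul.
    by apply: pos_sqr; rewrite cstarB scaleR_unit_sa hsa.
  rewrite cstarM ksa hsa zz.
  have -> : h ** k ** (k ** h) = h ** (k ** k) ** h by ncring.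
  rewrite kk !(cmulBr, cmulBl) !(cmulZr, cmulZl) !(mulc1, mul1c) scalerA -rmorphM /=.
  rewrite -[X in _ - (X - _ + _) = _](scale_half) (_ : 2^-1 * 2^-1 = 4^-1); last by field.
  ncring.
have := rnorm_ge0 z; nra.
Qed.

End Unital.

(** * The unitization *)

Section Unitization.
Context (R : realType) (A : cstarAlgType R).

Let W : lmodType R[i] := (R[i]^o * A)%type.
Implicit Types (T S : W) (x : A).

Definition uact T x : A := T.1 *: x + T.2 ** x.

Definition umul T S : W := (T.1 * S.1, T.1 *: S.2 + S.1 *: T.2 + T.2 ** S.2).

Definition ustar T : W := (T.1^*, T.2^#).

Lemma uactD T S x : uact (T + S) x = uact T x + uact S x.
Proof. by rewrite /uact /= scalerDl cmulDl addrACA. Qed.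

Lemma uactZ k T x : uact (k *: T) x = k *: uact T x.
Proof. by rewrite /uact /= cmulZl scalerDr scalerA. Qed.

Lemma uactM T S x : uact (umul T S) x = uact T (uact S x).
Proof.
rewrite /uact /umul /= !cmulDl !cmulDr !cmulZl !cmulZr scalerDr scalerA.
by rewrite -!addrA; do 3!congr (_ + _); rewrite ?cmulA// addrCA.
Qed.

(** The adjoint for the [A]-valued inner product [x, y |-> x^# ** y]. *)
Lemma uact_star T x y : x^# ** uact T y = (uact (ustar T) x)^# ** y.
Proof.
rewrite /uact /ustar /= cstarD cstarZ conjCK cstarM cstarK.
by rewrite cmulDr cmulDl cmulZr cmulZl cmulA.
Qed.

Definition uopnorm T : R := best_bound (fun x => rnorm (uact T x)) (fun x => rnorm x).

Lemma uact_bounded T :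
  exists C, bound (fun x => rnorm (uact T x)) (fun x => rnorm x) C.
Proof.
exists (cabs T.1 + rnorm T.2); split=> [|x].
  by rewrite addr_ge0 ?cabs_ge0 ?rnorm_ge0.
by rewrite (le_trans (rnormD _ _))// mulrDl lerD ?rnormM// rnormZ.
Qed.

Lemma uopnorm_ge0 T : 0 <= uopnorm T.
Proof. exact/best_bound_ge0/uact_bounded. Qed.

Lemma uopnormP T x : rnorm (uact T x) <= uopnorm T * rnorm x.
Proof.
exact: (best_boundP (fun x => rnorm_ge0 x) (uact_bounded T)).
Qed.

Lemma uopnorm_le T C : 0 <= C -> (forall x, rnorm (uact T x) <= C * rnorm x) ->
  uopnorm T <= C.
Proof. exact: best_bound_le. Qed.

Lemma uopnormD T S : uopnorm (T + S) <= uopnorm T + uopnorm S.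
Proof.
apply: uopnorm_le => [|x]; first by rewrite addr_ge0 ?uopnorm_ge0.
by rewrite uactD (le_trans (rnormD _ _))// mulrDl lerD ?uopnormP.
Qed.

Lemma uopnormZ_le k T : uopnorm (k *: T) <= cabs k * uopnorm T.
Proof.
apply: uopnorm_le => [|x]; first by rewrite mulr_ge0 ?uopnorm_ge0 ?cabs_ge0.
by rewrite uactZ rnormZ -mulrA ler_wpM2l ?cabs_ge0 ?uopnormP.
Qed.

Lemma uopnormZ k T : uopnorm (k *: T) = cabs k * uopnorm T.
Proof.
apply/eqP; rewrite eq_le uopnormZ_le /=.
have [->|k0] := eqVneq k 0; first by rewrite cabs0 mul0r uopnorm_ge0.
rewrite -{1}[T](scale1r) -(mulVf k0) -scalerA.
rewrite (le_trans (ler_wpM2l _ (uopnormZ_le _ _))) ?cabs_ge0//.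
by rewrite mulrA -cabsM mulfV// cabs1 mul1r.
Qed.

Lemma uopnormM T S : uopnorm (umul T S) <= uopnorm T * uopnorm S.
Proof.
apply: uopnorm_le => [|x]; first by rewrite mulr_ge0 ?uopnorm_ge0.
rewrite uactM (le_trans (uopnormP _ _))// -mulrA ler_wpM2l ?uopnorm_ge0//.
exact: uopnormP.
Qed.

Lemma uopnorm_sqr_le T : uopnorm T ^+ 2 <= uopnorm (umul (ustar T) T).
Proof.
rewrite -ler_sqrt ?uopnorm_ge0// sqrtr_sqr ger0_norm ?uopnorm_ge0//.
apply: uopnorm_le => [|x]; first exact: sqrtr_ge0.
rewrite -(@ler_pXn2r _ 2) ?nnegrE ?rnorm_ge0 ?mulr_ge0 ?sqrtr_ge0 ?rnorm_ge0//.
rewrite exprMn sqr_sqrtr ?uopnorm_ge0// -rnorm_CN.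
have -> : (uact T x)^# ** uact T x = x^# ** uact (umul (ustar T) T) x.
  by rewrite uactM [RHS]uact_star /ustar /= conjCK cstarK; case: T.
rewrite (le_trans (rnormM _ _))// rnorm_star mulrC expr2 mulrA.
by rewrite ler_wpM2r ?rnorm_ge0 ?uopnormP.
Qed.

Lemma ustarK T : ustar (ustar T) = T.
Proof. by case: T => k a; rewrite /ustar /= conjCK cstarK. Qed.

Lemma uopnorm_star T : uopnorm (ustar T) = uopnorm T.
Proof.
have le S : uopnorm S <= uopnorm (ustar S).
  have [->|n0] := eqVneq (uopnorm S) 0; first exact: uopnorm_ge0.
  have np : 0 < uopnorm S by rewrite lt_neqAle eq_sym n0 uopnorm_ge0.
  rewrite -(ler_pM2r np) -expr2 (le_trans (uopnorm_sqr_le _))//.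
  exact: uopnormM.
by apply/eqP; rewrite eq_le le -{2}[T]ustarK le.
Qed.

Lemma uopnorm_CN T : uopnorm (umul (ustar T) T) = uopnorm T ^+ 2.
Proof.
apply/eqP; rewrite eq_le uopnorm_sqr_le andbT (le_trans (uopnormM _ _))//.
by rewrite uopnorm_star.
Qed.

(** The operator norm alone is only a seminorm when [A] has a unit. *)
Definition unorm T : R := Num.max (cabs T.1) (uopnorm T).

Lemma unormE T C : (unorm T <= C) = (cabs T.1 <= C) && (uopnorm T <= C).
Proof. by rewrite ge_max. Qed.

Lemma unorm_fst T : cabs T.1 <= unorm T.
Proof. by rewrite le_max lexx. Qed.

Lemma unorm_op T : uopnorm T <= unorm T.
Proof. by rewrite le_max lexx orbT. Qed.

Lemma unorm_ge0 T : 0 <= unorm T.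
Proof. exact: le_trans (uopnorm_ge0 _) (unorm_op T). Qed.

Lemma unorm_le T : unorm T <= cabs T.1 + rnorm T.2.
Proof.
rewrite unormE lerDl rnorm_ge0 /=; apply: uopnorm_le => [|x].
  by rewrite addr_ge0 ?cabs_ge0 ?rnorm_ge0.
by rewrite (le_trans (rnormD _ _))// mulrDl lerD ?rnormM// rnormZ.
Qed.

Lemma rnorm_snd T : rnorm T.2 <= 2 * unorm T.
Proof.
have [->|n0] := eqVneq (rnorm T.2) 0; first by rewrite mulr_ge0 ?unorm_ge0.
have np : 0 < rnorm T.2 by rewrite lt_neqAle eq_sym n0 rnorm_ge0.
rewrite -(ler_pM2r np) -expr2 -rnorm_CN'.
have -> : T.2 ** T.2^# = uact T T.2^# - T.1 *: T.2^# by rewrite /uact addrC addKr.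
rewrite (le_trans (rnormB _ _))// rnormZ (le_trans (lerD (uopnormP _ _) (lexx _)))//.
rewrite rnorm_star -mulrDl ler_pM2r//.
by have := unorm_fst T; have := unorm_op T; lra.
Qed.

Lemma uopnorm_emb a : uopnorm (0, a) = rnorm a.
Proof.
apply/eqP; rewrite eq_le; apply/andP; split.
  by apply: uopnorm_le => [|x]; rewrite ?rnorm_ge0// /uact scale0r add0r rnormM.
have [->|n0] := eqVneq (rnorm a) 0; first exact: uopnorm_ge0.
have np : 0 < rnorm a by rewrite lt_neqAle eq_sym n0 rnorm_ge0.
rewrite -(ler_pM2r np) -expr2 -rnorm_CN' -[rnorm a in leRHS]rnorm_star.
by have := uopnormP (0, a) a^#; rewrite /uact scale0r add0r.
Qed.

Lemma unorm_emb a : unorm (0, a) = rnorm a.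
Proof. by rewrite /unorm uopnorm_emb /= cabs0 max_r ?rnorm_ge0. Qed.

Lemma unormD T S : unorm (T + S) <= unorm T + unorm S.
Proof.
rewrite unormE; apply/andP; split.
  by rewrite (le_trans (cabsD _ _))// lerD ?unorm_fst.
by rewrite (le_trans (uopnormD _ _))// lerD ?unorm_op.
Qed.

Lemma unormZ k T : unorm (k *: T) = cabs k * unorm T.
Proof. by rewrite /unorm uopnormZ /= cabsM maxr_pMr ?cabs_ge0. Qed.

Lemma unorm_eq0 T : unorm T = 0 -> T = 0.
Proof.
move=> T0; have := unorm_fst T; have := rnorm_snd T; rewrite T0 mulr0.
case: T {T0} => k a /= an kn.
congr (_, _); first by apply/cabs_eq0/eqP; rewrite eq_le kn cabs_ge0.
by apply/rnorm_eq0/eqP; rewrite eq_le an rnorm_ge0.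
Qed.

Lemma unorm_complete (u : nat -> W) :
  (forall e, 0 < e -> exists N, forall m n, (N <= m)%N -> (N <= n)%N ->
     unorm (u m - u n) < e) ->
  exists l, forall e, 0 < e -> exists N, forall n, (N <= n)%N -> unorm (u n - l) < e.
Proof.
move=> cu.
have [e e0|k ku] := @complex_cauchy R (fun n => (u n).1).
  have [N Nu] := cu _ e0; exists N => m n Nm Nn.
  exact: le_lt_trans (unorm_fst (u m - u n)) (Nu _ _ Nm Nn).
have [e e0|a au] := @cauchy_sequence_tends R A (fun n => (u n).2).
  have [N Nu] := cu _ (divr_gt0 e0 (ltr0n _ 2)); exists N => m n Nm Nn.
  have := rnorm_snd (u m - u n); have := Nu _ _ Nm Nn => /=; lra.
exists (k, a) => e e0.
have [N1 h1] := ku _ (divr_gt0 e0 (ltr0n _ 2)).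
have [N2 h2] := au _ (divr_gt0 e0 (ltr0n _ 2)).
exists (maxn N1 N2) => n; rewrite geq_max => /andP[/h1 hk /h2 ha].
have := unorm_le (u n - (k, a)) => /=; lra.
Qed.

Definition unitization_norm := CompleteNorm unormD unormZ unorm_eq0 unorm_complete.

Definition unitization : Type := banach unitization_norm.

HB.instance Definition _ := CompleteNormedModule.on unitization.

Let umulA : associative (umul : unitization -> unitization -> unitization).
Proof.
move=> [k a] [l b] [m c]; rewrite /umul /=; congr (_, _); first by rewrite mulrA.
rewrite !cmulDl !cmulDr !cmulZl !cmulZr !scalerDr !scalerA.
by rewrite [m * k]mulrC [m * l]mulrC; ncring.
Qed.

Let umulDl : left_distributive (umul : unitization -> unitization -> unitization) +%R.
Proof.
move=> [k a] [l b] [m c]; congr (_, _) => /=; first by rewrite mulrDl.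
by rewrite cmulDl scalerDl scalerDr; ncring.
Qed.

Let umulDr : right_distributive (umul : unitization -> unitization -> unitization) +%R.
Proof.
move=> [k a] [l b] [m c]; congr (_, _) => /=; first by rewrite mulrDr.
by rewrite cmulDr scalerDl scalerDr; ncring.
Qed.

Let umulZl (k : R[i]) (a b : unitization) :
  (umul (k *: a) b : unitization) = k *: (umul a b : unitization).
Proof.
case: a b => [l a] [m b]; congr (_, _) => /=; first exact/esym/mulrA.
by rewrite cmulZl !scalerDr !scalerA [m * k]mulrC.
Qed.

Let umulZr (k : R[i]) (a b : unitization) :
  (umul a (k *: b) : unitization) = k *: (umul a b : unitization).
Proof.
case: a b => [l a] [m b]; congr (_, _) => /=; first exact: mulrCA.
by rewrite cmulZr !scalerDr !scalerA [l * k]mulrC.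
Qed.

Let ustarD : {morph (ustar : unitization -> unitization) : a b / a + b}.
Proof. by move=> [k a] [l b]; congr (_, _) => /=; rewrite ?rmorphD ?cstarD. Qed.

Let ustarZ (k : R[i]) (a : unitization) :
  (ustar (k *: a) : unitization) = k^* *: (ustar a : unitization).
Proof. by case: a => [l a]; congr (_, _) => /=; rewrite ?rmorphM ?cstarZ. Qed.

Let ustarM (a b : unitization) : (ustar (umul a b) : unitization) = umul (ustar b) (ustar a).
Proof.
case: a b => [l a] [m b]; congr (_, _) => /=; first by rewrite rmorphM mulrC.
by rewrite !cstarD !cstarZ cstarM [X in X + _]addrC.
Qed.

Let unormM (a b : unitization) : `|umul a b : unitization| <= `|a| * `|b|.
Proof.
rewrite !rnormE -rmorphM lecR !banach_rnorm /= unormE /= cabsM.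
rewrite ler_pM ?cabs_ge0 ?unorm_fst//= (le_trans (uopnormM _ _))//.
by rewrite ler_pM ?uopnorm_ge0 ?unorm_op.
Qed.

Let unorm_CN (a : unitization) : `|umul (ustar a) a : unitization| = `|a| ^+ 2.
Proof.
rewrite !rnormE -rmorphXn !banach_rnorm /=; congr (_%:C%C).
rewrite {1}/unorm uopnorm_CN /= cabsM cabsJ -expr2 /unorm.
case: (leP (cabs a.1) (uopnorm a)) => h.
  by rewrite max_r// lerXn2r ?nnegrE ?cabs_ge0 ?uopnorm_ge0.
by rewrite max_l// lerXn2r ?nnegrE ?cabs_ge0 ?uopnorm_ge0 ?ltW.
Qed.

HB.instance Definition _ := isCstarAlgebra.Build R unitization
  umulA umulDl umulDr umulZl umulZr ustarK ustarD ustarZ ustarM unormM unorm_CN.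

Definition uone : unitization := (1, 0).

Definition uemb (a : A) : unitization := (0, a).

End Unitization.

(** * Extreme points by Zorn's lemma *)

(** Convex sets of functionals are described by sublinear functions [p], as the
sets of all linear [f] below [p]. A decreasing chain of such sets corresponds to
a pointwise infimum, so that Zorn's lemma applies without any topology; it does
the work of both the Hahn-Banach and the Krein-Milman theorems. *)

Section Extreme.
Context (R : realType) (V : lmodType R[i]) (T : set V).
Local Notation "r :* x" := (r%:C%C *: x) (at level 40).
Hypotheses (T0 : T 0) (TD : forall x y, T x -> T y -> T (x + y))
  (TZ : forall (r : R) x, T x -> T (r :* x)).
Implicit Types (p q f g : V -> R) (x y : V).

Definition sublinear p :=
  (forall x y, T x -> T y -> p (x + y) <= p x + p y) /\
  (forall r x, 0 <= r -> T x -> p (r :* x) = r * p x).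

Definition real_linear f :=
  (forall x y, T x -> T y -> f (x + y) = f x + f y) /\
  (forall r x, T x -> f (r :* x) = r * f x).

Definition below f p := forall x, T x -> f x <= p x.

Let TN x : T x -> T (- x).
Proof. by move=> Tx; rewrite -scaleN1r -(rmorphN1 (real_complex R)); apply: TZ. Qed.

Lemma sublinear0 p : sublinear p -> p 0 = 0.
Proof. by move=> [_ pZ]; rewrite -[0](scale0r (0 : V)) pZ// mul0r. Qed.

Lemma sublinearN p x : sublinear p -> T x -> - p (- x) <= p x.
Proof.
move=> sp Tx; rewrite lerNl -subr_ge0 opprK -(sublinear0 sp) -(addNr x).
by apply: sp.1 => //; apply: TN.
Qed.

Lemma real_linearN f x : real_linear f -> T x -> f (- x) = - f x.
Proof.
move=> [_ fZ] Tx.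
by rewrite -scaleN1r -(rmorphN1 (real_complex R)) fZ// mulN1r.
Qed.

Lemma real_linear_eq f g : real_linear f -> real_linear g -> below f g ->
  forall x, T x -> f x = g x.
Proof.
move=> fl gl fg x Tx; apply/eqP; rewrite eq_le fg//= -lerN2.
by rewrite -!real_linearN// fg//; apply: TN.
Qed.

(** The support function of the set of the functionals below [p] that take at
[y] their largest possible value [p y]. *)
Definition expose p y x := inf [set p (x + s :* y) - s * p y | s in [set s | 0 <= s]].

Section Expose.
Variables (p : V -> R) (y : V).
Hypotheses (sp : sublinear p) (Ty : T y).

Let expose_lb x : T x ->
  lbound [set p (x + s :* y) - s * p y | s in [set s | 0 <= s]] (- p (- x)).
Proof.
move=> Tx _ [s /= s0 <-]; rewrite lerBrDr -sp.2// addrC lerBlDr.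
have := sp.1 (x + s :* y) (- x) (TD Tx (TZ _ Ty)) (TN Tx).
by rewrite addrAC subrr add0r.
Qed.

Let expose_neq0 x : [set p (x + s :* y) - s * p y | s in [set s | 0 <= s]] !=set0.
Proof. by exists (p (x + 0 :* y) - 0 * p y), 0 => //=. Qed.

Lemma expose_le x s : T x -> 0 <= s -> expose p y x <= p (x + s :* y) - s * p y.
Proof.
move=> Tx s0; apply: ge_inf; last by exists s.
by exists (- p (- x)); apply: expose_lb.
Qed.

Lemma expose_ge x c : (forall s, 0 <= s -> c <= p (x + s :* y) - s * p y) ->
  c <= expose p y x.
Proof. by move=> h; apply: (lb_le_inf (expose_neq0 x)) => _ [s /= s0 <-]; apply: h. Qed.

Lemma expose_below : below (expose p y) p.
Proof. by move=> x Tx; have := expose_le Tx (lexx 0); rewrite scale0r addr0 mul0r subr0. Qed.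

Lemma exposeN : expose p y (- y) <= - p y.
Proof.
have := expose_le (TN Ty) (ler01 : 0 <= 1 :> R).
by rewrite scale1r addNr (sublinear0 sp) mul1r sub0r.
Qed.

Lemma expose_sublinear : sublinear (expose p y).
Proof.
split=> [x x' Tx Tx'|r x r0 Tx].
  rewrite -lerBlDr; apply: expose_ge => s s0.
  rewrite lerBlDr -lerBlDl; apply: expose_ge => s' s'0.
  rewrite lerBlDl (le_trans (expose_le (TD Tx Tx') (addr_ge0 s0 s'0)))//.
  have := sp.1 (x + s :* y) (x' + s' :* y) (TD Tx (TZ _ Ty)) (TD Tx' (TZ _ Ty)).
  rewrite addrACA -scalerDl -rmorphD /=; lra.
have [->|rn0] := eqVneq r 0.
  rewrite scale0r mul0r; apply/eqP; rewrite eq_le; apply/andP; split.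
    by have := expose_below T0; rewrite (sublinear0 sp).
  by apply: expose_ge => s s0; rewrite add0r sp.2// subrr.
have rp : 0 < r by rewrite lt_neqAle eq_sym rn0.
apply/eqP; rewrite eq_le; apply/andP; split.
  rewrite mulrC -ler_pdivrMr//; apply: expose_ge => s s0.
  rewrite ler_pdivrMr//.
  have := expose_le (TZ r Tx) (mulr_ge0 r0 s0).
  rewrite rmorphM /= -scalerA -scalerDr sp.2//; last exact: (TD Tx (TZ s Ty)).
  lra.
apply: expose_ge => s s0.
have := expose_le Tx (divr_ge0 s0 r0).
rewrite -(ler_pM2l rp) mulrBr -(sp.2 r)//; last exact: (TD Tx (TZ _ Ty)).
rewrite scalerDr scalerA -rmorphM /= mulrCA mulfV// mulr1.
by rewrite mulrA mulrCA mulfV// mulr1.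
Qed.

End Expose.

Variable p0 : V -> R.
Hypothesis sp0 : sublinear p0.

Definition face p := forall f g, real_linear f -> real_linear g ->
  below f p0 -> below g p0 -> (forall x, T x -> f x + g x <= 2 * p x) ->
  below f p.

Lemma face0 : face p0. Proof. by move=> f g _ _ fp _ _. Qed.

Lemma face_expose p y : sublinear p -> T y -> face p -> face (expose p y).
Proof.
move=> sp Ty Fp f g fl gl fp0 gp0 fgp.
have fgp' x : T x -> f x + g x <= 2 * p x.
  by move=> Tx; have := expose_below sp Ty Tx; have := fgp x Tx; lra.
have fp : below f p by exact: (Fp f g).
have gp : below g p by apply: (Fp g f) => // x Tx; rewrite addrC; exact: fgp'.
have fy : f y = p y.
  have := fgp _ (TN Ty); rewrite (real_linearN fl Ty) (real_linearN gl Ty).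
  have := exposeN sp Ty; have := fp _ Ty; have := gp _ Ty; lra.
move=> x Tx; apply: expose_ge => s s0.
by rewrite -fy -(fl.2 s y Ty) lerBrDr -(fl.1 _ _ Tx (TZ s Ty)); exact: fp (TD Tx (TZ s Ty)).
Qed.

(** A sublinear functional minimal among those whose dominated functionals form
a face is linear, as otherwise it could be exposed further; it is then an
extreme point. *)
Lemma extreme_dominated h : T h -> exists f, [/\ real_linear f, below f p0,
  f h = p0 h & forall f1 f2, real_linear f1 -> real_linear f2 ->
    below f1 p0 -> below f2 p0 -> (forall x, T x -> f1 x + f2 x = 2 * f x) ->
    forall x, T x -> f1 x = f x].
Proof.
move=> Th.
pose good p := [/\ sublinear p, below p p0, p (- h) <= - p0 h & face p].
pose P := {p : V -> R | good p}.
pose le (p q : P) := `[< below (sval q) (sval p) >].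
have good0 : good (expose p0 h).
  split; [exact: expose_sublinear|exact: expose_below|exact: exposeN|].
  exact/face_expose/face0.
have [|p q r /asboolP pq /asboolP qr||[p [sp pp0 ph Fp]] pmax] := @ZL_preorder P (exist _ _ good0) le.
- by move=> p; apply/asboolP => x Tx.
- by apply/asboolP => x Tx; apply: le_trans (pq x Tx); apply: qr.
- move=> C Ctot; have [[c0 Cc0]|/nonemptyPn C0] := pselect (C !=set0); last first.
    by exists (exist _ _ good0) => s; rewrite C0.
  pose E x := [set sval (p : P) x | p in C].
  pose pinf x := inf (E x).
  have Elb x : T x -> lbound (E x) (- p0 (- x)).
    move=> Tx _ [[p [sp pp0 _ _]] _ /= <-].
    rewrite (le_trans _ (sublinearN sp Tx))// lerN2.
    by apply: pp0; apply: TN.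
  have pinf_le (p : P) x : C p -> T x -> pinf x <= sval p x.
    move=> Cp Tx; apply: ge_inf; last by exists p.
    by exists (- p0 (- x)); apply: Elb.
  have pinf_ge x (c : R) : (forall p : P, C p -> c <= sval p x) -> c <= pinf x.
    move=> h'; apply: lb_le_inf; first by exists (sval c0 x), c0.
    by move=> _ [p Cp <-]; apply: h'.
  have pinfG : good pinf.
    split.
    - split=> [x y Tx Ty|r x r0 Tx].
        rewrite -lerBlDr; apply: (pinf_ge) => p Cp.
        rewrite lerBlDr -lerBlDl; apply: (pinf_ge) => q Cq.
        rewrite lerBlDl.
        have [/asboolP pq|/asboolP qp] := Ctot p q Cp Cq.
          have [[qD _] _ _ _] := svalP q.
          have := pinf_le q _ Cq (TD Tx Ty); have := qD x y Tx Ty.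
          by have := pq x Tx; have := pq y Ty; lra.
        have [[pD _] _ _ _] := svalP p.
        have := pinf_le p _ Cp (TD Tx Ty); have := pD x y Tx Ty.
        by have := qp x Tx; have := qp y Ty; lra.
      have pZ (p : P) : sval p (r :* x) = r * sval p x by have [[_ ->]] := svalP p.
      have [->|rn0] := eqVneq r 0.
        rewrite mul0r scale0r; apply/eqP; rewrite eq_le; apply/andP; split.
          rewrite (le_trans (pinf_le c0 _ Cc0 T0))//.
          by have [sc _ _ _] := svalP c0; rewrite (sublinear0 sc).
        apply: (pinf_ge) => p Cp.
        by have [sc _ _ _] := svalP p; rewrite (sublinear0 sc).
      have rp : 0 < r by rewrite lt_neqAle eq_sym rn0.
      apply/eqP; rewrite eq_le; apply/andP; split.
        rewrite mulrC -ler_pdivrMr//; apply: (pinf_ge) => p Cp.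
        rewrite ler_pdivrMr// mulrC -pZ; apply: pinf_le => //; exact: TZ.
      apply: (pinf_ge) => p Cp; rewrite pZ ler_wpM2l//; exact: pinf_le.
    - move=> x Tx; apply: le_trans (pinf_le _ _ Cc0 Tx) _.
      by have [_ + _ _] := svalP c0; apply.
    - apply: le_trans (pinf_le _ _ Cc0 (TN Th)) _.
      by have [_ _ + _] := svalP c0.
    - move=> f g fl gl fp gp fg x Tx; apply: (pinf_ge) => p Cp.
      have [_ _ _ Fp] := svalP p; apply: (Fp f g) => // z Tz.
      by apply: le_trans (fg z Tz) _; rewrite ler_pM2l//; exact: pinf_le.
  by exists (exist _ _ pinfG) => s Cs; apply/asboolP => x Tx /=; exact: pinf_le.
have pN y : T y -> p (- y) = - p y.
  move=> Ty; apply/eqP; rewrite eq_le; apply/andP; split; last first.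
    by rewrite lerNl; apply: sublinearN.
  have goode : good (expose p y).
    split; [exact: expose_sublinear| | |exact: face_expose].
      by move=> x Tx; apply: le_trans (expose_below sp Ty Tx) (pp0 _ Tx).
    by apply: le_trans (expose_below sp Ty (TN Th)) ph.
  have /asboolP/(_ _ (TN Ty))/= pe : le (exist _ _ goode) (exist _ p (And4 sp pp0 ph Fp)).
    by apply: pmax; apply/asboolP => x Tx /=; apply: expose_below.
  by apply: le_trans pe (exposeN sp Ty).
have pl : real_linear p.
  split=> [x y Tx Ty|r x Tx].
    apply/eqP; rewrite eq_le sp.1//= -lerN2 -pN; last exact: TD.
    by rewrite !opprD -(pN x Tx) -(pN y Ty) sp.1//; apply: TN.
  have [r0|r0] := leP 0 r; first exact: sp.2.
  rewrite -[r in LHS]opprK rmorphN scaleNr pN; last exact: TZ.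
  by rewrite sp.2 ?oppr_ge0 ?ltW// mulNr opprK.
exists p; split=> //.
  by apply/eqP; rewrite eq_le pp0//= -lerN2 -pN.
move=> f1 f2 f1l f2l f1p f2p f12.
apply: real_linear_eq => //.
by apply: (Fp f1 f2) => // x Tx; rewrite f12.
Qed.

End Extreme.

(** * Hilbert space completions *)

(** A positive semidefinite form. It is only given on a subspace [ph_dom], as the
fibers of a Fell bundle are subspaces of an ambient algebra. *)
Record preHilbert (R : realType) := PreHilbert {
  ph_space :> lmodType R[i] ;
  ph_dom : set ph_space ;
  ph_form : ph_space -> ph_space -> R[i] ;
  ph_dom0 : ph_dom 0 ;
  ph_domP : forall (k : R[i]) x y, ph_dom x -> ph_dom y -> ph_dom (k *: x + y) ;
  ph_formP : forall (k : R[i]) x y z, ph_dom x -> ph_dom y -> ph_dom z ->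
    ph_form (k *: x + y) z = k * ph_form x z + ph_form y z ;
  ph_formC : forall x y, ph_dom x -> ph_dom y -> ph_form y x = (ph_form x y)^* ;
  ph_form_ge0 : forall x, ph_dom x -> 0 <= ph_form x x
}.

Section PreHilbert.
Context (R : realType) (E : preHilbert R).
Local Notation X := (@ph_dom R E).
Local Notation s := (@ph_form R E).
Implicit Types (x y z a b : E) (k : R[i]).

Lemma ph_domZ k x : X x -> X (k *: x).
Proof. by move=> Xx; rewrite -[_ *: _]addr0; apply: ph_domP => //; exact: ph_dom0. Qed.

Lemma ph_domB x y : X x -> X y -> X (x - y).
Proof. by move=> Xx Xy; rewrite addrC -scaleN1r; apply: ph_domP. Qed.

Lemma ph_form0l z : X z -> s 0 z = 0.
Proof.
move=> Xz; have := ph_formP (-1) (@ph_dom0 R E) (@ph_dom0 R E) Xz.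
by rewrite scaler0 add0r mulN1r addNr.
Qed.

Lemma ph_formZl k x z : X x -> X z -> s (k *: x) z = k * s x z.
Proof.
move=> Xx Xz; have := ph_formP k Xx (@ph_dom0 R E) Xz.
by rewrite addr0 ph_form0l// addr0.
Qed.

Lemma ph_formBl x y z : X x -> X y -> X z -> s (x - y) z = s x z - s y z.
Proof.
by move=> Xx Xy Xz; rewrite [x - y]addrC -scaleN1r ph_formP// mulN1r addrC.
Qed.

Lemma ph_formPr k x y z : X x -> X y -> X z -> s z (k *: x + y) = k^* * s z x + s z y.
Proof.
move=> Xx Xy Xz; have Xk := ph_domP k Xx Xy.
rewrite (ph_formC Xk Xz) ph_formP// rmorphD rmorphM /=.
by rewrite -(ph_formC Xx Xz) -(ph_formC Xy Xz).
Qed.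

Lemma ph_formZr k x z : X x -> X z -> s z (k *: x) = k^* * s z x.
Proof.
move=> Xx Xz; rewrite (ph_formC (ph_domZ k Xx) Xz) ph_formZl// rmorphM /=.
by rewrite -(ph_formC Xx Xz).
Qed.

Lemma ph_formBr x y z : X x -> X y -> X z -> s z (x - y) = s z x - s z y.
Proof.
move=> Xx Xy Xz; rewrite [x - y]addrC -scaleN1r ph_formPr// rmorphN1 mulN1r.
by rewrite addrC.
Qed.

Definition seminorm x : R := if `[< X x >] then Num.sqrt (complex.Re (s x x)) else 0.

Lemma seminorm_ge0 x : 0 <= seminorm x.
Proof. by rewrite /seminorm; case: ifP => // _; exact: sqrtr_ge0. Qed.

Lemma seminorm_sqr x : X x -> s x x = (seminorm x ^+ 2)%:C%C.
Proof.
move=> Xx; have s0 := ph_form_ge0 Xx; rewrite /seminorm asboolT// sqr_sqrtr.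
  exact: ge0_ReE.
by rewrite -lecR -ge0_ReE.
Qed.

Lemma ph_cauchy_schwarz x y : X x -> X y -> cabs (s x y) <= seminorm x * seminorm y.
Proof.
move=> Xx Xy; set z := s x y.
have pos (r : R) : 0 <= seminorm x ^+ 2 - 2 * r * cabs z ^+ 2
    + r ^+ 2 * cabs z ^+ 2 * seminorm y ^+ 2.
  have Xv : X (x - (r%:C%C * z) *: y) by apply/ph_domB/ph_domZ.
  have Xzy : X ((r%:C%C * z) *: y) by exact: ph_domZ.
  have := ph_form_ge0 Xv; rewrite ph_formBl// !ph_formBr// !ph_formZl// !ph_formZr//.
  rewrite (ph_formC Xx Xy) -/z !seminorm_sqr//.
  have -> : (r%:C%C * z)^* = r%:C%C * z^* by rewrite rmorphM /= conj_real.
  rewrite (_ : _ - _ = (seminorm x ^+ 2 - 2 * r * cabs z ^+ 2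
    + r ^+ 2 * cabs z ^+ 2 * seminorm y ^+ 2)%:C%C); first by rewrite -lecR.
  have := cabs_sqr z.
  move: (cabs z ^+ 2) (seminorm x ^+ 2) (seminorm y ^+ 2) => n a b zn.
  by rewrite rmorphD rmorphB !rmorphM /= zn rmorph_nat; ring.
have [y0|y0] := eqVneq (seminorm y) 0.
  have := pos ((seminorm x ^+ 2 + 1) / (2 * cabs z ^+ 2)).
  rewrite y0 expr0n !mulr0 addr0; have [->//|z0] := eqVneq (cabs z) 0.
  have -> : 2 * ((seminorm x ^+ 2 + 1) / (2 * cabs z ^+ 2)) * cabs z ^+ 2 = seminorm x ^+ 2 + 1.
    by field.
  lra.
have yp : 0 < seminorm y by rewrite lt_neqAle eq_sym y0 seminorm_ge0.
have := pos ((seminorm y ^+ 2)^-1).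
have -> : (seminorm y ^+ 2)^-1 ^+ 2 * cabs z ^+ 2 * seminorm y ^+ 2 = (seminorm y ^+ 2)^-1 * cabs z ^+ 2.
  by field.
move=> h; rewrite -(@ler_pXn2r _ 2) ?nnegrE ?cabs_ge0 ?mulr_ge0 ?seminorm_ge0//.
rewrite exprMn -ler_pdivrMr ?exprn_gt0// mulrC; lra.
Qed.

(** The vector [[a]] of the completion is represented by the antilinear
functional [s a]. *)
Definition riesz a b : R[i] := if `[< X a /\ X b >] then s a b else 0.

Lemma rieszE a b : X a -> X b -> riesz a b = s a b.
Proof. by move=> Xa Xb; rewrite /riesz asboolT. Qed.

Lemma riesz_out a b : ~ X b -> riesz a b = 0.
Proof. by move=> Xb; rewrite /riesz asboolF// => -[]. Qed.

Definition in_completion (f : E -> R[i]) := (forall b, ~ X b -> f b = 0) /\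
  forall e, 0 < e -> exists2 a, X a & forall b, X b -> cabs (f b - s a b) <= e * seminorm b.

Definition completion_pred : {pred E -> R[i]} := [pred f | `[< in_completion f >]].

Lemma completion_submod : submod_closed completion_pred.
Proof.
split=> [|k f g /asboolP[f0 fa] /asboolP[g0 ga]]; apply/asboolP.
  split=> // e e0; exists 0; first exact: ph_dom0.
  by move=> b Xb; rewrite ph_form0l// subrr cabs0 mulr_ge0 ?seminorm_ge0// ltW.
split=> [b Xb|e e0]; first by rewrite /= !fctE f0// g0// scaler0 addr0.
have k1 : 0 < cabs k + 1 by rewrite ltr_wpDl ?cabs_ge0.
have [a Xa aP] := fa _ (divr_gt0 (divr_gt0 e0 (ltr0n _ 2)) k1).
have [a' Xa' a'P] := ga _ (divr_gt0 e0 (ltr0n _ 2)).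
exists (k *: a + a'); first exact: ph_domP.
move=> b Xb; rewrite ph_formP// !fctE.
have -> : k *: f b + g b - (k * s a b + s a' b) = k * (f b - s a b) + (g b - s a' b).
  by rewrite -[k *: f b]/(k * f b); ring.
rewrite (le_trans (cabsD _ _))// cabsM.
have h1 := aP b Xb; have h2 := a'P b Xb.
have h3 : cabs k * cabs (f b - s a b) <= (e / 2) * seminorm b.
  rewrite (le_trans (ler_wpM2l (cabs_ge0 _) h1))// mulrA ler_wpM2r ?seminorm_ge0//.
  rewrite mulrA ler_pdivrMr// mulrDr mulr1 mulrC lerDl.
  by rewrite divr_ge0// ltW.
lra.
Qed.

HB.instance Definition _ :=
  GRing.isSubmodClosed.Build R[i] (E -> R[i]) completion_pred completion_submod.

Record completion := Completion {
  completion_val :> E -> R[i] ; completion_valP : completion_val \in completion_pred }.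

HB.instance Definition _ := [isSub for completion_val].
HB.instance Definition _ := [Choice of completion by <:].
HB.instance Definition _ := [SubChoice_isSubLmodule of completion by <:].

Implicit Types (f g h : completion).

Lemma completionP f : in_completion f.
Proof. by have /asboolP := completion_valP f. Qed.

Lemma completion_eq f g : (forall b, X b -> f b = g b) -> f = g.
Proof.
move=> fg; apply/val_inj/funext => b /=.
have [Xb|Xb] := pselect (X b); first exact: fg.
by rewrite (completionP f).1// (completionP g).1.
Qed.

Lemma completionD f g b : (f + g) b = f b + g b.
Proof. by []. Qed.

Lemma completionZ k f b : (k *: f) b = k * f b.
Proof. by []. Qed.

Lemma completionB f g b : (f - g) b = f b - g b.
Proof. by []. Qed.

Lemma riesz_completion a : riesz a \in completion_pred.
Proof.
apply/asboolP; split=> [b Xb|e e0]; first exact: riesz_out.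
have [Xa|Xa] := pselect (X a).
  exists a => // b Xb; rewrite rieszE// subrr cabs0.
  by rewrite mulr_ge0 ?seminorm_ge0// ltW.
exists 0; first exact: ph_dom0.
move=> b Xb; rewrite ph_form0l// /riesz asboolF; last by case.
by rewrite subrr cabs0 mulr_ge0 ?seminorm_ge0// ltW.
Qed.

Definition embed a : completion := Completion (riesz_completion a).

Lemma embedE a b : X a -> X b -> embed a b = s a b.
Proof. exact: rieszE. Qed.

Lemma embedB a b : X a -> X b -> embed (a - b) = embed a - embed b.
Proof.
move=> Xa Xb; apply: completion_eq => c Xc.
by rewrite completionB !embedE// ?ph_formBl//; exact: ph_domB.
Qed.

Definition cpl_norm f : R := best_bound (fun b => cabs (f b)) seminorm.

Lemma cpl_bounded f : exists C, bound (fun b => cabs (f b)) seminorm C.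
Proof.
have [f0 fa] := completionP f; have [a Xa aP] := fa 1 ltr01.
exists (seminorm a + 1); split=> [|b]; first by rewrite addr_ge0 ?seminorm_ge0.
have [Xb|Xb] := pselect (X b); last first.
  by rewrite f0// cabs0 mulr_ge0 ?addr_ge0 ?seminorm_ge0.
have := cabsD (f b - s a b) (s a b); rewrite subrK.
have := aP b Xb; have := ph_cauchy_schwarz Xa Xb; lra.
Qed.

Lemma cpl_norm_ge0 f : 0 <= cpl_norm f.
Proof. exact/best_bound_ge0/cpl_bounded. Qed.

Lemma cpl_normP f b : cabs (f b) <= cpl_norm f * seminorm b.
Proof. exact: (best_boundP seminorm_ge0 (cpl_bounded f)). Qed.

Lemma cpl_norm_le f C : 0 <= C -> (forall b, X b -> cabs (f b) <= C * seminorm b) ->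
  cpl_norm f <= C.
Proof.
move=> C0 fC; apply: best_bound_le => // b.
have [Xb|Xb] := pselect (X b); first exact: fC.
by rewrite (completionP f).1// cabs0 mulr_ge0 ?seminorm_ge0.
Qed.

Lemma cpl_norm_embed a : X a -> cpl_norm (embed a) = seminorm a.
Proof.
move=> Xa; apply/eqP; rewrite eq_le; apply/andP; split.
  apply: cpl_norm_le => [|b Xb]; first exact: seminorm_ge0.
  by rewrite embedE// ph_cauchy_schwarz.
have [->|n0] := eqVneq (seminorm a) 0; first exact: cpl_norm_ge0.
have np : 0 < seminorm a by rewrite lt_neqAle eq_sym n0 seminorm_ge0.
have := cpl_normP (embed a) a; rewrite embedE// seminorm_sqr// cabsR.
by rewrite ger0_norm ?sqr_ge0// expr2 ler_pM2r.
Qed.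

Lemma cpl_normD f g : cpl_norm (f + g) <= cpl_norm f + cpl_norm g.
Proof.
apply: cpl_norm_le => [|b Xb]; first by rewrite addr_ge0 ?cpl_norm_ge0.
by rewrite completionD (le_trans (cabsD _ _))// mulrDl lerD ?cpl_normP.
Qed.

Lemma cpl_normZ_le k f : cpl_norm (k *: f) <= cabs k * cpl_norm f.
Proof.
apply: cpl_norm_le => [|b Xb]; first by rewrite mulr_ge0 ?cpl_norm_ge0 ?cabs_ge0.
by rewrite completionZ cabsM -mulrA ler_wpM2l ?cabs_ge0 ?cpl_normP.
Qed.

Lemma cpl_normZ k f : cpl_norm (k *: f) = cabs k * cpl_norm f.
Proof.
apply/eqP; rewrite eq_le cpl_normZ_le /=.
have [->|k0] := eqVneq k 0; first by rewrite cabs0 mul0r cpl_norm_ge0.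
rewrite -{1}[f](scale1r) -(mulVf k0) -scalerA.
rewrite (le_trans (ler_wpM2l _ (cpl_normZ_le _ _))) ?cabs_ge0//.
by rewrite mulrA -cabsM mulfV// cabs1 mul1r.
Qed.

Lemma cpl_normN f : cpl_norm (- f) = cpl_norm f.
Proof. by rewrite -scaleN1r cpl_normZ cabsN cabs1 mul1r. Qed.

Lemma cpl_normB f g : cpl_norm (f - g) <= cpl_norm f + cpl_norm g.
Proof. by rewrite (le_trans (cpl_normD _ _))// cpl_normN. Qed.

Lemma cpl_norm_eq0 f : cpl_norm f = 0 -> f = 0.
Proof.
move=> f0; apply: completion_eq => b Xb; apply/cabs_eq0/eqP.
by rewrite eq_le cabs_ge0 andbT (le_trans (cpl_normP f b))// f0 mul0r.
Qed.

Lemma cpl_dense f e : 0 < e -> exists2 a, X a & cpl_norm (f - embed a) <= e.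
Proof.
move=> e0; have [a Xa aP] := (completionP f).2 e e0; exists a => //.
apply: cpl_norm_le => [|b Xb]; first exact: ltW.
by rewrite completionB embedE ?aP.
Qed.

Lemma cpl_complete (u : nat -> completion) :
  (forall e, 0 < e -> exists N, forall m n, (N <= m)%N -> (N <= n)%N ->
     cpl_norm (u m - u n) < e) ->
  exists l, forall e, 0 < e -> exists N, forall n, (N <= n)%N -> cpl_norm (u n - l) < e.
Proof.
move=> cu; have /choice[l lu] : forall b, exists l, forall e, 0 < e ->
    exists N, forall n, (N <= n)%N -> cabs (u n b - l) < e.
  move=> b; apply: complex_cauchy => e e0.
  have b1 : 0 < seminorm b + 1 by rewrite ltr_wpDl ?seminorm_ge0.
  have [N Nu] := cu _ (divr_gt0 e0 b1); exists N => m n Nm Nn.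
  have := cpl_normP (u m - u n) b; rewrite completionB.
  have := Nu _ _ Nm Nn; rewrite ltr_pdivlMr//.
  by have := seminorm_ge0 b; have := cpl_norm_ge0 (u m - u n); nra.
have lim e : 0 < e -> exists N, forall n b, (N <= n)%N -> cabs (u n b - l b) <= e * seminorm b.
  move=> e0; have [N Nu] := cu _ e0; exists N => n b Nn.
  apply/ler_addgt0Pr => d /(lu b)[M Ml].
  have := cabsD (u n b - u (maxn N M) b) (u (maxn N M) b - l b); rewrite addrA subrK.
  have := Ml _ (leq_maxr N M).
  have := cpl_normP (u n - u (maxn N M)) b; rewrite completionB.
  have := Nu _ _ Nn (leq_maxl N M).
  by have := seminorm_ge0 b; nra.
have lK : l \in completion_pred.
  apply/asboolP; split=> [b Xb|e e0].
    apply/cabs_eq0/eqP; rewrite eq_le cabs_ge0 andbT; apply/ler_addgt0Pr => d /(lu b)[M].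
    move=> /(_ M (leqnn _)); rewrite (completionP _).1// sub0r cabsN add0r.
    exact: ltW.
  have [N Nl] := lim _ (divr_gt0 e0 (ltr0n _ 2)).
  have [a Xa aP] := (completionP (u N)).2 _ (divr_gt0 e0 (ltr0n _ 2)).
  exists a => // b Xb; have := aP b Xb; have := Nl N b (leqnn _).
  have := cabsD (l b - u N b) (u N b - s a b); rewrite addrA subrK.
  by rewrite (cabs_distC (u N b) (l b)); lra.
exists (Completion lK) => e e0; have [N Nl] := lim _ (divr_gt0 e0 (ltr0n _ 2)).
exists N => n Nn; apply: (@le_lt_trans _ _ (e / 2)); last by lra.
apply: cpl_norm_le => [|b Xb]; first by rewrite divr_ge0// ltW.
exact: Nl.
Qed.

Definition completion_norm :=
  CompleteNorm cpl_normD cpl_normZ cpl_norm_eq0 cpl_complete.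

Definition hilbert_completion : completeNormedModType R[i] := banach completion_norm.

End PreHilbert.

(** ** The inner product of the completion *)

Section InnerProduct.
Context (R : realType) (E : preHilbert R).
Local Notation X := (@ph_dom R E).
Local Notation s := (@ph_form R E).
Implicit Types (x y z a b : E) (k : R[i]) (f g h : completion E).

Lemma completion_antilinear f b c k : X b -> X c -> f (k *: b + c) = k^* * f b + f c.
Proof.
move=> Xb Xc; apply/eqP; rewrite -subr_eq0; apply/eqP/cabs_eq0/eqP.
rewrite eq_le cabs_ge0 andbT; have Xkbc := ph_domP k Xb Xc.
apply/ler_addgt0Pr => e e0; rewrite add0r.
pose C := seminorm (k *: b + c) + cabs k * seminorm b + seminorm c + 1.
have C0 : 0 < C.
  by rewrite /C ltr_wpDl// !addr_ge0 ?mulr_ge0 ?seminorm_ge0 ?cabs_ge0.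
have [a Xa aP] := (completionP f).2 _ (divr_gt0 e0 C0).
have -> : f (k *: b + c) - (k^* * f b + f c) = (f (k *: b + c) - s a (k *: b + c))
   - (k^* * (f b - s a b) + (f c - s a c)).
  by rewrite ph_formPr//; ring.
rewrite (le_trans (cabsD _ _))// cabsN.
have := cabsD (k^* * (f b - s a b)) (f c - s a c); rewrite cabsM cabsJ.
have := aP _ Xb; have := aP _ Xc; have := aP _ Xkbc.
have eC : e = e / C * C by rewrite mulfVK// gt_eqF.
have := ler_wpM2l (cabs_ge0 k) (aP _ Xb).
have : 0 < e / C by rewrite divr_gt0.
rewrite [in X in _ -> _ <= X]eC /C; nra.
Qed.

Lemma completion_sub f b c : X b -> X c -> f (b - c) = f b - f c.
Proof.
move=> Xb Xc; rewrite addrC -scaleN1r completion_antilinear// rmorphN1 mulN1r.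
by rewrite addrC.
Qed.

Lemma exists_cpl_dot f g : exists z : R[i], forall b, X b ->
  cabs (z - f b) <= cpl_norm f * cpl_norm (g - embed b).
Proof.
have inv0 n : 0 < n.+1%:R^-1 :> R by rewrite invr_gt0.
have /choice[u uP] : forall n, exists b, X b /\ cpl_norm (g - embed b) <= n.+1%:R^-1.
  by move=> n; have [b] := cpl_dense g (inv0 n); exists b.
have small (e : R) : 0 < e -> exists N, forall n, (N <= n)%N ->
    cpl_norm (g - embed (u n)) < e.
  move=> e0; have [k] := ltr_add_invr (e0 : 0 < e); rewrite add0r => ke.
  exists k => n kn; apply: le_lt_trans (uP n).2 _.
  by rewrite (le_lt_trans _ ke)// lef_pV2 ?posrE// ler_nat.
have f1 : 0 < cpl_norm f + 1 by rewrite ltr_wpDl ?cpl_norm_ge0.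
have fdist b c : X b -> X c -> cabs (f b - f c) <=
    cpl_norm f * (cpl_norm (g - embed b) + cpl_norm (g - embed c)).
  move=> Xb Xc; rewrite -completion_sub// (le_trans (cpl_normP _ _))//.
  rewrite ler_wpM2l ?cpl_norm_ge0// -cpl_norm_embed; last exact: ph_domB.
  have -> : embed (b - c) = (g - embed c) - (g - embed b).
    by rewrite embedB// opprB [RHS]addrC addrA subrK.
  by rewrite (le_trans (cpl_normB _ _))// addrC.
have [e e0|z zP] := @complex_cauchy R (fun n => f (u n)).
  have [N Nu] := small _ (divr_gt0 (divr_gt0 e0 (ltr0n _ 2)) f1).
  exists N => m n /Nu hm /Nu hn; apply: le_lt_trans (fdist _ _ (uP m).1 (uP n).1) _.
  move: hm hn; rewrite !ltr_pdivlMr//.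
  have := cpl_norm_ge0 (g - embed (u m)); have := cpl_norm_ge0 (g - embed (u n)).
  have := cpl_norm_ge0 f; nra.
exists z => b Xb; apply/ler_addgt0Pr => e e0.
have [N1 h1] := zP _ (divr_gt0 e0 (ltr0n _ 2)).
have [N2 h2] := small _ (divr_gt0 (divr_gt0 e0 (ltr0n _ 2)) f1).
have := h1 _ (leq_maxl N1 N2); have := h2 _ (leq_maxr N1 N2).
set n := maxn N1 N2; rewrite ltr_pdivlMr// cabs_distC.
have := cabsD (z - f (u n)) (f (u n) - f b); rewrite addrA subrK.
have := fdist _ _ (uP n).1 Xb.
have := cpl_norm_ge0 (g - embed (u n)); have := cpl_norm_ge0 f; nra.
Qed.

(** The value at [g] of the functional [f], by continuity. *)
Definition cpl_dot f g : R[i] := sval (cid (exists_cpl_dot f g)).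

Lemma cpl_dotP f g b : X b ->
  cabs (cpl_dot f g - f b) <= cpl_norm f * cpl_norm (g - embed b).
Proof. exact: (svalP (cid (exists_cpl_dot f g))). Qed.

Lemma cpl_dot_unique f g (z : R[i]) C :
  (forall b, X b -> cabs (z - f b) <= C * cpl_norm (g - embed b)) -> z = cpl_dot f g.
Proof.
move=> zP; apply/eqP; rewrite -subr_eq0; apply/eqP/cabs_eq0/eqP.
rewrite eq_le cabs_ge0 andbT; apply/ler_addgt0Pr => e e0; rewrite add0r.
have D0 : 0 < `|C| + cpl_norm f + 1 by rewrite ltr_wpDl// addr_ge0 ?cpl_norm_ge0.
have [b Xb bP] := cpl_dense g (divr_gt0 e0 D0).
have := zP b Xb; have := cpl_dotP f g Xb.
have := cabsD (z - f b) (f b - cpl_dot f g); rewrite addrA subrK (cabs_distC (f b)).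
move: bP; rewrite ler_pdivlMr//.
have := ler_norm C; have := cpl_norm_ge0 (g - embed b); have := cpl_norm_ge0 f; nra.
Qed.

Lemma cpl_dotPl k f f' g : cpl_dot (k *: f + f') g = k * cpl_dot f g + cpl_dot f' g.
Proof.
apply/esym/(@cpl_dot_unique _ _ _ (cabs k * cpl_norm f + cpl_norm f')) => b Xb.
rewrite completionD completionZ.
have -> : k * cpl_dot f g + cpl_dot f' g - (k * f b + f' b) =
    k * (cpl_dot f g - f b) + (cpl_dot f' g - f' b) by ring.
rewrite (le_trans (cabsD _ _))// cabsM mulrDl lerD ?cpl_dotP// -mulrA.
by rewrite ler_wpM2l ?cabs_ge0 ?cpl_dotP.
Qed.

Lemma cpl_dot_embedr f b : X b -> cpl_dot f (embed b) = f b.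
Proof.
move=> Xb; apply/esym/(@cpl_dot_unique _ _ _ (cpl_norm f)) => c Xc.
rewrite -completion_sub// (le_trans (cpl_normP _ _))// -cpl_norm_embed ?embedB//.
exact: ph_domB.
Qed.

Lemma cpl_dot_embedl f b : X b -> cpl_dot (embed b) f = (f b)^*.
Proof.
move=> Xb; apply/esym/(@cpl_dot_unique _ _ _ (seminorm b)) => c Xc.
rewrite embedE// (ph_formC Xc Xb) -rmorphB cabsJ -(embedE Xc Xb) -completionB.
by rewrite mulrC cpl_normP.
Qed.

Lemma cpl_dot_le f g : cabs (cpl_dot f g) <= cpl_norm f * cpl_norm g.
Proof.
apply/ler_addgt0Pr => e e0.
have D0 : 0 < 2 * (cpl_norm f + 1) by rewrite mulr_gt0// ltr_wpDl ?cpl_norm_ge0.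
have [b Xb bP] := cpl_dense g (divr_gt0 e0 D0).
have := cpl_dotP f g Xb; have := cpl_normP f b; rewrite -(cpl_norm_embed Xb).
have := cabsD (cpl_dot f g - f b) (f b); rewrite subrK.
have : cpl_norm (embed b) <= cpl_norm g + cpl_norm (g - embed b).
  by rewrite -[in leLHS](subKr g (embed b)) cpl_normB.
move: bP; rewrite ler_pdivlMr//.
have := cpl_norm_ge0 (g - embed b); have := cpl_norm_ge0 f; nra.
Qed.

Lemma cpl_dotBl f f' g : cpl_dot (f - f') g = cpl_dot f g - cpl_dot f' g.
Proof. by rewrite addrC -scaleN1r cpl_dotPl mulN1r addrC. Qed.

Lemma cpl_dotC f g : cpl_dot f g = (cpl_dot g f)^*.
Proof.
apply/esym/(@cpl_dot_unique _ _ _ (cpl_norm f)) => b Xb.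
rewrite -[f b]conjCK -cpl_dot_embedl// -rmorphB cabsJ -cpl_dotBl mulrC.
exact: cpl_dot_le.
Qed.

Lemma cpl_dotxx f : cpl_dot f f = (cpl_norm f ^+ 2)%:C%C.
Proof.
apply/eqP; rewrite -subr_eq0; apply/eqP/cabs_eq0/eqP.
rewrite eq_le cabs_ge0 andbT; apply/ler_addgt0Pr => e e0; rewrite add0r.
set n := cpl_norm f; have n0 : 0 <= n := cpl_norm_ge0 f.
have D0 : 0 < e + 4 * n + 2 by lra.
have d0 := divr_gt0 e0 D0.
have [b Xb bP] := cpl_dense f d0.
have d1 : e / (e + 4 * n + 2) <= 1 by rewrite ler_pdivrMr//; lra.
have de : e / (e + 4 * n + 2) * (4 * n + 2) <= e.
  by rewrite mulrAC ler_pdivrMr//; nra.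
move: (e / _) d0 d1 de bP => d d0 d1 de bP.
have tri1 : seminorm b <= n + d.
  rewrite -cpl_norm_embed// -[embed b](subKr f) (le_trans (cpl_normB _ _))//.
  by rewrite lerD2l.
have tri2 : n <= seminorm b + d.
  rewrite -(cpl_norm_embed Xb) /n -[in X in X <= _](subrK (embed b) f) addrC.
  by rewrite (le_trans (cpl_normD _ _))// lerD2l.
have b0 := seminorm_ge0 b.
have -> : cpl_dot f f - (n ^+ 2)%:C%C = cpl_dot (f - embed b) f
    + (cpl_dot (f - embed b) (embed b))^* + (seminorm b ^+ 2 - n ^+ 2)%:C%C.
  rewrite -cpl_dotC [cpl_dot (embed b) _]cpl_dotC !cpl_dotBl !cpl_dot_embedr//.
  rewrite cpl_dot_embedl// embedE// seminorm_sqr// !rmorphB /= conj_real.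
  by ring.
rewrite (le_trans (cabsD _ _))// cabsR.
have h1 := cabsD (cpl_dot (f - embed b) f) (cpl_dot (f - embed b) (embed b))^*.
have h2 := cpl_dot_le (f - embed b) f.
have h3 := cpl_dot_le (f - embed b) (embed b); rewrite cpl_norm_embed// in h3.
rewrite cabsJ in h1.
have h4 : `|seminorm b ^+ 2 - n ^+ 2| <= d * (2 * n + d).
  rewrite subr_sqr normrM ler_pM//.
    by rewrite ler_distl lerBlDr tri2 tri1.
  rewrite ger0_norm ?addr_ge0// [leRHS](_ : _ = n + d + n); last by ring.
  by rewrite lerD2r.
have h5 := cpl_norm_ge0 (f - embed b).
have h6 : cpl_norm (f - embed b) * n <= d * n by rewrite ler_wpM2r.
have h7 : cpl_norm (f - embed b) * seminorm b <= d * (n + 1).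
  by rewrite ler_pM// (le_trans tri1)// lerD2l.
have h8 : d * (2 * n + d) <= d * (2 * n + 1) by rewrite ler_wpM2l ?lerD2l// ltW.
by rewrite -/n in h2; clear - h1 h2 h3 h4 h6 h7 h8 de; lra.
Qed.

Let dot : hilbert_completion E -> hilbert_completion E -> R[i] := cpl_dot.

Let dot_bilinear : bilinear_for (GRing.Scale.Law.clone _ _ *%R _)
  (GRing.Scale.Law.clone _ _ (Num.conj \; *%R) _) dot.
Proof.
split=> [g|f] k x y; first exact: cpl_dotPl.
by rewrite /dot cpl_dotC cpl_dotPl rmorphD rmorphM /= -!cpl_dotC.
Qed.

HB.instance Definition _ := bilinear_isBilinear.Build R[i]
  (hilbert_completion E) (hilbert_completion E) R[i] _ _ dot dot_bilinear.

Let dot_hermitian (f g : (hilbert_completion E)) :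
  dot f g = (-1) ^+ false * Num.conj (dot g f).
Proof. by rewrite mul1r; exact: cpl_dotC. Qed.

HB.instance Definition _ := isHermitianSesquilinear.Build R[i]
  (hilbert_completion E) false Num.conj dot dot_hermitian.

Let dot_positive (f : (hilbert_completion E)) : f != 0 -> 0 < dot f f.
Proof.
move=> f0; rewrite /dot cpl_dotxx ltcR exprn_gt0// lt_neqAle cpl_norm_ge0 andbT.
by rewrite eq_sym; apply: contra f0 => /eqP/cpl_norm_eq0 ->.
Qed.

HB.instance Definition _ := isDotProduct.Build R[i] (hilbert_completion E) dot dot_positive.

Let dotE (f : (hilbert_completion E)) : `|f| ^+ 2 = dot f f.
Proof. by rewrite /dot cpl_dotxx rmorphXn. Qed.

Definition completion_hilbert : hilbertSpace R := @HilbertSpace R (hilbert_completion E) dot dotE.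

Lemma completion_hdotE (f g : completion_hilbert) : hdot completion_hilbert f g = cpl_dot f g.
Proof. by []. Qed.

Lemma completion_rnormE (f : completion_hilbert) : rnorm f = cpl_norm f.
Proof. by []. Qed.

End InnerProduct.

(** * Geometry of Hilbert spaces *)

Section HilbertSpace.
Context (R : realType) (H : hilbertSpace R).
Implicit Types (x y z : H) (k : R[i]) (M : set H).
Local Notation "'[ x , y ]" := (hdot H x y).

Lemma hdotC x y : '[x, y] = '[y, x]^*.
Proof. by rewrite (hermC (hdot H)) mul1r. Qed.

Lemma hdotPl k x y z : '[k *: x + y, z] = k * '[x, z] + '[y, z].
Proof. by rewrite linearPl. Qed.

Lemma hdotBl x y z : '[x - y, z] = '[x, z] - '[y, z].
Proof. by rewrite addrC -scaleN1r hdotPl mulN1r addrC. Qed.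

Lemma hdotBr x y z : '[z, x - y] = '[z, x] - '[z, y].
Proof. by rewrite hdotC hdotBl rmorphB /= -!hdotC. Qed.

Lemma hdotDl x y z : '[x + y, z] = '[x, z] + '[y, z].
Proof. by rewrite -[x in LHS]scale1r hdotPl mul1r. Qed.

Lemma hdotDr x y z : '[z, x + y] = '[z, x] + '[z, y].
Proof. by rewrite hdotC hdotDl rmorphD /= -!hdotC. Qed.

Lemma hdot0l x : '[0, x] = 0.
Proof. by rewrite -(subrr (0 : H)) hdotBl subrr. Qed.

Lemma hdot0r x : '[x, 0] = 0.
Proof. by rewrite hdotC hdot0l conjC0. Qed.

Lemma hdotZl k x y : '[k *: x, y] = k * '[x, y].
Proof. by rewrite -[_ *: _]addr0 hdotPl hdot0l addr0. Qed.

Lemma hdotZr k x y : '[y, k *: x] = k^* * '[y, x].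
Proof. by rewrite hdotC hdotZl rmorphM /= -hdotC. Qed.

Lemma hdotxx x : '[x, x] = (rnorm x ^+ 2)%:C%C.
Proof. by rewrite -hdotE rnormE rmorphXn. Qed.

Lemma Re_hdotC x y : complex.Re '[x, y] = complex.Re '[y, x].
Proof. by rewrite hdotC Re_conj. Qed.

Lemma Re_hdotxx x : complex.Re '[x, x] = rnorm x ^+ 2.
Proof. by rewrite hdotxx. Qed.

Lemma hdot_eq0 x : '[x, x] = 0 -> x = 0.
Proof.
rewrite hdotxx => /(congr1 (@complex.Re R)) /= /eqP.
by rewrite sqrf_eq0 => /eqP; exact: rnorm_eq0.
Qed.

Definition hilbert_preHilbert : preHilbert R.
Proof.
refine (@PreHilbert R H setT (fun x y => '[x, y]) I (fun _ _ _ _ _ => I) _ _ _).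
- by move=> *; exact: hdotPl.
- by move=> *; exact: hdotC.
- by move=> x _; rewrite hdotxx ler0c sqr_ge0.
Defined.

Lemma hdot_le x y : cabs '[x, y] <= rnorm x * rnorm y.
Proof.
have sE (z : H) : @seminorm R hilbert_preHilbert z = rnorm z.
  by rewrite /seminorm asboolT//= hdotxx /= sqrtr_sqr ger0_norm ?rnorm_ge0.
by have := @ph_cauchy_schwarz R hilbert_preHilbert x y I I; rewrite !sE.
Qed.

Lemma rnormD_sqr x y :
  rnorm (x + y) ^+ 2 = rnorm x ^+ 2 + 2 * complex.Re '[x, y] + rnorm y ^+ 2.
Proof.
rewrite -!Re_hdotxx hdotDl !hdotDr !ReD (Re_hdotC y x); lra.
Qed.

Lemma rnormB_sqr x y :
  rnorm (x - y) ^+ 2 = rnorm x ^+ 2 - 2 * complex.Re '[x, y] + rnorm y ^+ 2.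
Proof.
rewrite rnormD_sqr rnormN -scaleN1r hdotZr rmorphN1 mulN1r ReN; lra.
Qed.

Lemma parallelogram x y :
  rnorm (x + y) ^+ 2 + rnorm (x - y) ^+ 2 = 2 * rnorm x ^+ 2 + 2 * rnorm y ^+ 2.
Proof. rewrite rnormD_sqr rnormB_sqr; lra. Qed.

Lemma subspaceZ M k x : closed_subspace M -> M x -> M (k *: x).
Proof. by move=> [_ M0 MP] Mx; rewrite -[_ *: _]addr0; apply: MP. Qed.

Lemma subspaceD M x y : closed_subspace M -> M x -> M y -> M (x + y).
Proof. by move=> [_ M0 MP] Mx My; rewrite -[x]scale1r; apply: MP. Qed.

(** A minimizing sequence for the distance to [M] is Cauchy by the
parallelogram identity. *)
Lemma orthogonal_projection M x : closed_subspace M ->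
  exists2 m, M m & forall y, M y -> '[x - m, y] = 0.
Proof.
move=> subM; have [cM M0 MP] := subM.
pose D := [set rnorm (x - y) ^+ 2 | y in M]; pose d := inf D.
have D0 : D !=set0 by exists (rnorm (x - 0) ^+ 2), 0.
have Dlb : lbound D 0 by move=> _ [y _ <-]; exact: sqr_ge0.
have dle y : M y -> d <= rnorm (x - y) ^+ 2.
  by move=> My; apply: ge_inf; [exists 0|exists y].
have inv0 n : 0 < n.+1%:R^-1 :> R by rewrite invr_gt0.
have /choice[u uP] : forall n, exists y, M y /\ rnorm (x - y) ^+ 2 < d + n.+1%:R^-1.
  move=> n; have [|_ [y My <-] yd] := inf_adherent (E := D) (inv0 n).
    by split=> //; exists 0.
  by exists y.
have small (e : R) : 0 < e -> exists N, forall n, (N <= n)%N ->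
    rnorm (x - u n) ^+ 2 < d + e.
  move=> e0; have [k] := ltr_add_invr (e0 : 0 < e); rewrite add0r => ke.
  exists k => n kn; apply: lt_le_trans (uP n).2 _.
  by rewrite lerD2l (le_trans _ (ltW ke))// lef_pV2 ?posrE// ler_nat.
have [|m um] := @cauchy_sequence_tends _ _ u.
  move=> e e0; have e20 : 0 < e ^+ 2 / 4 by rewrite divr_gt0// exprn_gt0.
  have [N Nu] := small _ e20; exists N => p q /Nu hp /Nu hq.
  rewrite -(@ltr_pXn2r _ 2) ?nnegrE ?rnorm_ge0 ?ltW//.
  have := parallelogram (x - u q) (x - u p).
  have -> : x - u q - (x - u p) = u p - u q by rewrite opprB addrC addrA subrK.
  have -> : x - u q + (x - u p) = 2%:C%C *: (x - (2^-1)%:C%C *: (u p + u q)).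
    rewrite scalerBr scalerA -rmorphM mulfV// scale1r.
    by rewrite -[2]/(1 + 1) rmorphD scalerDl !scale1r addrACA -opprD [u q + _]addrC.
  rewrite rnormZr exprMn ger0_norm//.
  have : M ((2^-1)%:C%C *: (u p + u q)).
    exact: subspaceZ subM (subspaceD subM (uP p).1 (uP q).1).
  move=> /dle; lra.
have Mm : M m by apply: closed_tends cM _ um => n; exact: (uP n).1.
exists m => // y My; set c := '[x - m, y].
have xm : rnorm (x - m) ^+ 2 <= d.
  have B0 : 0 < 2 * rnorm (x - m) + 1 by rewrite ltr_wpDl ?mulr_ge0 ?rnorm_ge0.
  apply/ler_addgt0Pr => e e0; have e2 := divr_gt0 e0 (ltr0n _ 2).
  have [N1 h1] := small _ e2.
  have [N2 h2] := um _ (divr_gt0 e2 B0).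
  have := h1 _ (leq_maxl N1 N2); have := h2 _ (leq_maxr N1 N2).
  set n := maxn N1 N2; rewrite ltr_pdivlMr//.
  have : rnorm (x - m) <= rnorm (x - u n) + rnorm (u n - m) := rnorm_dist _ _ _.
  have := rnorm_ge0 (x - u n); have := rnorm_ge0 (x - m).
  have := rnorm_ge0 (u n - m).
  have : 0 <= d by exact: lb_le_inf.
  move: (rnorm (x - u n)) (rnorm (x - m)) (rnorm (u n - m)) => a b t.
  clear - e0 => d0 t0 b0 a0 abt te ad.
  have [bt|tb] := leP b t.
    have : b ^+ 2 <= t * b by rewrite expr2 ler_wpM2r.
    lra.
  have : (b - t) ^+ 2 <= a ^+ 2 by rewrite lerXn2r ?nnegrE//; lra.
  have := sqr_ge0 t; lra.
have key (r : R) : 0 <= - (2 * r * cabs c ^+ 2) + r ^+ 2 * cabs c ^+ 2 * rnorm y ^+ 2.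
  have := dle _ (subspaceD subM Mm (subspaceZ (r%:C%C * c) subM My)).
  rewrite opprD addrA rnormB_sqr rnormZ cabsM cabsR hdotZr -/c.
  have -> : (r%:C%C * c)^* * c = (r * cabs c ^+ 2)%:C%C.
    by rewrite rmorphM /= conj_real -mulrA [c^* * _]mulrC -cabs_sqr -rmorphM.
  rewrite /= !exprMn real_normK ?num_real//; lra.
have [y0|y0] := eqVneq (rnorm y) 0.
  by rewrite /c (rnorm_eq0 y0) hdot0r.
have yp : 0 < rnorm y by rewrite lt_neqAle eq_sym y0 rnorm_ge0.
have := key ((rnorm y ^+ 2)^-1).
have -> : - (2 * (rnorm y ^+ 2)^-1 * cabs c ^+ 2) +
  (rnorm y ^+ 2)^-1 ^+ 2 * cabs c ^+ 2 * rnorm y ^+ 2 =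
  - (cabs c ^+ 2 / rnorm y ^+ 2) by field.
rewrite oppr_ge0 pmulr_lle0 ?invr_gt0 ?exprn_gt0// => c0.
apply/cabs_eq0/eqP; rewrite -sqrf_eq0; apply/eqP/le_anti.
by rewrite c0 sqr_ge0.
Qed.

End HilbertSpace.

Lemma bounded_linear_continuous (R : realType) (V W : normedModType R[i])
    (f : V -> W) (C : R) : linear f -> (forall x, rnorm (f x) <= C * rnorm x) ->
  continuous f.
Proof.
move=> fl fC x B /nbhs_ballP[e /= /cgt0P[e0 eE] eB].
have C1 : 0 < `|C| + 1 by rewrite ltr_wpDl.
apply/nbhs_ballP; exists (complex.Re e / (`|C| + 1))%:C%C => /=.
  by rewrite ltcR divr_gt0.
move=> y /ball_rnorm xy; apply: eB; rewrite eE; apply/ball_rnorm.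
have -> : f x - f y = f (x - y).
  have := fl (-1) y x; rewrite !scaleN1r ![- _ + _]addrC.
  by move=> ->.
apply: le_lt_trans (fC _) _; move: xy; rewrite ltr_pdivlMr//.
by have := ler_norm C; have := rnorm_ge0 (x - y); nra.
Qed.

(** * Operators on a completion *)

Section Operators.
Context (R : realType) (E : preHilbert R).
Local Notation X := (@ph_dom R E).
Local Notation s := (@ph_form R E).
Implicit Types (S : E -> E) (f g : completion E).

Definition adjointable S S' :=
  [/\ forall x, X x -> X (S x), forall x, X x -> X (S' x),
      forall x y, X x -> X y -> s (S x) y = s x (S' y) &
      exists2 C, 0 <= C & forall x, X x -> seminorm (S' x) <= C * seminorm x].

(** On the functionals representing the vectors of the completion, an operator
[S] acts by composition with its adjoint [S']. *)
Definition extend S' f : completion E :=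
  insubd 0 (fun b => if `[< X b >] then f (S' b) else 0).

Section Extend.
Variables (S S' : E -> E).
Hypothesis SS' : adjointable S S'.

Lemma extendE f b : X b -> extend S' f b = f (S' b).
Proof.
move=> Xb; have [XS XS' adj [C C0 S'C]] := SS'.
rewrite /extend /insubd insubT /= ?asboolT//.
apply/asboolP; split=> [c Xc|e e0]; first by rewrite asboolF.
have C1 : 0 < C + 1 by rewrite ltr_wpDl.
have [a Xa aP] := (completionP f).2 _ (divr_gt0 e0 C1).
exists (S a); first exact: XS.
move=> c Xc; rewrite asboolT// adj// (le_trans (aP _ (XS' _ Xc)))//.
rewrite mulrAC ler_pdivrMr// -mulrA ler_pM2l// mulrC.
by rewrite (le_trans (S'C c Xc))// ler_wpM2r ?seminorm_ge0// lerDl.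
Qed.

Lemma extend_embed a : X a -> extend S' (embed a) = embed (S a).
Proof.
move=> Xa; have [XS XS' adj _] := SS'; apply: completion_eq => b Xb.
by rewrite extendE// !embedE//; [rewrite adj|exact: XS|exact: XS'].
Qed.

Lemma extend_linear k f g : extend S' (k *: f + g) = k *: extend S' f + extend S' g.
Proof.
apply: completion_eq => b Xb.
by rewrite completionD completionZ !extendE.
Qed.

Lemma extend_bounded : exists C, forall f, cpl_norm (extend S' f) <= C * cpl_norm f.
Proof.
have [XS XS' adj [C C0 S'C]] := SS'; exists C => f.
apply: cpl_norm_le => [|b Xb]; first by rewrite mulr_ge0 ?cpl_norm_ge0.
rewrite extendE// (le_trans (cpl_normP _ _))// [C * _]mulrC -mulrA.
by rewrite ler_wpM2l ?cpl_norm_ge0// S'C.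
Qed.

Lemma extend_dot_embed f b : X b ->
  cpl_dot (extend S' f) (embed b) = cpl_dot f (embed (S' b)).
Proof.
by move=> Xb; have [_ XS' _ _] := SS'; rewrite !cpl_dot_embedr ?extendE//; exact: XS'.
Qed.

End Extend.

Lemma extend_adjoint S S' f g : adjointable S S' -> adjointable S' S ->
  cpl_dot (extend S' f) g = cpl_dot f (extend S g).
Proof.
move=> SS' S'S; have [C CP] := extend_bounded S'S.
apply/esym/(@cpl_dot_unique _ _ _ _ _ (cpl_norm f * `|C|)) => b Xb.
rewrite -cpl_dot_embedr// (extend_dot_embed SS')// -(extend_embed S'S)//.
rewrite [cpl_dot f (extend S g)]cpl_dotC [cpl_dot f (extend S (embed b))]cpl_dotC.
rewrite -rmorphB cabsJ -cpl_dotBl (le_trans (cpl_dot_le _ _))// mulrC -mulrA.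
rewrite ler_wpM2l ?cpl_norm_ge0//.
have -> : extend S g - extend S (embed b) = extend S (g - embed b).
  by rewrite -scaleN1r addrC -(extend_linear S'S) scaleN1r addrC.
rewrite (le_trans (CP _))// ler_wpM2r ?cpl_norm_ge0//; exact: ler_norm.
Qed.

Lemma completion_closed_dense (M : set (completion_hilbert E)) :
  closed_subspace M -> (forall a, X a -> M (embed a)) -> M = setT.
Proof.
move=> [/closed_rnormP cM _ _] Ma; apply/seteqP; split=> // f _.
apply: cM => e e0; have [a Xa aP] := cpl_dense f (divr_gt0 e0 (ltr0n _ 2)).
exists (embed a); first exact: Ma.
rewrite completion_rnormE; apply: le_lt_trans aP _; lra.
Qed.

Lemma completion_orthogonal_dense f :
  (forall a, X a -> complex.Re (cpl_dot (embed a) f) = 0) -> f = 0.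
Proof.
move=> f0; apply/cpl_norm_eq0/eqP; rewrite eq_le cpl_norm_ge0 andbT.
apply/ler_addgt0Pr => e e0; rewrite add0r.
have [a Xa aP] := cpl_dense f e0.
have : cpl_norm f ^+ 2 = complex.Re (cpl_dot (f - embed a) f).
  by rewrite cpl_dotBl ReD ReN f0// subr0 cpl_dotxx.
have := cpl_dot_le (f - embed a) f; have := Re_cabs (cpl_dot (f - embed a) f).
have := ler_norm (complex.Re (cpl_dot (f - embed a) f)).
move: (complex.Re _) (cabs _) aP (cpl_norm_ge0 f) (cpl_norm_ge0 (f - embed a)).
move: (cpl_norm f) (cpl_norm _) => n t r c te n0 t0 h1 h2 h3 h4.
have [->|n1] := eqVneq n 0; first exact: ltW.
by have np : 0 < n; [rewrite lt_neqAle eq_sym n1|nra].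
Qed.

End Operators.

(** * Pure positive functionals *)

Section PureFunctionals.
Context (R : realType) (A : cstarAlgType R) (e : A).
Hypotheses (mul1c : forall x, e ** x = x) (mulc1 : forall x, x ** e = x).
Variable T : cstar_subalgebra A.
Hypothesis Te : T e.
Implicit Types (x y h k : A) (f g : A -> R) (r : R).
Local Notation "r :* x" := (r%:C%C *: x) (at level 40).
Local Notation pos := (pos e).

Let TD x y : T x -> T y -> T (x + y). Proof. exact: csubD. Qed.
Let TZ (r : R) x : T x -> T (r :* x). Proof. exact: csubZ. Qed.
Let sae := star_unit mulc1.

(** Functionals are real parts of complex functionals. *)
Definition positive_functional f := [/\ real_linear T f,
  forall x, T x -> f x^# = f x & forall x, T x -> pos x -> 0 <= f x].

(** The functionals below this one are the positive ones of norm at most [2]. *)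
Definition state_bound x : R := inf [set r | 0 <= r /\ pos (r :* e - (x + x^#))].

Let sa_sym x : (x + x^#)^# = x + x^#.
Proof. by rewrite cstarD cstarK addrC. Qed.

Lemma state_bound_ge0 x : 0 <= state_bound x.
Proof.
apply: lb_le_inf => [|r []//]; exists (rnorm (x + x^#)).
by split; [exact: rnorm_ge0|exact: (pos_shift mulc1 (sa_sym x) (lexx _))].
Qed.

Lemma state_bound_le x r : 0 <= r -> pos (r :* e - (x + x^#)) -> state_bound x <= r.
Proof. by move=> r0 px; apply: ge_inf => //; exists 0 => ? []. Qed.

Lemma state_bound_ge x r : (forall t, 0 <= t -> pos (t :* e - (x + x^#)) -> r <= t) ->
  r <= state_bound x.
Proof.
move=> h; apply: lb_le_inf => [|t []]; last exact: h.
by exists (rnorm (x + x^#)); split; [exact: rnorm_ge0|exact: (pos_shift mulc1 (sa_sym x) (lexx _))].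
Qed.

Lemma state_bound_sublinear : sublinear T state_bound.
Proof.
split=> [x y _ _|r x r0 _].
  rewrite -lerBlDr; apply: state_bound_ge => s s0 xs.
  rewrite lerBlDr -lerBlDl; apply: state_bound_ge => t t0 yt.
  rewrite lerBlDl; apply: state_bound_le; first exact: addr_ge0.
  rewrite (_ : _ - _ = s :* e - (x + x^#) + (t :* e - (y + y^#))).
    exact: posD.
  by rewrite rmorphD scalerDl cstarD; ncring.
have [->|rn0] := eqVneq r 0.
  rewrite scale0r mul0r; apply/le_anti; rewrite state_bound_ge0 andbT.
  by apply: state_bound_le; rewrite // cstar0 addr0 subr0 scale0r; exact: pos0.
have rp : 0 < r by rewrite lt_neqAle eq_sym rn0.
apply/le_anti/andP; split.
  rewrite mulrC -ler_pdivrMr//; apply: state_bound_ge => t t0 xt.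
  rewrite ler_pdivrMr//; apply: state_bound_le; first exact: mulr_ge0.
  rewrite cstarZr -scalerDr mulrC rmorphM -scalerA -scalerBr.
  exact: posZ.
apply: state_bound_ge => t t0 xt; rewrite mulrC -ler_pdivlMr//.
apply: state_bound_le; first exact: divr_ge0.
rewrite (_ : _ - _ = r^-1 :* (t :* e - (r :* x + (r :* x)^#))).
  by apply: posZ => //; rewrite invr_ge0.
rewrite cstarZr -scalerDr scalerBr !scalerA -!rmorphM mulVf// scale1r.
by rewrite mulrC.
Qed.

Lemma below_state_bound f : real_linear T f ->
  below T f state_bound <-> positive_functional f /\ f e <= 2.
Proof.
move=> fl; split=> [fb|[[_ fs fp] fe] x Tx].
  have fneg x : T x -> pos (x + x^#) -> 0 <= f x.
    move=> Tx px; rewrite -oppr_le0 -(real_linearN fl)//.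
    apply: le_trans (fb _ (csubN Tx)) _; apply: state_bound_le => //.
    by rewrite scale0r sub0r cstarN -opprD opprK.
  split; last first.
    apply: le_trans (fb _ Te) _; apply: state_bound_le => //.
    rewrite sae -[2]/(1 + 1) rmorphD scalerDl !scale1r subrr.
    exact: pos0.
  split=> // x Tx.
    have Txs := subalg_star Tx.
    have skew z : T z -> z + z^# = 0 -> 0 <= f z.
      by move=> Tz z0; apply: fneg => //; rewrite z0; exact: pos0.
    have fB z w : T z -> T w -> f (z - w) = f z - f w.
      by move=> Tz Tw; rewrite fl.1 ?(real_linearN fl)//; exact: csubN.
    have h1 : 0 <= f (x - x^#).
      by apply: (skew); [exact: csubB|rewrite cstarB cstarK; ncring].
    have h2 : 0 <= f (x^# - x).
      by apply: (skew); [exact: csubB|rewrite cstarB cstarK; ncring].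
    by apply/le_anti; rewrite -subr_ge0 -[X in _ && X]subr_ge0 -!fB// h1 h2.
  move=> px; apply: fneg => //; apply: posD => //.
  by have [-> _] := px.
apply: state_bound_ge => r r0 px.
have : 0 <= f (r :* e - (x + x^#)).
  by apply: fp => //; exact: csubB (csubZ _ Te) (csubD Tx (subalg_star Tx)).
have Txs := subalg_star Tx; have Txx : T (x + x^#) := csubD Tx Txs.
rewrite (fl.1 _ _ (csubZ _ Te) (csubN Txx)) (real_linearN fl Txx) (fl.2 _ _ Te).
rewrite (fl.1 _ _ Tx Txs) fs// => h.
by have : r * f e <= r * 2 by [rewrite ler_wpM2l]; lra.
Qed.

Definition pure_functional f := positive_functional f /\
  forall g, positive_functional g -> (forall x, T x -> pos x -> g x <= f x) ->
  exists t, forall x, T x -> g x = t * f x.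

(** An extreme point of the positive functionals of norm at most [2], among those
that are maximal at [y^# ** y]: if [g <= f] and [t = g e / f e], then [f] is the
midpoint of two such functionals, [f + (g - t f)] and [f - (g - t f)]. *)
Lemma exists_pure_functional y : T y -> y <> 0 ->
  exists2 f, pure_functional f & 0 < f (y^# ** y).
Proof.
move=> Ty y0; set h := y^# ** y.
have Th : T h by apply/subalg_mul => //; exact: subalg_star.
have hsa : h^# = h by rewrite cstarM cstarK.
have ph : pos h by exact: pos_star_mul.
have hh : h + h^# = 2 :* h by rewrite hsa -[2]/(1 + 1) rmorphD scalerDl !scale1r.
have h0 : 0 < state_bound h.
  apply: lt_le_trans (_ : 2 * rnorm h <= _).
    by rewrite mulr_gt0// rnorm_gt0// => /cstar_mul_eq0.
  apply: state_bound_ge => t t0; rewrite hh => pt.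
  have := pos_le mul1c mulc1 t0 (posZ (ler0n R 2) ph) pt.
  by rewrite rnormZr ger0_norm.
have [f [fl fb fh fext]] :=
  extreme_dominated (@csub0 _ _ T) TD TZ state_bound_sublinear Th.
have [[_ fs fp] fe] := (below_state_bound fl).1 fb.
exists f; last by rewrite fh.
have fe0 : 0 < f e.
  have : 0 <= f (rnorm h :* e - h).
    by apply: fp; [apply: csubB => //; exact: csubZ|exact: pos_shift].
  rewrite (fl.1 _ _ (csubZ _ Te) (csubN Th)) (fl.2 _ _ Te) (real_linearN fl Th) fh.
  rewrite subr_ge0 => hh'; have : 0 < rnorm h * f e by exact: lt_le_trans hh'.
  by rewrite pmulr_rgt0// rnorm_gt0// => /cstar_mul_eq0.
split=> // g [gl gs gp] gf.
have pe : pos e by have := pos_star_mul mul1c mulc1 e; rewrite sae mul1c.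
pose t := g e / f e; exists t.
have t0 : 0 <= t by rewrite divr_ge0 ?gp// ltW.
have t1 : t <= 1 by rewrite ler_pdivrMr// mul1r gf.
have te : t * f e = g e by rewrite mulfVK// gt_eqF.
pose f1 x := f x + (g x - t * f x); pose f2 x := f x - (g x - t * f x).
have f1l : real_linear T f1.
  by split=> [x z Tx Tz|r x Tx]; rewrite /f1 ?fl.1 ?gl.1 ?fl.2 ?gl.2//; ring.
have f2l : real_linear T f2.
  by split=> [x z Tx Tz|r x Tx]; rewrite /f2 ?fl.1 ?gl.1 ?fl.2 ?gl.2//; ring.
have f1b : below T f1 state_bound.
  apply/(below_state_bound f1l); split; last by rewrite /f1 te; lra.
  split=> // x Tx; first by rewrite /f1 fs// gs.
  move=> px; have -> : f1 x = (1 - t) * f x + g x by rewrite /f1; ring.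
  by rewrite addr_ge0 ?gp// mulr_ge0 ?subr_ge0 ?fp.
have f2b : below T f2 state_bound.
  apply/(below_state_bound f2l); split; last by rewrite /f2 te; lra.
  split=> // x Tx; first by rewrite /f2 fs// gs.
  move=> px; have -> : f2 x = (f x - g x) + t * f x by rewrite /f2; ring.
  by rewrite addr_ge0 ?subr_ge0 ?gf// mulr_ge0 ?fp.
move=> x Tx; have := fext f1 f2 f1l f2l f1b f2b _ x Tx; rewrite /f1 /f2 => fE.
have : f x + (g x - t * f x) = f x by apply: fE => z Tz; ring.
lra.
Qed.

End PureFunctionals.

(** * Consequences of positivity in an algebra without unit *)

Section NonUnital.
Context (R : realType) (A : cstarAlgType R).
Implicit Types (a b x : A) (S : cstar_subalgebra A) (T : unitization A).

Let e : unitization A := uone A.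

Lemma uone_mul T : e ** T = T.
Proof.
case: T => k a; congr (_, _) => /=; first exact: mul1r.
by rewrite scale1r scaler0 cmul0l !addr0.
Qed.

Lemma mul_uone T : T ** e = T.
Proof.
case: T => k a; congr (_, _) => /=; first exact: mulr1.
by rewrite scale1r scaler0 cmul0r addr0 add0r.
Qed.

Lemma uembM a b : uemb (a ** b) = uemb a ** uemb b :> unitization A.
Proof. by congr (_, _) => /=; rewrite ?mul0r// !scale0r !add0r. Qed.

Lemma uemb_star a : (uemb a)^# = uemb a^# :> unitization A.
Proof. by congr (_, _) => /=; rewrite conjC0. Qed.

Lemma uembD a b : uemb (a + b) = uemb a + uemb b :> unitization A.
Proof. by congr (_, _) => /=; rewrite addr0. Qed.

Lemma uembZ k a : uemb (k *: a) = k *: uemb a :> unitization A.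
Proof. by congr (_, _) => /=; exact/esym/mulr0. Qed.

Lemma uembN a : uemb (- a) = - uemb a :> unitization A.
Proof. by congr (_, _) => /=; rewrite oppr0. Qed.

Lemma rnorm_uemb a : rnorm (uemb a : unitization A) = rnorm a.
Proof. exact: unorm_emb. Qed.

Lemma uembI : injective (@uemb R A).
Proof. by move=> a b []. Qed.

Lemma unitization_closed S : closed_subspace [set T : unitization A | S T.2].
Proof.
split=> [||k T T' /= ST ST']; last exact: csubP.
  apply/closed_rnormP => T Tc; apply: (closed_rnormP _).1 (@csub_closed _ _ S) _ _ => d d0.
  have [T' ST' TT'] := Tc _ (divr_gt0 d0 (ltr0n _ 2)); exists T'.2 => //.
  have := rnorm_snd (T - T') => /=; move: TT'; rewrite /= banach_rnorm /=; lra.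
exact: csub0.
Qed.

Let unitization_mul S T T' : S T.2 -> S T'.2 -> S (T ** T').2.
Proof. by move=> ST ST'; apply: csubD; [apply: csubD; exact: csubZ|exact: subalg_mul]. Qed.

Let unitization_star S T : S T.2 -> S (T^#).2.
Proof. exact: subalg_star. Qed.

Definition unitization_sub S : cstar_subalgebra (unitization A) :=
  CstarSubalgebra (unitization_closed S) (@unitization_mul S) (@unitization_star S).

Lemma unitization_sub_one S : unitization_sub S e.
Proof. exact: csub0. Qed.

Lemma sqrt_star_mul S x : S (x^# ** x) ->
  exists k, [/\ S k, k^# = k & k ** k = x^# ** x].
Proof.
move=> Sx; have := pos_star_mul uone_mul mul_uone (uemb x).
rewrite uemb_star -uembM => px.
have [//|[l k] [Sk [ksa _] kk _]] :=
  pos_sqrt uone_mul mul_uone (T := unitization_sub S) (unitization_sub_one S) _ px.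
have l0 : l = 0.
  by move: kk => -[/eqP + _]; rewrite mulf_eq0 orbb => /eqP.
move: kk ksa => [_]; rewrite /= l0 !scale0r !add0r => kk [_ ksa].
by exists k.
Qed.

(** The square root [k + l] of [(rnorm a)^2 - a^# ** a] lies in the unitization;
its scalar part and its part in [S] are given separately, so that it can act on
whatever [S] acts on. *)
Lemma sqrt_unit_sub S a : S (a^# ** a) -> exists (k : R) l,
  [/\ S l, l^# = l, k ^+ 2 = rnorm a ^+ 2 &
      k%:C%C *: l + k%:C%C *: l + l ** l = - (a^# ** a)].
Proof.
move=> Saa.
have aasa : (uemb (a^# ** a))^# = uemb (a^# ** a).
  by rewrite uemb_star cstarM cstarK.
have aan : rnorm (uemb (a^# ** a)) <= rnorm a ^+ 2 by rewrite rnorm_uemb rnorm_CN.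
have [//|[k l] [Sk [ksa _] kk _]] := pos_sqrt uone_mul mul_uone
  (T := unitization_sub S) (unitization_sub_one S) _ (pos_shift mul_uone aasa aan).
  by apply: csubB; [apply/csubZ/unitization_sub_one|].
move: ksa kk => [kr ksa] [kk ll].
have kE : k = (complex.Re k)%:C%C.
  by rewrite RRe_real// CrealE; apply/eqP.
exists (complex.Re k), l; split=> //.
  apply: complexI; rewrite rmorphXn /= -kE expr2 [LHS]kk.
  by rewrite subr0; exact: mulr1.
by move: ll; rewrite /= scaler0 add0r -kE.
Qed.

Lemma sqrt_sub_star_mul S a : S (a^# ** a) -> exists k l, S l /\
  forall x, (rnorm a ^+ 2)%:C%C *: (x^# ** x) - (a ** x)^# ** (a ** x) =
    (k *: x + l ** x)^# ** (k *: x + l ** x).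
Proof.
move=> /sqrt_unit_sub[k [l [Sl lsa kk ll]]]; exists k%:C%C, l; split=> // x.
have -> : (a ** x)^# ** (a ** x) = x^# ** (a^# ** a) ** x by rewrite cstarM; ncring.
rewrite -[a^# ** a]opprK -ll -kk rmorphXn expr2 /= -scalerA.
rewrite cstarD cstarZr cstarM lsa !cmulDl !cmulDr !(cmulNl, cmulNr) !cmulZl !cmulZr.
rewrite !cmulDr !cmulDl !(cmulZr, cmulZl) !cmulA opprK; ncring.
Qed.

Lemma rnorm_sub_cube_le a : rnorm a <= 1 -> rnorm (a - a ** a^# ** a) <= 2^-1.
Proof.
rewrite -!rnorm_uemb uembD uembN !uembM -uemb_star.
exact: rnorm_sub_cube uone_mul mul_uone _.
Qed.

End NonUnital.

(** * Hilbert spaces of positive functionals *)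

(** The elements of [pm_dom] have the [S]-valued inner product
[x, y |-> y^# ** x], which [pm_fun] makes scalar. If [pm_dom] is [S] itself, this
is the construction of Gelfand, Naimark and Segal; if it is a fiber [B_t], with
[S = B_e], this is induction of representations along [B_t]. *)
Record positiveModule (R : realType) (A : cstarAlgType R) (S : cstar_subalgebra A) :=
  PositiveModule {
  pm_dom : set A ;
  pm_fun : A -> R[i] ;
  pm_dom0 : pm_dom 0 ;
  pm_domP : forall (k : R[i]) x y, pm_dom x -> pm_dom y -> pm_dom (k *: x + y) ;
  pm_act : forall a x, S a -> pm_dom x -> pm_dom (a ** x) ;
  pm_star_mul : forall x y, pm_dom x -> pm_dom y -> S (y^# ** x) ;
  pm_funP : forall (k : R[i]) a b, S a -> S b -> pm_fun (k *: a + b) = k * pm_fun a + pm_fun b ;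
  pm_fun_star : forall a, S a -> pm_fun a^# = (pm_fun a)^* ;
  pm_fun_ge0 : forall x, pm_dom x -> 0 <= pm_fun (x^# ** x)
}.

Section PositiveModule.
Context (R : realType) (A : cstarAlgType R) (S : cstar_subalgebra A).
Variable M : positiveModule S.
Local Notation X := (pm_dom M).
Local Notation phi := (pm_fun M).
Implicit Types (a b x y : A).

Definition pm_preHilbert : preHilbert R.
Proof.
refine (@PreHilbert R A X (fun x y => phi (y^# ** x)) (pm_dom0 M) (@pm_domP _ _ _ M) _ _ _).
- move=> k x y z Xx Xy Xz; rewrite cmulDr cmulZr.
  by rewrite pm_funP//; exact: (@pm_star_mul _ _ _ M).
- move=> x y Xx Xy; rewrite -pm_fun_star; last exact: (@pm_star_mul _ _ _ M).
  by rewrite cstarM cstarK.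
- exact: pm_fun_ge0.
Defined.

Lemma pm_fun_ReP (r : R) a b : S a -> S b ->
  complex.Re (phi (r%:C%C *: a - b)) = r * complex.Re (phi a) - complex.Re (phi b).
Proof.
move=> Sa Sb; rewrite pm_funP//; last exact: csubN.
rewrite ReD ReZ; congr (_ + _).
have := pm_funP M (-1) Sb (csub0 S); rewrite addr0 scaleN1r => ->.
have := pm_funP M (-1) (csub0 S) (csub0 S); rewrite scaler0 add0r mulN1r addNr => ->.
by rewrite addr0 mulN1r ReN.
Qed.

(** The difference of the two sides is the value of the functional at
[y^# ** y] for [y = k x + l x], with [k + l] the square root of
[(rnorm a)^2 - a^# ** a]. *)
Lemma pm_bound a x : S (a^# ** a) -> X x ->
  complex.Re (phi ((a ** x)^# ** (a ** x))) <=
    rnorm a ^+ 2 * complex.Re (phi (x^# ** x)).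
Proof.
move=> Saa Xx; have [k [l [Sl kl]]] := sqrt_sub_star_mul Saa.
have Xaax := pm_act Saa Xx.
rewrite -subr_ge0 -pm_fun_ReP; [|exact: (@pm_star_mul _ _ _ M)|]; last first.
  by rewrite cstarM -cmulA [a^# ** _]cmulA; exact: (@pm_star_mul _ _ _ M).
rewrite kl -lecR -ge0_ReE; last first.
  by apply/pm_fun_ge0/pm_domP => //; exact: pm_act.
by apply/pm_fun_ge0/pm_domP => //; exact: pm_act.
Qed.

Lemma pm_adjointable a : S a ->
  @adjointable R pm_preHilbert (fun x => a ** x) (fun x => a^# ** x).
Proof.
move=> Sa; have Sas := subalg_star Sa; split=> [x|x|x y Xx Xy|] /=.
- exact: pm_act.
- exact: pm_act.
- by rewrite cstarM cstarK cmulA.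
- exists (rnorm a); first exact: rnorm_ge0.
  move=> x Xx; have Xax : X (a^# ** x) by exact: pm_act.
  rewrite /seminorm !asboolT//= -[rnorm a](ger0_norm (rnorm_ge0 a)).
  rewrite -sqrtr_sqr -sqrtrM ?sqr_ge0// ler_sqrt; last first.
    by rewrite mulr_ge0 ?sqr_ge0// -lecR -ge0_ReE pm_fun_ge0.
  by rewrite -[rnorm a]rnorm_star pm_bound// cstarK; exact: subalg_mul.
Qed.

Definition pm_hilbert : hilbertSpace R := completion_hilbert pm_preHilbert.

Definition pm_rep a (f : pm_hilbert) : pm_hilbert :=
  @extend R pm_preHilbert (fun x => a^# ** x) f.

Lemma pm_repE a (f : pm_hilbert) x : S a -> X x ->
  (pm_rep a f : completion pm_preHilbert) x = (f : completion pm_preHilbert) (a^# ** x).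
Proof. by move=> Sa Xx; exact: (extendE (pm_adjointable Sa)). Qed.

Lemma pm_rep_embed a x : S a -> X x ->
  pm_rep a (@embed R pm_preHilbert x) = @embed R pm_preHilbert (a ** x).
Proof. by move=> Sa Xx; exact: (extend_embed (pm_adjointable Sa)). Qed.

Lemma pm_representation : representation S pm_rep.
Proof.
split.
- by move=> a Sa k f g; exact: (extend_linear (pm_adjointable Sa)).
- move=> a Sa; have [C CP] := extend_bounded (pm_adjointable Sa).
  apply: (@bounded_linear_continuous _ _ _ _ C) => [k f g|f].
    exact: (extend_linear (pm_adjointable Sa)).
  exact: CP.
- move=> k a b f Sa Sb; apply: completion_eq => x Xx.
  have Sk := csubP k Sa Sb.
  rewrite completionD completionZ !pm_repE// cstarD cstarZ cmulDl cmulZl.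
  rewrite completion_antilinear ?conjCK//; apply: pm_act => //; exact: subalg_star.
- move=> a b f Sa Sb; apply: completion_eq => x Xx.
  have Sab := subalg_mul Sa Sb; have Xax := pm_act (subalg_star Sa) Xx.
  by rewrite (pm_repE _ Sab Xx) (pm_repE _ Sa Xx) (pm_repE _ Sb Xax) cstarM cmulA.
- move=> a f g Sa; rewrite !completion_hdotE; have Sas := subalg_star Sa.
  have := extend_adjoint f g (pm_adjointable Sa) _; rewrite /pm_rep cstarK; apply.
  by have := pm_adjointable Sas; rewrite cstarK.
Qed.

End PositiveModule.

(** * Pure functionals give irreducible representations *)

Section PureRepresentation.
Context (R : realType) (A : cstarAlgType R) (e : A).
Hypotheses (mul1c : forall x, e ** x = x) (mulc1 : forall x, x ** e = x).
Variables (T : cstar_subalgebra A) (f : A -> R).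
Hypotheses (Te : T e) (pf : pure_functional e T f).
Implicit Types (a b x y : A) (k : R[i]).

Let fl : real_linear T f. Proof. by case: pf => -[]. Qed.

Definition complexify x : R[i] := (f x -i* f ('i%C *: x))%C.

Lemma complexifyP k x y : T x -> T y ->
  complexify (k *: x + y) = k * complexify x + complexify y.
Proof.
move=> Tx Ty; have [fD fZ] := fl; have Ti z : T z -> T ('i%C *: z) by exact: csubZ.
have split_k z : k *: z = (complex.Re k)%:C%C *: z + (complex.Im k)%:C%C *: ('i%C *: z).
  by rewrite {1}[k]complexE scalerDl scalerA [in RHS]mulrC.
have fk z : T z -> f (k *: z) = complex.Re k * f z + complex.Im k * f ('i%C *: z).
  by move=> Tz; rewrite split_k fD ?fZ//; apply: csubZ => //; exact: Ti.
have Tk z : T z -> T (k *: z) by exact: csubZ.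
rewrite /complexify fD//; last exact: Tk.
rewrite scalerDr fD//; [|exact/Ti/Tk|exact: Ti].
rewrite scalerA [_ * k]mulrC -scalerA !fk//; last exact: Ti.
rewrite scale_ii (real_linearN fl)//; case: k {split_k fk Tk} => a b /=.
by congr Complex; ring.
Qed.

Lemma complexify_star a : T a -> complexify a^# = (complexify a)^*.
Proof.
move=> Ta; have [[_ fs _] _] := pf; rewrite /complexify fs//.
have -> : 'i%C *: a^# = - ('i%C *: a)^# by rewrite cstarZi opprK.
have Tia : T ('i%C *: a) by exact: csubZ.
by rewrite (real_linearN fl) ?fs//; exact: subalg_star.
Qed.

Lemma complexify_ge0 x : T x -> 0 <= complexify (x^# ** x).
Proof.
move=> Tx; have Txx : T (x^# ** x) by apply/subalg_mul => //; exact: subalg_star.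
have xx : (x^# ** x)^# = x^# ** x by rewrite cstarM cstarK.
have := complexify_star Txx; rewrite xx /complexify => -[]; rewrite opprK => f0.
have -> : f ('i%C *: (x^# ** x)) = 0 by lra.
rewrite lecE /= oppr0 eqxx /=.
have [[_ _ fp] _] := pf; apply: fp => //; exact: pos_star_mul.
Qed.

Definition pure_module : positiveModule T :=
  @PositiveModule R A T T complexify (csub0 T) (@csubP _ _ T)
    (@subalg_mul _ _ T) (fun x y Tx Ty => subalg_mul (subalg_star Ty) Tx)
    complexifyP complexify_star complexify_ge0.

Local Notation H := (pm_hilbert pure_module).
Local Notation rho := (pm_rep (M := pure_module)).
Local Notation vec := (@embed R (pm_preHilbert pure_module)).
Let xi : H := vec e.

Let rho_xi a : T a -> rho a xi = vec a.
Proof. by move=> Ta; rewrite /xi pm_rep_embed// mulc1. Qed.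

Let Re_dot_xi a : T a -> complex.Re (hdot H (rho a xi) xi) = f a.
Proof.
move=> Ta; rewrite rho_xi// completion_hdotE cpl_dot_embedr// embedE//=.
by rewrite (star_unit mulc1) mul1c.
Qed.

Let rep : representation T rho := pm_representation pure_module.

(** For the projection [m] on an invariant subspace of the cyclic vector [xi],
the functional of [m] is below that of [xi]; by purity they are proportional,
which forces [m] to be a multiple of [xi]. *)
Lemma pure_irreducible (N : set H) : closed_subspace N ->
  (forall a v, T a -> N v -> N (rho a v)) -> N = [set 0] \/ N = setT.
Proof.
move=> cN invN; have [m Nm mP] := orthogonal_projection xi cN.
have [[_ fs fp] fpure] := pf.
have linB a v w : T a -> rho a (v - w) = rho a v - rho a w.
  move=> Ta; have := rep_linear rep Ta (-1) w v.
  by rewrite !scaleN1r ![- _ + _]addrC.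
have orth a v : T a -> N v -> hdot H (rho a (xi - m)) v = 0.
  move=> Ta Nv; rewrite (rep_star rep)//; apply: mP; apply: invN => //.
  exact: subalg_star.
pose g a := complex.Re (hdot H (rho a m) m).
have gE (k : A) : T k -> k^# = k -> g (k ** k) = rnorm (rho k m) ^+ 2.
  by move=> Tk ksa; rewrite /g (repM rep)// (rep_star rep)// ksa Re_hdotxx.
have fE (k : A) : T k -> k^# = k -> f (k ** k) = rnorm (rho k xi) ^+ 2.
  move=> Tk ksa; rewrite -Re_dot_xi; last exact: subalg_mul.
  by rewrite (repM rep)// (rep_star rep)// ksa Re_hdotxx.
have gl : real_linear T g.
  split=> [x y Tx Ty|r x Tx]; rewrite /g.
    by rewrite -[x in LHS]scale1r (repP rep)// scale1r hdotDl ReD.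
  rewrite -[_ *: _ in LHS]addr0 (repP rep)//; last exact: csub0.
  have := repP rep (-1) m (csub0 T) (csub0 T); rewrite scaler0 addr0 => z0.
  rewrite hdotDl hdotZl ReD ReZ [X in _ + X](_ : _ = 0) ?addr0//.
  rewrite z0 scaleN1r; have -> : - rho 0 m + rho 0 m = 0 by rewrite addNr.
  by rewrite hdot0l.
have gpos : positive_functional e T g.
  split=> [|x Tx|x Tx px]; first exact: gl.
    by rewrite /g (rep_star rep _ _ (subalg_star Tx)) cstarK Re_hdotC.
  have [k [Tk [ksa _] kk _]] := pos_sqrt mul1c mulc1 Te Tx px.
  by rewrite -kk gE// sqr_ge0.
have [t gt] : exists t, forall x, T x -> g x = t * f x.
  apply: fpure => // x Tx px.
  have [k [Tk [ksa _] kk _]] := pos_sqrt mul1c mulc1 Te Tx px.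
  rewrite -kk gE// fE//.
  have -> : rho k xi = rho k (xi - m) + rho k m by rewrite linB// subrK.
  rewrite rnormD_sqr orth//; last exact: invN.
  by rewrite /= mulr0 addr0 lerDr sqr_ge0.
have v0 : m - t%:C%C *: xi = 0.
  apply: completion_orthogonal_dense => a Ta.
  rewrite -completion_hdotE -rho_xi// hdotBr ReD ReN hdotZr conj_real ReZ.
  rewrite (Re_dot_xi Ta) -(gt a Ta) /g.
  have -> : rho a m = rho a xi - rho a (xi - m) by rewrite linB// opprB addrC subrK.
  by rewrite hdotBl orth// subr0 subrr.
have mE : m = t%:C%C *: xi by exact: subr0_eq.
have [t0|t0] := eqVneq t 0.
  left; apply/seteqP; split=> [v Nv|_ ->]; last by case: cN.
  have m0 : m = 0 by rewrite mE t0 scale0r.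
  apply: completion_orthogonal_dense => a Ta.
  rewrite -completion_hdotE -rho_xi// (rep_star rep)//.
  have := mP (rho a^# v); rewrite m0 subr0 => ->//.
  by apply: invN => //; exact: subalg_star.
right; apply: completion_closed_dense => // a Ta.
rewrite -rho_xi//; apply: invN => //.
have -> : xi = (t^-1)%:C%C *: m by rewrite mE scalerA -rmorphM mulVf// scale1r.
exact: subspaceZ.
Qed.

End PureRepresentation.

Section Separation.
Context (R : realType) (A : cstarAlgType R) (S : cstar_subalgebra A).

(** Gelfand and Naimark: the unitization has a pure functional that is positive
at [y^# ** y], and its cyclic vector is not killed by [y]. An invariant subspace
for [S] is also invariant under the scalars, hence under the unitization. *)
Lemma prim_separates y : S y -> y <> 0 -> exists P : Prim S, ~ P y.
Proof.
move=> Sy y0; pose e := uone A; pose T := unitization_sub S.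
have Te : T e := unitization_sub_one S.
have Ty : T (uemb y) := Sy.
have [|f pf fy] := exists_pure_functional (@uone_mul R A) (@mul_uone R A) Te Ty.
  by move/(@uembI R A).
pose M := pure_module (@uone_mul R A) (@mul_uone R A) pf.
pose H := pm_hilbert M; pose rho a := pm_rep (M := M) (uemb a).
have repT : representation T (pm_rep (M := M)) := pm_representation M.
have repS : representation S rho.
  have TS a : S a -> T (uemb a) by [].
  split=> [a Sa|a Sa|k a b x Sa Sb|a b x Sa Sb|a v w Sa].
  - exact: (rep_linear repT (TS _ Sa)).
  - exact: (rep_continuous repT (TS _ Sa)).
  - by rewrite /rho uembD uembZ (repP repT).
  - by rewrite /rho uembM (repM repT).
  - by rewrite /rho (rep_star repT) ?uemb_star.
have Tyy : T ((uemb y)^# ** uemb y) by apply/subalg_mul => //; exact: subalg_star.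
pose xi : H := @embed R (pm_preHilbert M) e.
have yxi : rho y xi <> 0.
  rewrite /rho pm_rep_embed// mul_uone => y0'.
  have : @embed R (pm_preHilbert M) (uemb y) (uemb y) = 0 by rewrite y0'.
  rewrite embedE//= /complexify => -[fy0 _].
  by move: fy; rewrite fy0 ltxx.
have rho_e (v : H) : pm_rep (M := M) e v = v.
  apply: completion_eq => x Tx; rewrite pm_repE//.
  by rewrite (star_unit (@mul_uone R A)) uone_mul.
have irr : irreducible_rep S rho.
  split=> //; first by exists y, xi.
  move=> N cN invN; apply: pure_irreducible => // -[k a] v Sa Nv.
  have -> : ((k, a) : unitization A) = k *: e + uemb a.
    by congr (_, _) => /=; rewrite ?scaler0 ?add0r// -[k *: 1]/(k * 1) mulr1 addr0.
  rewrite (repP repT)// rho_e; have [_ _ NP] := cN; apply: NP => //.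
  exact: invN.
have prim : primitive S [set a | S a /\ forall x, rho a x = 0].
  by exists H, rho.
by exists (PrimIdeal prim) => /= -[_ /(_ xi)].
Qed.

End Separation.

(** * Representations and primitive ideals *)

Section Representations.
Context (R : realType) (A : cstarAlgType R) (S : cstar_subalgebra A).
Context (H : hilbertSpace R) (rho : A -> H -> H).
Hypothesis rep : representation S rho.
Implicit Types (a b c : A) (x y v w : H).

Lemma repB a v w : S a -> rho a (v - w) = rho a v - rho a w.
Proof.
by move=> Sa; have := rep_linear rep Sa (-1) w v; rewrite !scaleN1r ![- _ + _]addrC.
Qed.

Lemma rep0 v : rho 0 v = 0.
Proof.
have := repP rep (-1) v (csub0 S) (csub0 S); rewrite scaler0 addr0 => ->.
by rewrite scaleN1r addNr.
Qed.

Lemma repDl a b v : S a -> S b -> rho (a + b) v = rho a v + rho b v.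
Proof. by move=> Sa Sb; rewrite -[a in LHS]scale1r (repP rep)// scale1r. Qed.

Lemma repZl (k : R[i]) a v : S a -> rho (k *: a) v = k *: rho a v.
Proof. by move=> Sa; rewrite -[_ *: _ in LHS]addr0 (repP rep) ?rep0 ?addr0//; exact: csub0. Qed.

Lemma repNl a v : S a -> rho (- a) v = - rho a v.
Proof. by move=> Sa; rewrite -scaleN1r repZl// scaleN1r. Qed.

(** With [k + l] the square root of [(rnorm a)^2 - a^# ** a], the square of the
norm of [k v + rho l v] is the difference of the squares of the two sides. *)
Lemma rep_bounded a v : S a -> rnorm (rho a v) <= rnorm a * rnorm v.
Proof.
move=> Sa; have Sas := subalg_star Sa.
have Saa : S (a^# ** a) by exact: subalg_mul.
have [k [l [Sl lsa kk ll]]] := sqrt_unit_sub Saa.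
rewrite -(@ler_pXn2r _ 2) ?nnegrE ?mulr_ge0 ?rnorm_ge0// exprMn -kk.
have : complex.Re (hdot H (rho (- (a^# ** a)) v) v) = - rnorm (rho a v) ^+ 2.
  by rewrite repNl// (repM rep)// -scaleN1r hdotZl mulN1r ReN (rep_star rep)// cstarK Re_hdotxx.
have Skl : S (k%:C%C *: l) by exact: csubZ.
rewrite -ll !repDl//; [|exact: csubD|exact: subalg_mul].
rewrite repZl// (repM rep)// !hdotDl !ReD hdotZl ReZ (rep_star rep (rho l v))// lsa Re_hdotxx.
have := sqr_ge0 (rnorm (k%:C%C *: v + rho l v)); rewrite rnormD_sqr rnormZr exprMn.
rewrite real_normK ?num_real// hdotZl ReZ (Re_hdotC v); lra.
Qed.

Lemma rep_kernel_closed : closed_subspace [set a | S a /\ forall v, rho a v = 0].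
Proof.
split=> [||k a b /= [Sa a0] [Sb b0]]; last first.
- by split=> [|v]; [exact: csubP|rewrite (repP rep)// a0 b0 scaler0 addr0].
- by split=> [|v]; [exact: csub0|exact: rep0].
apply/closed_rnormP => a ca; have Sa : S a.
  by apply: (closed_rnormP _).1 (@csub_closed _ _ S) _ _ => d /ca[b [Sb _] ab]; exists b.
split=> // v; apply: rnorm_small0 => d d0.
have v1 : 0 < rnorm v + 1 by rewrite ltr_wpDl ?rnorm_ge0.
have [b [Sb b0] ab] := ca _ (divr_gt0 d0 v1).
have -> : rho a v = rho (a - b) v by rewrite repDl ?repNl ?b0 ?subr0//; exact: csubN.
rewrite (le_trans (rep_bounded _ _))//; first exact: csubB.
move: ab; rewrite ltr_pdivlMr//.
have := rnorm_ge0 (a - b); have := rnorm_ge0 v; nra.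
Qed.

Hypothesis irr : forall M : set H, closed_subspace M ->
  (forall a x, S a -> M x -> M (rho a x)) -> M = [set 0] \/ M = setT.

(** The closure of the orbit of [xi] is an invariant subspace. *)
Lemma irreducible_cyclic (xi : H) : (exists2 a, S a & rho a xi <> 0) ->
  forall v d, 0 < d -> exists2 a, S a & rnorm (v - rho a xi) < d.
Proof.
move=> [a Sa axi]; pose N := [set v : H | forall d, 0 < d ->
  exists2 a, S a & rnorm (v - rho a xi) < d].
have cN : closed_subspace N.
  split=> [||k v w /= Nv Nw d d0].
  - apply/closed_rnormP => v cv d d0; have d2 := divr_gt0 d0 (ltr0n R 2).
    have [w /(_ _ d2)[b Sb wb] vw] := cv _ d2; exists b => //.
    have := rnorm_dist v w (rho b xi); lra.
  - by move=> d d0; exists 0; [exact: csub0|rewrite rep0 subrr rnorm0].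
  - have k1 : 0 < cabs k + 1 by rewrite ltr_wpDl ?cabs_ge0.
    have d2 := divr_gt0 d0 (ltr0n R 2).
    have [b Sb vb] := Nv _ (divr_gt0 d2 k1); have [c Sc wc] := Nw _ d2.
    exists (k *: b + c); first exact: csubP.
    rewrite (repP rep)// opprD addrACA -scalerBr.
    apply: le_lt_trans (rnormD _ _) _; rewrite rnormZ.
    move: vb; rewrite ltr_pdivlMr//.
    have := rnorm_ge0 (v - rho b xi); have := cabs_ge0 k; nra.
case: (irr cN) => [b v Sb Nv d d0|N0|NT].
- have b1 : 0 < rnorm b + 1 by rewrite ltr_wpDl ?rnorm_ge0.
  have [c Sc vc] := Nv _ (divr_gt0 d0 b1); exists (b ** c); first exact: subalg_mul.
  rewrite (repM rep)// -repB//; apply: le_lt_trans (rep_bounded _ Sb) _.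
  move: vc; rewrite ltr_pdivlMr//; have := rnorm_ge0 (v - rho c xi).
  have := rnorm_ge0 b; nra.
- case: axi; suff : N (rho a xi) by rewrite N0.
  by move=> d d0; exists a => //; rewrite subrr rnorm0.
- by move=> v d d0; have : N v by [rewrite NT]; apply.
Qed.

End Representations.

Section Primitive.
Context (R : realType) (A : cstarAlgType R) (S : cstar_subalgebra A) (P : Prim S).
Implicit Types (a b c : A).

Lemma prim_sub a : P a -> S a.
Proof. by have [H [rho [_ ->]]] := prim_primitive P => -[]. Qed.

Lemma prim_closed_subspace : closed_subspace P.
Proof.
by have [H [rho [[rep _ _] ->]]] := prim_primitive P; exact: rep_kernel_closed.
Qed.

Lemma prim_mull a b : S a -> P b -> P (a ** b).
Proof. by move=> Sa Pb; apply: prim_mul => //; [exact: prim_sub|right]. Qed.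

Lemma prim_mulr a b : P a -> S b -> P (a ** b).
Proof. by move=> Pa Sb; apply: prim_mul => //; [exact: prim_sub|left]. Qed.

Lemma prim_star a : P a -> P a^#.
Proof.
have [H [rho [[rep _ _] ->]]] := prim_primitive P => -[Sa a0].
split=> [|v]; first exact: subalg_star.
apply: hdot_eq0; rewrite (rep_star rep) ?cstarK ?a0 ?hdot0r//.
exact: subalg_star.
Qed.

Lemma prim_star_mul a : S a -> P (a^# ** a) -> P a.
Proof.
have [H [rho [[rep _ _] ->]]] := prim_primitive P => Sa [_ aa0].
split=> // v; apply: hdot_eq0.
by rewrite (rep_star rep)// -(repM rep) ?aa0 ?hdot0r//; exact: subalg_star.
Qed.

End Primitive.

(** * Closed spans *)

Section ClosedSpan.
Context (R : realType) (A : cstarAlgType R).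
Implicit Types (a b x : A) (N I E : set A).

Lemma closed_span_subspace E : closed_subspace (closed_span E).
Proof.
split=> [|N [[_ N0 _] _]//|k x y Ex Ey N [cN EN]].
  by apply: closed_bigI => N [[cN _ _] _].
by have [_ _ NP] := cN; apply: NP; [exact: Ex|exact: Ey].
Qed.

Lemma closed_span_gen E : E `<=` closed_span E.
Proof. exact: sub_gen_smallest. Qed.

Lemma closed_span_min E N : closed_subspace N -> E `<=` N -> closed_span E `<=` N.
Proof. by move=> cN EN x; apply. Qed.

Lemma mulspan_gen N I a b : N a -> I b -> mulspan N I (a ** b).
Proof. by move=> Na Ib; apply: closed_span_gen; exists a => //; exists b. Qed.

Lemma mulspan_min N I E : closed_subspace E ->
  (forall a b, N a -> I b -> E (a ** b)) -> mulspan N I `<=` E.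
Proof.
by move=> cE h; apply: closed_span_min => // _ [a Na [b Ib <-]]; exact: h.
Qed.

Lemma closed_subspace_bounded N (f : A -> A) (C : R) : closed_subspace N ->
  (forall x y, f (x - y) = f x - f y) ->
  (forall x, rnorm (f x) <= C * rnorm x) -> closed (f @^-1` N).
Proof.
move=> [cN _ _] fB fC; apply/closed_rnormP => x cx.
apply: (closed_rnormP _).1 cN _ _ => d d0.
have C1 : 0 < `|C| + 1 by rewrite ltr_wpDl.
have [y Ny xy] := cx _ (divr_gt0 d0 C1); exists (f y) => //.
rewrite -fB; apply: le_lt_trans (fC _) _; move: xy; rewrite ltr_pdivlMr//.
by have := ler_norm C; have := rnorm_ge0 (x - y); nra.
Qed.

Lemma closed_subspace_mull N a : closed_subspace N -> closed_subspace [set x | N (a ** x)].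
Proof.
move=> cN; have [_ N0 NP] := cN; split=> [||k x y /= Nx Ny].
- apply: (closed_subspace_bounded (C := rnorm a) cN) => [x y|x].
    exact: cmulBr.
  exact: rnormM.
- by rewrite /= cmul0r.
- by rewrite cmulDr cmulZr; apply: NP.
Qed.

Lemma closed_subspace_mulr N a : closed_subspace N -> closed_subspace [set x | N (x ** a)].
Proof.
move=> cN; have [_ N0 NP] := cN; split=> [||k x y /= Nx Ny].
- apply: (closed_subspace_bounded (C := rnorm a) cN) => [x y|x].
    exact: cmulBl.
  by rewrite mulrC; exact: rnormM.
- by rewrite /= cmul0l.
- by rewrite cmulDl cmulZl; apply: NP.
Qed.

Lemma closed_subspace_cap N I : closed_subspace N -> closed_subspace I ->
  closed_subspace (N `&` I).
Proof.
move=> [cN N0 NP] [cI I0 IP]; split=> [||k x y [Nx Ix] [Ny Iy]].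
- exact: closedI.
- by split.
- by split; [apply: NP|apply: IP].
Qed.

(** Subtracting the cube of [a / rnorm a] from it at least halves the norm; so
[a] is the sum of a series of cubes. *)
Lemma cubes_span I E : closed_subspace I ->
  (forall (k : R[i]) a, E a -> E (k *: a)) ->
  (forall a, E a -> I (a ** a^# ** a)) ->
  (forall a, E a -> E (a - a ** a^# ** a)) -> E `<=` I.
Proof.
move=> cI EZ EI EB; have [closedI I0 IP] := cI.
have approx n : forall a, E a -> rnorm a <= 1 ->
    exists y, [/\ I y, E (a - y) & rnorm (a - y) <= 2^-1 ^+ n].
  elim: n => [|n IH] a Ea a1.
    by exists 0; split; rewrite ?subr0 ?expr0.
  have half_pos : 0 < 2^-1 ^+ n :> R by rewrite exprn_gt0.
  have [y [Iy Eay ayn]] := IH a Ea a1.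
  pose r : A := ((2^-1 ^+ n)^-1)%:C%C *: (a - y).
  have rE : (2^-1 ^+ n)%:C%C *: r = a - y.
    by rewrite scalerA -rmorphM mulfV ?scale1r// gt_eqF.
  have Er : E r by exact: EZ.
  have r1 : rnorm r <= 1.
    by rewrite rnormZr ger0_norm ?invr_ge0 ?(ltW half_pos)// ler_pdivrMl// mulr1.
  exists ((2^-1 ^+ n)%:C%C *: (r ** r^# ** r) + y).
  have -> : a - ((2^-1 ^+ n)%:C%C *: (r ** r^# ** r) + y) =
      (2^-1 ^+ n)%:C%C *: (r - r ** r^# ** r).
    by rewrite scalerBr rE opprD addrCA addrC addrAC.
  split; first by apply: IP => //; exact: EI.
    by apply: EZ; exact: EB.
  rewrite rnormZr ger0_norm ?(ltW half_pos)// exprSr ler_pM2l//.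
  exact: rnorm_sub_cube_le.
have small a : E a -> rnorm a <= 1 -> I a.
  move=> Ea a1; apply: (closed_rnormP _).1 closedI _ _ => d d0.
  have [n nd] : exists n, 2^-1 ^+ n < d.
    have h1 : `|2^-1 : R| < 1 by rewrite ger0_norm ?invr_ge0// invf_lt1// ltr1n.
    have /cvgrPdist_lt/(_ d d0)[n _ nd] := cvg_expr h1.
    exists n; have : `|0 - 2^-1 ^+ n| < d := nd n (leqnn n).
    by rewrite sub0r normrN ger0_norm// exprn_ge0// invr_ge0.
  have [y [Iy _ ay]] := approx n a Ea a1; exists y => //.
  exact: le_lt_trans nd.
move=> a Ea; have [a0|a0] := eqVneq (rnorm a) 0; first by rewrite (rnorm_eq0 a0).
have ap : 0 < rnorm a by rewrite lt_neqAle eq_sym a0 rnorm_ge0.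
have Ia : I (((rnorm a)^-1)%:C%C *: a).
  apply: small; first exact: EZ.
  by rewrite rnormZr ger0_norm ?invr_ge0 ?rnorm_ge0// mulVf.
have -> : a = (rnorm a)%:C%C *: (((rnorm a)^-1)%:C%C *: a) + 0.
  by rewrite addr0 scalerA -rmorphM mulfV// scale1r.
exact: IP.
Qed.

End ClosedSpan.

(** * Fell bundles and induced representations *)

Section Fibers.
Context (R : realType) (G : groupType) (A : cstarAlgType R) (B : fellBundle G A).
Local Notation S := (unit_fiber B).
Implicit Types (s t : G) (a b c : A).

Lemma fiber0 t : B t 0.
Proof. by have [] := fiber_closed_subspace B t. Qed.

Lemma fiberP t (k : R[i]) a b : B t a -> B t b -> B t (k *: a + b).
Proof. by have [_ _] := fiber_closed_subspace B t; apply. Qed.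

Lemma fiberM s t a b : B s a -> B t b -> B (s * t)%g (a ** b).
Proof. by move=> Ba Bb; apply: fiber_mul; exact: mulspan_gen. Qed.

Lemma fiber1M t a b : S a -> B t b -> B t (a ** b).
Proof. by move=> Sa Bb; have := fiberM Sa Bb; rewrite mul1g. Qed.

Lemma fiberM1 t a b : B t a -> S b -> B t (a ** b).
Proof. by move=> Ba Sb; have := fiberM Ba Sb; rewrite mulg1. Qed.

Lemma fiber_starV t a : B t a -> B (t^-1)%g a^#.
Proof. by move=> Ba; rewrite -fiber_star; exists a. Qed.

Lemma fiberV_star t a : B (t^-1)%g a -> B t a^#.
Proof. by move/fiber_starV; rewrite invgK. Qed.

Lemma fiberVM t a b : B (t^-1)%g a -> B t b -> S (a ** b).
Proof. by move=> Ba Bb; have := fiberM Ba Bb; rewrite mulVg. Qed.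

Lemma fiberMV t a b : B t a -> B (t^-1)%g b -> S (a ** b).
Proof. by move=> Ba Bb; have := fiberM Ba Bb; rewrite mulgV. Qed.

Lemma fiber_star_mul t a b : B t a -> B t b -> S (a^# ** b).
Proof. by move=> /fiber_starV Ba Bb; exact: fiberVM Ba Bb. Qed.

Lemma dual_ideal_subspace t : closed_subspace (dual_ideal B t).
Proof. exact: closed_span_subspace. Qed.

Lemma dual_ideal_gen t a b : B t a -> B (t^-1)%g b -> dual_ideal B t (a ** b).
Proof. exact: mulspan_gen. Qed.

Lemma dual_ideal_sub t a : dual_ideal B t a -> S a.
Proof.
apply: (@mulspan_min _ _ _ _ S); first exact: subalg_closed_subspace.
by move=> b c Bb Bc; exact: fiberMV Bb Bc.
Qed.

Lemma dual_ideal_mulr t a b : dual_ideal B t a -> S b -> dual_ideal B t (a ** b).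
Proof.
move=> Da Sb; move: a Da; apply: mulspan_min.
  exact/closed_subspace_mulr/dual_ideal_subspace.
by move=> c d Bc Bd /=; rewrite -cmulA; apply: dual_ideal_gen => //; exact: fiberM1.
Qed.

Lemma dual_ideal_actr t a b : B t a -> dual_ideal B (t^-1)%g b -> B t (a ** b).
Proof. by move=> Ba /dual_ideal_sub; exact: fiberM1. Qed.

(** An element [a] of [Q] and of [D_t] is a sum of cubes [a ** a^# ** a], in
which the outer factors are approximated by sums of products [b ** c] with [b] in
[B_t] and [c] in its adjoint. *)
Lemma induced_idealE t (P Q : Prim S) :
  (forall a, Q a <-> S a /\ forall b c, B t b -> B t c -> P (b^# ** a ** c)) ->
  induced_ideal B t (P `&` dual_ideal B (t^-1)%g) = Q `&` dual_ideal B t.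
Proof.
move=> QP; apply/seteqP; split.
  apply: mulspan_min.
    exact: closed_subspace_cap (prim_closed_subspace Q) (dual_ideal_subspace t).
  move=> a c Ba Bc; move: a Ba; apply: mulspan_min.
    apply/closed_subspace_mulr/closed_subspace_cap; first exact: prim_closed_subspace.
    exact: dual_ideal_subspace.
  move=> b p Bb [Pp Dp]; have Bbp : B t (b ** p) by exact: dual_ideal_actr.
  split; last exact: dual_ideal_gen.
  apply/QP; split=> [|b' c' Bb' Bc']; first exact: fiberMV Bbp Bc.
  have -> : b'^# ** (b ** p ** c) ** c' = b'^# ** b ** p ** (c ** c') by ncring.
  apply: prim_mulr; last exact: fiberVM Bc Bc'.
  by apply: prim_mull => //; exact: fiber_star_mul Bb' Bb.
set I := induced_ideal _ _ _.
have cI : closed_subspace I by exact: closed_span_subspace.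
have DQD y : Q y -> forall a b, dual_ideal B t a -> dual_ideal B t b -> I (a ** y ** b).
  move=> Qy a b Da Db; move: a Da; apply: mulspan_min.
    exact: (closed_subspace_mulr y (closed_subspace_mulr b cI)).
  move=> c1 c2 Bc1 Bc2; move: b Db; apply: mulspan_min; first exact: closed_subspace_mull.
  move=> c3 c4 Bc3 Bc4 /=.
  have -> : c1 ** c2 ** y ** (c3 ** c4) = c1 ** (c2 ** y ** c3) ** c4 by ncring.
  apply: mulspan_gen => //; apply: mulspan_gen => //; have [Sy Py] := (QP y).1 Qy.
  split; first by have := Py c2^# c3 (fiberV_star Bc2) Bc3; rewrite cstarK.
  rewrite -cmulA; apply: dual_ideal_gen => //; rewrite invgK; exact: fiber1M.
apply: cubes_span => //.
- move=> k a [Qa Da]; have [_ Q0 QPl] := prim_closed_subspace Q.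
  have [_ D0 DP] := dual_ideal_subspace t.
  by rewrite -[k *: a]addr0; split; [apply: QPl|apply: DP].
- by move=> a [Qa Da]; apply: DQD => //; exact: prim_star.
- move=> a [Qa Da]; have Sa := prim_sub Qa; have Sas := subalg_star Sa.
  have [_ Q0 QPl] := prim_closed_subspace Q.
  have [_ D0 DP] := dual_ideal_subspace t.
  rewrite addrC -scaleN1r; split.
    by apply: QPl => //; apply: prim_mulr => //; exact: prim_mulr.
  by apply: DP => //; apply: dual_ideal_mulr => //; exact: dual_ideal_mulr.
Qed.

End Fibers.

(** The positive element [c^# ** c] has a square root in the unit fiber. *)
Lemma rep_fiber_ge0 (R : realType) (G : groupType) (A : cstarAlgType R)
    (B : fellBundle G A) (H : hilbertSpace R) (rho : A -> H -> H) :
  representation (unit_fiber B) rho ->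
  forall v t c, B t c -> 0 <= hdot H (rho (c^# ** c) v) v.
Proof.
move=> rep v t c Bc; have [k [Sk ksa kk]] := sqrt_star_mul (fiber_star_mul Bc Bc).
rewrite -kk (repM rep)// (rep_star rep)// ksa hdotxx ler0c.
exact: sqr_ge0.
Qed.

Section Induction.
Context (R : realType) (G : groupType) (A : cstarAlgType R) (B : fellBundle G A).
Local Notation S := (unit_fiber B).
Variables (t : G) (H0 : hilbertSpace R) (rho : A -> H0 -> H0) (xi : H0).
Hypothesis rep : representation S rho.
Hypothesis irr : forall M : set H0, closed_subspace M ->
  (forall a x, S a -> M x -> M (rho a x)) -> M = [set 0] \/ M = setT.
Hypothesis xi_neq0 : exists2 b, B t b & rho (b^# ** b) xi <> 0.
Implicit Types (a b c x y : A) (v w : H0).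

Let BB x y : B t x -> B t y -> S (x^# ** y).
Proof. exact: fiber_star_mul. Qed.

Let phi a : R[i] := hdot H0 (rho a xi) xi.

Let phiP (k : R[i]) a b : S a -> S b -> phi (k *: a + b) = k * phi a + phi b.
Proof. by move=> Sa Sb; rewrite /phi (repP rep)// hdotPl. Qed.

Let phi_star a : S a -> phi a^# = (phi a)^*.
Proof.
move=> Sa; rewrite /phi (rep_star rep) ?cstarK; last exact: subalg_star.
exact: hdotC.
Qed.

Let phi_ge0 x : B t x -> 0 <= phi (x^# ** x).
Proof. by move=> Bx; apply: (rep_fiber_ge0 rep xi Bx). Qed.

Definition induced_module : positiveModule S :=
  @PositiveModule R A S (B t) phi (fiber0 B t) (@fiberP _ _ _ B t)
    (fun a x => @fiber1M _ _ _ B t a x)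
    (fun x y Bx By => fiber_star_mul By Bx) phiP phi_star phi_ge0.

Local Notation E := (pm_preHilbert induced_module).
Local Notation H := (pm_hilbert induced_module).
Local Notation lam := (pm_rep (M := induced_module)).
Local Notation vec := (@embed R E).

Let rho_star_xi_le c x : B t c -> B t x ->
  rnorm (rho (c^# ** x) xi) <= rnorm c * @seminorm R E x.
Proof.
move=> Bc Bx; have Scc : S (c ** c^#) by exact: fiberMV Bc (fiber_starV Bc).
have Scx : S (c^# ** x) by exact: BB.
rewrite -(@ler_pXn2r _ 2) ?nnegrE ?mulr_ge0 ?rnorm_ge0 ?seminorm_ge0//.
have <- : complex.Re (phi ((c^# ** x)^# ** (c^# ** x))) = rnorm (rho (c^# ** x) xi) ^+ 2.
  rewrite /phi (repM rep)//; last exact: subalg_star.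
  by rewrite (rep_star rep) ?cstarK ?Re_hdotxx//; exact: subalg_star.
rewrite exprMn.
have -> : @seminorm R E x ^+ 2 = complex.Re (phi (x^# ** x)).
  by have := @seminorm_sqr R E x Bx => /(congr1 (@complex.Re R)).
rewrite -[rnorm c]rnorm_star; apply: (pm_bound (M := induced_module)) => //.
by rewrite cstarK.
Qed.

(** The elementary tensor [c (x) v] of the induced space, which is the completion
of [B_t (x) H0] although only the tensors with [xi] enter in its definition. *)
Let tensor_fun c v b : R[i] := if `[< B t b >] then hdot H0 (rho (b^# ** c) v) xi else 0.

Definition tensor c v : completion E := 
  insubd (0 : completion E) (tensor_fun c v : E -> R[i]).

Let rho_pair b c v : B t b -> B t c ->
  hdot H0 (rho (b^# ** c) v) xi = hdot H0 v (rho (c^# ** b) xi).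
Proof.
by move=> Bb Bc; rewrite (rep_star rep) ?cstarM ?cstarK//; exact: BB.
Qed.

Let cyclic v d : 0 < d -> exists2 a, S a & rnorm (v - rho a xi) < d.
Proof.
move=> d0; apply: (irreducible_cyclic rep irr) => //.
by have [b Bb bxi] := xi_neq0; exists (b^# ** b) => //; exact: BB.
Qed.

Lemma tensorE c v b : B t c -> B t b -> tensor c v b = hdot H0 (rho (b^# ** c) v) xi.
Proof.
move=> Bc Bb; rewrite /tensor /insubd insubT /=; last by rewrite /tensor_fun asboolT.
apply/asboolP; split=> [b' Bb'|d d0]; first by rewrite /tensor_fun asboolF.
have c1 : 0 < rnorm c + 1 by rewrite ltr_wpDl ?rnorm_ge0.
have [a Sa va] := cyclic v (divr_gt0 d0 c1).
exists (c ** a); first exact: fiberM1.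
move=> b' Bb'; rewrite /tensor_fun asboolT//=.
have -> : phi (b'^# ** (c ** a)) = hdot H0 (rho (b'^# ** c) (rho a xi)) xi.
  by rewrite /phi cmulA (repM rep)//; exact: BB.
rewrite !rho_pair// -hdotBl (le_trans (hdot_le _ _))//.
rewrite (le_trans (ler_wpM2l (rnorm_ge0 _) (rho_star_xi_le Bc Bb')))// mulrA.
rewrite ler_wpM2r ?seminorm_ge0//; move: va; rewrite ltr_pdivlMr//.
have := rnorm_ge0 (v - rho a xi); lra.
Qed.

Lemma tensor_xi c : B t c -> tensor c xi = vec c.
Proof.
by move=> Bc; apply: completion_eq => b Bb; rewrite tensorE// embedE.
Qed.

Lemma tensor_balanced c a v : B t c -> S a -> tensor c (rho a v) = tensor (c ** a) v.
Proof.
move=> Bc Sa; have Bca : B t (c ** a) by exact: fiberM1.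
apply: completion_eq => b Bb; rewrite !tensorE// cmulA.
by rewrite -(repM rep v (BB Bb Bc) Sa).
Qed.

Lemma lam_tensor a c v : S a -> B t c -> lam a (tensor c v) = tensor (a ** c) v.
Proof.
move=> Sa Bc; have Bac : B t (a ** c) by exact: fiber1M.
apply: completion_eq => b Bb; have Bab : B t (a^# ** b).
  by apply: fiber1M => //; exact: subalg_star.
by rewrite pm_repE// !tensorE// cstarM cstarK cmulA.
Qed.

Lemma tensorPr c (k : R[i]) v w : B t c ->
  tensor c (k *: v + w) = k *: tensor c v + tensor c w.
Proof.
move=> Bc; apply: completion_eq => b Bb; rewrite completionD completionZ !tensorE//.
by rewrite (rep_linear rep (fiber_star_mul Bb Bc)) hdotPl.
Qed.

Lemma tensor_le c v : B t c -> cpl_norm (tensor c v) <= rnorm c * rnorm v.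
Proof.
move=> Bc; apply: cpl_norm_le => [|b Bb]; first by rewrite mulr_ge0 ?rnorm_ge0.
rewrite tensorE// rho_pair// (le_trans (hdot_le _ _))// [rnorm c * _]mulrC -mulrA.
by rewrite ler_wpM2l ?rnorm_ge0// rho_star_xi_le.
Qed.

(** The adjoint of [v |-> c (x) v]; it maps [vec x] to [rho (c^# ** x) xi]. *)
Lemma exists_cotensor (F : H) c : B t c ->
  exists z, forall v, hdot H0 z v = cpl_dot F (tensor c v).
Proof.
move=> Bc; have inv0 n : 0 < n.+1%:R^-1 :> R by rewrite invr_gt0.
have /choice[u uP] : forall n, exists x, B t x /\ cpl_norm (F - vec x) <= n.+1%:R^-1.
  by move=> n; have [x Bx xP] := cpl_dense F (inv0 n); exists x.
have small (d : R) : 0 < d -> exists N, forall n, (N <= n)%N -> cpl_norm (F - vec (u n)) < d.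
  move=> d0; have [k] := ltr_add_invr (d0 : 0 < d); rewrite add0r => kd.
  exists k => n kn; apply: le_lt_trans (uP n).2 _.
  by rewrite (le_lt_trans _ kd)// lef_pV2 ?posrE// ler_nat.
pose z n := rho (c^# ** u n) xi.
have Bu n : B t (u n) := (uP n).1.
have zB m n : rnorm (z m - z n) <= rnorm c *
    (cpl_norm (F - vec (u m)) + cpl_norm (F - vec (u n))).
  have -> : z m - z n = rho (c^# ** (u m - u n)) xi.
    rewrite cmulBr (repDl rep) ?(repNl rep)//; [exact: BB|exact: BB|].
    by apply: csubN; exact: BB.
  have Bmn : B t (u m - u n) by rewrite addrC -scaleN1r; exact: fiberP.
  apply: le_trans (rho_star_xi_le Bc Bmn) _; apply: ler_wpM2l; first exact: rnorm_ge0.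
  rewrite -(@cpl_norm_embed R E (u m - u n) Bmn) (@embedB R E _ _ (Bu m) (Bu n)).
  have -> : vec (u m) - vec (u n) = (F - vec (u n)) - (F - vec (u m)).
    by rewrite opprB [RHS]addrC addrA subrK.
  by rewrite [leRHS]addrC; exact: cpl_normB.
have c1 : 0 < rnorm c + 1 by rewrite ltr_wpDl ?rnorm_ge0.
have [|l zl] := @cauchy_sequence_tends _ _ z.
  move=> d d0; have [N Nu] := small _ (divr_gt0 (divr_gt0 d0 (ltr0n R 2)) c1).
  exists N => p q Np Nq; apply: le_lt_trans (zB p q) _.
  move: (Nu p Np) (Nu q Nq); rewrite !ltr_pdivlMr//.
  have := cpl_norm_ge0 (F - vec (u p)); have := cpl_norm_ge0 (F - vec (u q)).
  have := rnorm_ge0 c; nra.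
exists l => v; apply/eqP; rewrite -subr_eq0; apply/eqP/cabs_eq0/eqP.
rewrite eq_le cabs_ge0 andbT; apply/ler_addgt0Pr => d d0; rewrite add0r.
have v1 : 0 < rnorm v + 1 by rewrite ltr_wpDl ?rnorm_ge0.
have [N1 h1] := zl _ (divr_gt0 (divr_gt0 d0 (ltr0n R 2)) v1).
have [N2 h2] := small _ (divr_gt0 (divr_gt0 (divr_gt0 d0 (ltr0n R 2)) v1) c1).
set n := maxn N1 N2.
have -> : hdot H0 l v - cpl_dot F (tensor c v) = - hdot H0 (z n - l) v
    - cpl_dot (F - vec (u n)) (tensor c v).
  rewrite hdotBl cpl_dotBl (@cpl_dot_embedl R E _ _ (Bu n)).
  rewrite (tensorE v Bc (Bu n)) (rho_pair v (Bu n) Bc) -hdotC.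
  by ring.
rewrite (le_trans (cabsD _ _))// !cabsN.
have g1 := h1 n (leq_maxl _ _); have g2 := h2 n (leq_maxr _ _).
have g3 := hdot_le (z n - l) v; have g4 := cpl_dot_le (F - vec (u n)) (tensor c v).
have g5 := tensor_le v Bc.
have g6 : rnorm (z n - l) * rnorm v <= d / 2.
  move: g1; rewrite ltr_pdivlMr//; have := rnorm_ge0 (z n - l); lra.
have g7 : cpl_norm (F - vec (u n)) * cpl_norm (tensor c v) <= d / 2.
  rewrite (le_trans (ler_wpM2l (cpl_norm_ge0 _) g5))//.
  move: g2; rewrite !ltr_pdivlMr//.
  set p := cpl_norm (F - vec (u n)); have p0 : 0 <= p := cpl_norm_ge0 _.
  have := mulr_ge0 p0 (rnorm_ge0 c); have := mulr_ge0 p0 (rnorm_ge0 v).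
  clear - p0; lra.
clear - g3 g4 g6 g7; lra.
Qed.

(** The [v] such that [c (x) v] is in [N] for all [c] form an invariant subspace
[V] of [H0]. If it is everything, then [N] contains all [c (x) xi]. If it is zero,
then so are the images of [N] under the adjoints of [v |-> c (x) v], because
applying [v |-> b (x) v] to them gives the action of [b ** c^#]. *)
Lemma induced_irreducible (N : set H) : closed_subspace N ->
  (forall a F, S a -> N F -> N (lam a F)) -> N = [set 0] \/ N = setT.
Proof.
move=> cN invN; have [closedN N0 NP] := cN.
pose V := [set v : H0 | forall c, B t c -> N (tensor c v)].
have tensorB c v w : B t c -> tensor c (v - w) = tensor c v - tensor c w.
  by move=> Bc; rewrite addrC -scaleN1r tensorPr// scaleN1r addrC.
have tensor0 c : B t c -> tensor c 0 = 0 by move=> Bc; rewrite -(subrr 0) tensorB// subrr.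
have cV : closed_subspace V.
  split=> [|c Bc|k v w Vv Vw c Bc]; last 2 first.
  - by rewrite tensor0.
  - by rewrite tensorPr//; apply: NP; [exact: Vv|exact: Vw].
  apply/closed_rnormP => v cv c Bc; apply: (closed_rnormP _).1 closedN _ _ => d d0.
  have c1 : 0 < rnorm c + 1 by rewrite ltr_wpDl ?rnorm_ge0.
  have [w Vw vw] := cv _ (divr_gt0 d0 c1); exists (tensor c w); first exact: Vw.
  have := tensor_le (v - w) Bc; rewrite tensorB// completion_rnormE.
  move: vw; rewrite ltr_pdivlMr//; have := rnorm_ge0 (v - w); lra.
case: (irr cV) => [a v Sa Vv c Bc|V0|VT].
- by rewrite tensor_balanced//; apply: Vv; exact: fiberM1.
- left; apply/seteqP; split=> [F NF|_ ->//].
  apply: completion_orthogonal_dense => c Bc; have [z zP] := exists_cotensor F Bc.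
  have Vz : V z.
    move=> b Bb; have Sbc : S (b ** c^#) by exact: fiberMV Bb (fiber_starV Bc).
    suff -> : tensor b z = lam (b ** c^#) F by exact: invN.
    apply: completion_eq => x Bx; have Bcx : B t ((b ** c^#)^# ** x).
      by apply: fiber1M => //; exact: subalg_star.
    have Sbx : S (b^# ** x) by exact: BB.
    rewrite pm_repE// tensorE// rho_pair// zP tensor_balanced// tensor_xi; last exact: fiberM1.
    rewrite (@cpl_dot_embedr R E _ _ (fiberM1 Bc Sbx)) cstarM cstarK; congr (F _).
    exact: cmulA.
  have z0 : z = 0 by have : [set 0] z by rewrite -V0.
  by rewrite cpl_dotC -tensor_xi// -zP z0 hdot0l conjC0.
- right; apply: completion_closed_dense => // c Bc.
  by rewrite -tensor_xi//; have : V xi by [rewrite VT]; apply.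
Qed.

(** The coefficients of [a] on elementary tensors are those of
[b^# ** a ** c]. *)
Lemma induced_kernel a : S a ->
  (forall F, lam a F = 0) <->
  (forall b c, B t b -> B t c -> forall v, rho (b^# ** a ** c) v = 0).
Proof.
move=> Sa; split=> [a0 b c Bb Bc v|a0 F].
  have Bac : B t (a ** c) by exact: fiber1M.
  have Sbac : S (b^# ** a ** c) by rewrite -cmulA; exact: BB.
  apply: rnorm_small0 => d d0.
  set w := rho _ v; have w0 : 0 < rnorm w + 1 by rewrite ltr_wpDl ?rnorm_ge0.
  have orth s : S s -> hdot H0 w (rho s xi) = 0.
    move=> Ss; have Bbs : B t (b ** s) by exact: fiberM1.
    have : lam a (tensor c v) (b ** s) = 0 :> R[i] by rewrite a0.
    rewrite lam_tensor// tensorE// cstarM => <-.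
    have -> : s^# ** b^# ** (a ** c) = s^# ** (b^# ** a ** c) by ncring.
    rewrite (repM rep) ?(rep_star rep) ?cstarK//; exact: subalg_star.
  have [s Ss ws] := cyclic w d0.
  have [->|wn] := eqVneq (rnorm w) 0; first exact: ltW.
  have wp : 0 < rnorm w by rewrite lt_neqAle eq_sym wn rnorm_ge0.
  have : rnorm w ^+ 2 = complex.Re (hdot H0 w (w - rho s xi)).
    by rewrite hdotBr orth// subr0 Re_hdotxx.
  have := hdot_le w (w - rho s xi); have := Re_cabs (hdot H0 w (w - rho s xi)).
  have := ler_norm (complex.Re (hdot H0 w (w - rho s xi))) => h1 h2 h3 h4.
  have : rnorm w * rnorm w <= rnorm w * d.
    rewrite -expr2 h4 (le_trans h1)// (le_trans h2)// (le_trans h3)//.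
    by rewrite ler_pM2l// ltW.
  by rewrite ler_pM2l.
apply: completion_eq => b Bb; have Bab : B t (a^# ** b).
  by apply: fiber1M => //; exact: subalg_star.
rewrite pm_repE// -(@cpl_dot_embedr R E _ _ Bab).
have -> : vec (a^# ** b) = 0.
  apply: completion_eq => x Bx; rewrite embedE//= /phi.
  have -> : x^# ** (a^# ** b) = (b^# ** a ** x)^# by rewrite !cstarM cstarK.
  have Sbax : S (b^# ** a ** x) by rewrite -cmulA; apply: BB => //; exact: fiber1M.
  rewrite (rep_star rep); last exact: subalg_star.
  by rewrite cstarK a0// hdot0r.
by rewrite -completion_hdotE hdot0r.
Qed.

Lemma induced_neq0 : exists a F, S a /\ lam a F <> 0.
Proof.
have [b Bb bxi] := xi_neq0; have Sbb : S (b ** b^#) by exact: fiberMV Bb (fiber_starV Bb).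
exists (b ** b^#), (vec b); split=> //; move=> h0; apply: bxi; apply: hdot_eq0.
have Bbbb : B t (b ** b^# ** b) by exact: fiber1M.
have : lam (b ** b^#) (vec b) b = 0 :> R[i] by rewrite h0.
rewrite pm_rep_embed// embedE//= /phi => <-; have Sb := BB Bb Bb.
have -> : b^# ** (b ** b^# ** b) = (b^# ** b) ** (b^# ** b) by ncring.
by rewrite (repM rep xi Sb Sb) [RHS](rep_star rep)// cstarM cstarK.
Qed.

End Induction.

Section DualMap.
Context (R : realType) (G : groupType) (A : cstarAlgType R) (B : fellBundle G A).
Local Notation S := (unit_fiber B).
Implicit Types (t : G) (P Q : Prim S).

Lemma dual_domP t P : dual_dom B t P <->
  exists a b, [/\ B t a, B (t^-1)%g b & ~ P (a ** b)].
Proof.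
split=> [Pt|[a [b [Ba Bb Pab]]] DP]; last first.
  by apply: Pab; apply: DP; exact: dual_ideal_gen.
apply: contrapT => h; apply: Pt; apply: mulspan_min; first exact: prim_closed_subspace.
by move=> a b Ba Bb; apply: contrapT => Pab; apply: h; exists a, b.
Qed.

(** The partial action is everywhere defined on its domain: [h_t(P)] is the
kernel of the representation induced by [B_t]. *)
Lemma exists_dual_map t P : dual_dom B (t^-1)%g P ->
  exists Q, [/\ dual_map B t P Q &
    forall a, Q a <-> S a /\ forall b c, B t b -> B t c -> P (b^# ** a ** c)].
Proof.
move=> Pt; have [a [b [Ba + Pab]]] := (dual_domP _ _).1 Pt; rewrite invgK => Bb.
have [H0 [rho [[rep _ irr] PE]]] := prim_primitive P.
have Pin c : P c <-> S c /\ forall v, rho c v = 0 by rewrite PE.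
have Sab : S (a ** b) by exact: fiberVM Ba Bb.
have Saa : S (a^# ** a) by exact: (fiber_star_mul Ba Ba).
have [xi abxi] : exists xi, rho (a ** b) xi <> 0.
  by apply/existsNP => ab0; apply/Pab/Pin.
have Sbb : S (b^# ** b) by exact: (fiber_star_mul Bb Bb).
have bbxi : rho (b^# ** b) xi <> 0.
  move=> bb0; apply/abxi/hdot_eq0.
  have [k [l [Sl kl]]] := sqrt_sub_star_mul Saa.
  have Bc : B t (k *: b + l ** b) by apply: fiberP => //; exact: fiber1M.
  have Sabs := subalg_star Sab.
  have Sabab : S ((a ** b)^# ** (a ** b)) by exact: subalg_mul.
  have := rep_fiber_ge0 rep xi Bc; rewrite -kl (repDl rep) ?(repNl rep) ?(repZl rep)//.
  - rewrite bb0 scaler0 sub0r -scaleN1r hdotZl mulN1r (repM rep xi Sabs Sab).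
    rewrite (rep_star rep)// cstarK oppr_ge0 => abab.
    by apply/le_anti; rewrite abab hdotxx ler0c sqr_ge0.
  - exact: csubZ.
  - exact: csubN.
have xi_neq0 : exists2 b, B t b & rho (b^# ** b) xi <> 0 by exists b.
pose M := @induced_module R G A B t H0 rho xi rep; pose lam := pm_rep (M := M).
have ker a' : S a' -> (forall F, lam a' F = 0) <->
    (forall b c, B t b -> B t c -> P (b^# ** a' ** c)).
  move=> Sa'; apply: (iff_trans (induced_kernel rep irr xi_neq0 Sa')).
  split=> h c d Bc Bd; last by have /Pin[] := h c d Bc Bd.
  apply/Pin; split; last exact: h.
  by rewrite -cmulA; apply: fiber_star_mul Bc _; exact: fiber1M.
have lamP : primitive S [set a | S a /\ forall F, lam a F = 0].
  exists (pm_hilbert M), lam; split=> //; split.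
  - exact: pm_representation.
  - by have [a' [F [Sa' aF]]] := induced_neq0 rep xi_neq0; exists a', F.
  - exact: induced_irreducible rep irr xi_neq0.
pose Q : Prim S := PrimIdeal lamP; exists Q.
have QE a' : Q a' <-> S a' /\ forall b c, B t b -> B t c -> P (b^# ** a' ** c).
  by split=> -[Sa' h]; split=> //; apply/ker.
split=> //; split=> //; last exact: induced_idealE.
apply/dual_domP; exists b, b^#; split=> //; first exact: fiber_starV.
move/QE => -[_ /(_ b b Bb Bb)].
have -> : b^# ** (b ** b^#) ** b = (b^# ** b)^# ** (b^# ** b).
  by rewrite cstarM cstarK; ncring.
by move=> /(prim_star_mul Sbb)/Pin[_ /(_ xi)].
Qed.

End DualMap.

(** * Open sets of primitive ideals *)

Section OpenPrim.
Context (R : realType) (A : cstarAlgType R) (S : cstar_subalgebra A).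
Implicit Types (P Q : Prim S) (U : set (Prim S)) (a b x : A).

Lemma open_primE U : open U = jacobson_open U.
Proof. by []. Qed.

Lemma open_prim_notin x : S x -> open [set P : Prim S | ~ P x].
Proof.
move=> Sx; rewrite open_primE => P kP /=.
by apply; apply: kP; split=> // Q; rewrite /setC /= => /contrapT.
Qed.

Lemma open_primP U P : open U -> U P ->
  exists u, [/\ S u, ~ P u & forall Q, ~ U Q -> Q u].
Proof.
rewrite open_primE => oU UP; apply: contrapT => h; apply: (oU P) => // u [Su kU].
by apply: contrapT => Pu; apply: h; exists u.
Qed.

(** For [x = a ** b] the element [x ** x^# ** x] has the form [a ** c ** b], and
its membership in [P] entails that of [x]. *)
Lemma prim_prime_mul P a b : S a -> S b -> ~ P a -> ~ P b ->
  exists2 c, S c & ~ P (a ** c ** b).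
Proof.
move=> Sa Sb Pa Pb; apply: contrapT => h.
have Pacb c : S c -> P (a ** c ** b).
  by move=> Sc; apply: contrapT => Pc; apply: h; exists c.
suff [] : P a \/ P b by [].
apply: prim_prime => //.
have Sab : S (a ** b) by exact: subalg_mul.
have Sabs := subalg_star Sab; have Sx : S ((a ** b)^# ** (a ** b)) by exact: subalg_mul.
apply: prim_star_mul => //; apply: prim_star_mul => //.
have -> : ((a ** b)^# ** (a ** b))^# ** ((a ** b)^# ** (a ** b)) =
    (a ** b)^# ** (a ** (b ** (a ** b)^# ** a) ** b).
  by rewrite cstarM cstarK; ncring.
by apply: prim_mull => //; apply: Pacb; do !apply: subalg_mul => //.
Qed.

Lemma prim_all_eq0 x : S x -> (forall P, P x) -> x = 0.
Proof.
by move=> Sx Px; apply: contrapT => x0; have [P] := prim_separates Sx x0; apply.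
Qed.

End OpenPrim.

Lemma open_dual_dom (R : realType) (G : groupType) (A : cstarAlgType R)
  (B : fellBundle G A) (t : G) : open (dual_dom B t).
Proof.
rewrite open_primE => P kP Pt; apply: Pt => a Da.
by apply: kP; split=> [|Q /contrapT]; [exact: dual_ideal_sub Da|exact].
Qed.

(** * Aperiodicity *)

Section Aperiodic.
Context (R : realType) (G : groupType) (A : cstarAlgType R) (B : fellBundle G A).
Local Notation S := (unit_fiber B).
Implicit Types (t : G) (a b x : A) (P : Prim S).

(** [(p ** d)^# ** (p ** d)] is below a multiple of [d^# ** d]. *)
Lemma hereditary_mul (D : cstar_subalgebra A) p d : hereditary S D -> S p -> D d ->
  D ((p ** d)^# ** (p ** d)).
Proof.
move=> [DS her] Sp Dd; have Sd := DS _ Dd.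
have Spp : S (p^# ** p) by apply/subalg_mul => //; exact: subalg_star.
have [k [l [Sl kl]]] := sqrt_sub_star_mul Spp.
apply: (her ((rnorm p ^+ 2)%:C%C *: (d^# ** d))).
- by apply/csubZ/subalg_mul => //; exact: subalg_star.
- by exists (p ** d) => //; exact: subalg_mul.
- by rewrite kl; exists (k *: d + l ** d) => //; apply: csubP => //; exact: subalg_mul.
Qed.

(** A nonzero element compressing [b] to [0] gives the infimum of aperiodicity,
which is then attained. *)
Lemma compression_inf (D : cstar_subalgebra A) b x : D x -> x <> 0 ->
  (x^# ** x) ** b ** (x^# ** x) = 0 ->
  ereal_inf [set (rnorm (a ** b ** a))%:E
            | a in [set a | positive_in D a /\ rnorm a = 1]] = 0%E.
Proof.
move=> Dx x0 xbx; apply/le_anti/andP; split; last first.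
  by apply: le_ereal_inf_tmp => _ [a _ <-]; rewrite lee_fin rnorm_ge0.
have xn : rnorm x != 0 by rewrite gt_eqF// rnorm_gt0.
pose y := ((rnorm x)^-1)%:C%C *: x; apply: ereal_inf_lbound.
exists (y^# ** y).
  split; first by exists y => //; exact: csubZ.
  rewrite rnorm_CN rnormZr ger0_norm ?invr_ge0 ?rnorm_ge0// mulVf// expr1n//.
rewrite cstarZr !(cmulZl, cmulZr) xbx !scaler0; congr EFin; exact: rnorm0.
Qed.

(** Either some primitive ideal [P], in the domain of [h_t] and not containing
[D], is moved to another one [Q] by [h_t]; then [u] and [v] below come from
disjoint neighbourhoods of [P] and [Q], so that [u ** s ** v^#] is in every
primitive ideal. Or there is no such [P] in the domain, and [b^# ** b ** d] is in
every primitive ideal. *)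
Lemma exists_compression t (D : cstar_subalgebra A) b :
  hausdorff_space (Prim S) -> topologically_free (dual_dom B) (dual_map B) ->
  t <> 1%g -> B t b -> hereditary S D -> (exists2 d, D d & d <> 0) ->
  exists x, [/\ D x, x <> 0 & (x^# ** x) ** b ** (x^# ** x) = 0].
Proof.
move=> hausB tfB t1 Bb herD [d0 Dd0 d0_neq0]; have [DS _] := herD.
set d := d0^# ** d0.
have Dd : D d by apply/subalg_mul => //; exact: subalg_star.
have Sd : S d := DS _ Dd.
pose W := [set P : Prim S | ~ P d] `&` dual_dom B (t^-1)%g.
have [W0|Wn] := pselect (W = set0).
  have bbd : b^# ** b ** d = 0.
    have Sbb : S (b^# ** b) by exact: (fiber_star_mul Bb Bb).
    apply: (@prim_all_eq0 _ _ S) => [|P]; first exact: subalg_mul.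
    have [Pd|Pd] := pselect (P d); first exact: prim_mull.
    apply: prim_mulr => //.
    have : ~ W P by rewrite W0.
    move=> /not_andP[//|/contrapT]; apply; apply: dual_ideal_gen.
      exact: fiber_starV.
    by rewrite invgK.
  have bd : b ** d = 0.
    apply: cstar_mul_eq0; rewrite cstarM.
    by rewrite -cmulA [b^# ** _]cmulA bbd cmul0r.
  by exists d0; split=> //; rewrite -/d -cmulA bd cmul0r.
have [P [[Pd Pt] PP]] : exists P, W P /\ ~ dual_map B t P P.
  apply: contrapT => h; have [P0 WP0] : W !=set0 by apply/set0P/eqP.
  have /(_ P0) : interior (\bigcup_(s in [set t])
      [set x | dual_dom B (s^-1)%g x /\ dual_map B s x x]) `<=` set0.
    by rewrite tfB// => /esym.
  apply; exists W; split=> //.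
    exact: openI (open_prim_notin Sd) (@open_dual_dom _ _ _ B _).
  move=> P WP; exists t => //; split; first by case: WP.
  by apply: contrapT => PP; apply: h; exists P.
have [Q [PQ QE]] := exists_dual_map Pt.
have nPQ : P != Q by apply/eqP => PQE; apply: PP; rewrite {2}PQE.
move: hausB; rewrite open_hausdorff => /(_ P Q nPQ).
move=> [[U V] /= [/set_mem UP /set_mem VQ] [oU oV UV]].
have [u [Su Pu uP]] := open_primP oU UP; have [v [Sv Qv vP]] := open_primP oV VQ.
have Svs := subalg_star Sv.
have uv s : S s -> u ** s ** v^# = 0.
  move=> Ss; have Sus : S (u ** s) by exact: subalg_mul.
  apply: (@prim_all_eq0 _ _ S) => [|L]; first exact: subalg_mul.
  have [UL|UL] := pselect (U L).
    apply: prim_mull => //; apply/prim_star/vP => VL.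
    by move/eqP: UV => /(congr1 (fun X => X L)) UVL; have : set0 L by rewrite -UVL.
  by apply: prim_mulr => //; apply: prim_mulr => //; exact: uP.
have [c [c' [Bc Bc' Pz]]] : exists c c', [/\ B t c, B t c' & ~ P (c^# ** v ** c')].
  apply: contrapT => h; apply/Qv/QE; split=> // c c' Bc Bc'.
  by apply: contrapT => Pz; apply: h; exists c, c'.
set z := c^# ** v ** c' in Pz.
have Sz : S z by rewrite /z -cmulA; apply: fiber_star_mul Bc _; exact: fiber1M.
have [s1 Ss1 Pus] := prim_prime_mul Su Sz Pu Pz.
have Sus : S (u ** s1 ** z) by do !apply: subalg_mul => //.
have [s2 Ss2 Py] := prim_prime_mul Sus Sd Pus Pd.
set p := u ** s1 ** z ** s2; have Sp : S p by exact: subalg_mul.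
set y := p ** d; set e := y^# ** y.
have De : D e by exact: hereditary_mul.
have esa : e^# = e by rewrite cstarM cstarK.
have e0 : e <> 0.
  move=> /cstar_mul_eq0 y0; apply: Py; rewrite -/p -/y y0.
  by have [] := prim_closed_subspace P.
have yby : y ** b ** y^# = 0.
  have -> : y ** b ** y^# = u ** (s1 ** z ** s2 ** d ** (b ** (d ** s2^#) ** c'^#)) ** v^#
      ** (c ** s1^# ** u^#).
    by rewrite /y /p /z /d !cstarM !cstarK; ncring.
  rewrite uv ?cmul0l//.
  have Bbs : B t (b ** (d ** s2^#)).
    by apply: fiberM1 => //; apply: subalg_mul => //; exact: subalg_star.
  have Sbs := fiberMV Bbs (fiber_starV Bc').
  by do !apply: subalg_mul => //.
exists e; split=> //; rewrite esa.
have -> : e ** e ** b ** (e ** e) = e ** y^# ** (y ** b ** y^#) ** y ** e.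
  by rewrite /e; ncring.
by rewrite yby cmul0r !cmul0l.
Qed.

End Aperiodic.

Theorem proposition4p5 (R : realType) (G : groupType) (A : cstarAlgType R)
    (B : fellBundle G A) :
  hausdorff_space (Prim (unit_fiber B)) ->
  topologically_free (dual_dom B) (dual_map B) ->
  aperiodic B.
Proof.
move=> hausB tfB t b D t1 Bb herD D0.
have [x [Dx x0 xbx]] := exists_compression hausB tfB t1 Bb herD D0.
exact: compression_inf xbx.
Qed.
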